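(* Fix a prime number $p$, a positive integer $r$ and a field $k$ of characteristic zero. Let $\mathscr{A}(p)_{\leq r}$ be the family of finite abelian $p$-groups of $p$-rank at most $r$. Let $\mathbb{N}^+=\mathbb{N}\cup\{\infty\}$ be the one-point compactification of the discrete space $\mathbb{N}$. Then the Balmer spectrum $\mathrm{Spc}(\mathsf{D}(\mathscr{A}(p)_{\leq r})^c)$ is Hausdorff and homeomorphic to $$\widehat{\mathcal{S}}_{\leq r}=\{v=(v_1,\ldots,v_r)\in(\mathbb{N}^+)^r\mid \infty\geq v_1\geq\cdots\geq v_r\geq 0\},$$ equipped with the subspace topology from $(\mathbb{N}^+)^r$. Furthermore, the Cantor--Bendixson rank of the spectrum is precisely $r$.
   Context: $\mathbb{N}=\{0,1,2,\dots\}$. Let $\mathscr{G}$ be the category of finite groups whose morphisms are conjugacy classes of surjective group homomorphisms. For a full subcategory $\mathscr{U}\subseteq\mathscr{G}$ closed under isomorphism, $\mathsf{D}(\mathscr{U})$ is the derived category of the abelian category $\mathsf{A}(\mathscr{U})=\mathrm{Fun}(\mathscr{U}^{\mathrm{op}},\mathrm{Mod}_k)$, with the pointwise tensor product over $k$, and $\mathsf{D}(\mathscr{U})^c$ is its full subcategory of compact objects. For $\mathscr{U}=\mathscr{A}(p)_{\leq r}$ (a full subcategory of $\mathscr{G}$), $\mathsf{D}(\mathscr{U})^c$ is an essentially small tensor-triangulated category. The Balmer spectrum $\mathrm{Spc}(\mathscr{K})$ of an essentially small tensor-triangulated category $\mathscr{K}$ is the set of prime thick ideals of $\mathscr{K}$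 (thick = triangulated and closed under retracts; ideal = closed under tensoring with any object; prime = proper and $X\otimes Y\in\mathfrak{p}$ implies $X\in\mathfrak{p}$ or $Y\in\mathfrak{p}$), with the topology having the sets $\mathrm{supp}(X)=\{\mathfrak{p}\mid X\notin\mathfrak{p}\}$, $X\in\mathscr{K}$, as a basis of closed sets. Cantor--Bendixson rank: for a topological space $X$ let $\delta X$ be the subspace of non-isolated points; put $\delta^0X=X$, $\delta^{\alpha+1}X=\delta\delta^{\alpha}X$ and $\delta^\alpha X=\bigcap_{\beta<\alpha}\delta^\beta X$ for limit ordinals $\alpha$. For non-empty $X$ the Cantor--Bendixson rank is $\sup\{\alpha\mid\delta^\alpha X\neq\varnothing\}$ if this supremum exists and $\infty$ otherwise. *)

(* Defs.v *)
From Stdlib Require List.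
From HB Require Import structures.
From mathcomp Require Import fingroup quotient pgroup abelian.
From mathcomp Require Import all_boot all_order all_algebra.
From mathcomp Require Import generic_quotient.
From mathcomp Require Import boolp classical_sets topology_structure.
From mathcomp Require Import function_spaces nat_topology.
From mathcomp Require Import one_point_compactification subtype_topology.

Set Implicit Arguments.
Unset Strict Implicit.
Unset Printing Implicit Defensive.

Import GRing.Theory.

Local Open Scope ring_scope.
Local Open Scope quotient_scope.

(* Vector spaces presented by generators and relations: the library has neither
   direct sums over arbitrary index types nor tensor products of
   infinite-dimensional spaces. *)

Inductive lterm (k : fieldType) (S : Type) : Type :=
| LGen of S
| LZero
| LOpp of lterm k S
| LAdd of lterm k S & lterm k S
| LScale of k & lterm k S.
Arguments LGen {k S}.
Arguments LZero {k S}.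

Section Presented.
Context (k : fieldType) (S : Type) (rel : lterm k S -> lterm k S -> Prop).

(* The least congruence containing [rel] and the axioms of k-vector spaces. *)
Inductive lcong : lterm k S -> lterm k S -> Prop :=
| lcong_rel a b : rel a b -> lcong a b
| lcong_refl a : lcong a a
| lcong_sym a b : lcong a b -> lcong b a
| lcong_trans b a c : lcong a b -> lcong b c -> lcong a c
| lcong_opp a b : lcong a b -> lcong (LOpp a) (LOpp b)
| lcong_add a a' b b' :
    lcong a a' -> lcong b b' -> lcong (LAdd a b) (LAdd a' b')
| lcong_scale c a b : lcong a b -> lcong (LScale c a) (LScale c b)
| lcong_addA a b c : lcong (LAdd a (LAdd b c)) (LAdd (LAdd a b) c)
| lcong_addC a b : lcong (LAdd a b) (LAdd b a)
| lcong_add0 a : lcong (LAdd LZero a) a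
| lcong_addN a : lcong (LAdd (LOpp a) a) LZero
| lcong_scaleA c d a : lcong (LScale c (LScale d a)) (LScale (c * d) a)
| lcong_scale1 a : lcong (LScale 1 a) a
| lcong_scaleDr c a b :
    lcong (LScale c (LAdd a b)) (LAdd (LScale c a) (LScale c b))
| lcong_scaleDl a c d :
    lcong (LScale (c + d) a) (LAdd (LScale c a) (LScale d a)).

HB.instance Definition _ := gen_eqMixin (lterm k S).
HB.instance Definition _ := gen_choiceMixin (lterm k S).

Definition lcongb (a b : lterm k S) : bool := `[< lcong a b >].

Lemma lcongb_refl : reflexive lcongb.
Proof. by move=> a; apply/asboolP; exact: lcong_refl. Qed.

Lemma lcongb_sym : symmetric lcongb.
Proof. by move=> a b; apply/asboolP/asboolP; exact: lcong_sym. Qed.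

Lemma lcongb_trans : transitive lcongb.
Proof.
by move=> b a c /asboolP ab /asboolP bc; apply/asboolP; exact: lcong_trans bc.
Qed.

Canonical lcongb_equiv :=
  EquivRel lcongb lcongb_refl lcongb_sym lcongb_trans.

Definition pres := {eq_quot lcongb}.
HB.instance Definition _ := Choice.on pres.

Definition ppi (a : lterm k S) : pres := \pi_pres a.

Lemma ppiP a b : ppi a = ppi b <-> lcong a b.
Proof.
by split=> [/eqmodP/asboolP //|ab]; apply/eqmodP/asboolP.
Qed.

Lemma ppi_repr x : ppi (repr x) = x.
Proof. exact: reprK. Qed.

Lemma lcong_repr a : lcong (repr (ppi a)) a.
Proof. by apply/ppiP; rewrite ppi_repr. Qed.

Definition padd (x y : pres) := ppi (LAdd (repr x) (repr y)).
Definition popp (x : pres) := ppi (LOpp (repr x)).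
Definition pzero := ppi LZero.
Definition pscale (c : k) (x : pres) := ppi (LScale c (repr x)).

Lemma ppiD a b : padd (ppi a) (ppi b) = ppi (LAdd a b).
Proof. by apply/ppiP; apply: lcong_add; exact: lcong_repr. Qed.

Lemma ppiN a : popp (ppi a) = ppi (LOpp a).
Proof. by apply/ppiP; apply: lcong_opp; exact: lcong_repr. Qed.

Lemma ppiZ c a : pscale c (ppi a) = ppi (LScale c a).
Proof. by apply/ppiP; apply: lcong_scale; exact: lcong_repr. Qed.

Lemma paddA : associative padd.
Proof.
move=> x y z; rewrite -(ppi_repr x) -(ppi_repr y) -(ppi_repr z) !ppiD.
by apply/ppiP; exact: lcong_addA.
Qed.

Lemma paddC : commutative padd.
Proof. by move=> x y; apply/ppiP; exact: lcong_addC. Qed.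

Lemma padd0 : left_id pzero padd.
Proof.
by move=> x; rewrite -(ppi_repr x) ppiD; apply/ppiP; exact: lcong_add0.
Qed.

Lemma paddN : left_inverse pzero popp padd.
Proof.
by move=> x; rewrite -(ppi_repr x) ppiN ppiD; apply/ppiP; exact: lcong_addN.
Qed.

HB.instance Definition _ := GRing.isZmodule.Build pres paddA paddC padd0 paddN.

Lemma pscaleA c d x : pscale c (pscale d x) = pscale (c * d) x.
Proof.
by rewrite -(ppi_repr x) !ppiZ; apply/ppiP; exact: lcong_scaleA.
Qed.

Lemma pscale1 : left_id 1 pscale.
Proof.
by move=> x; rewrite -(ppi_repr x) ppiZ; apply/ppiP; exact: lcong_scale1.
Qed.

Lemma pscaleDr : right_distributive pscale +%R.
Proof.
move=> c x y; rewrite -(ppi_repr x) -(ppi_repr y).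
change (pscale c (padd (ppi (repr x)) (ppi (repr y))) =
  padd (pscale c (ppi (repr x))) (pscale c (ppi (repr y)))).
by rewrite ppiD !ppiZ ppiD; apply/ppiP; exact: lcong_scaleDr.
Qed.

Lemma pscaleDl x : {morph pscale^~ x : c d / c + d}.
Proof.
move=> c d /=; rewrite -(ppi_repr x).
change (pscale (c + d) (ppi (repr x)) =
  padd (pscale c (ppi (repr x))) (pscale d (ppi (repr x)))).
by rewrite !ppiZ ppiD; apply/ppiP; exact: lcong_scaleDl.
Qed.

HB.instance Definition _ :=
  GRing.Zmodule_isLmodule.Build k pres pscaleA pscale1 pscaleDr pscaleDl.

Definition pgen (s : S) : pres := ppi (LGen s).

Lemma pres_ind (P : pres -> Prop) :
  (forall s, P (pgen s)) -> P 0 -> (forall x, P x -> P (- x)) ->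
  (forall x y, P x -> P y -> P (x + y)) -> (forall c x, P x -> P (c *: x)) ->
  forall x, P x.
Proof.
move=> Pg P0 PN PD PZ x; rewrite -(ppi_repr x).
elim: (repr x) => {x} [s||a Pa|a Pa b Pb|c a Pa]; first exact: Pg.
- exact: P0.
- by rewrite -ppiN; exact: PN.
- by rewrite -ppiD; exact: PD.
- by rewrite -ppiZ; exact: PZ.
Qed.

Section Rec.
Context (W : lmodType k) (f : S -> W).

Fixpoint leval (a : lterm k S) : W :=
  match a with
  | LGen s => f s
  | LZero => 0
  | LOpp a => - leval a
  | LAdd a b => leval a + leval b
  | LScale c a => c *: leval a
  end.

Hypothesis fP : forall a b, rel a b -> leval a = leval b.

Lemma leval_cong a b : lcong a b -> leval a = leval b.
Proof.
elim=> //= {a b}.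
- by move=> b a c _ -> _ ->.
- by move=> a b _ ->.
- by move=> a a' b b' _ -> _ ->.
- by move=> c a b _ ->.
- by move=> *; rewrite addrA.
- by move=> *; rewrite addrC.
- by move=> *; rewrite add0r.
- by move=> *; rewrite addNr.
- by move=> *; rewrite scalerA.
- by move=> *; rewrite scale1r.
- by move=> *; rewrite scalerDr.
- by move=> *; rewrite scalerDl.
Qed.

Definition pres_rec_fun (x : pres) : W := leval (repr x).

Lemma pres_rec_linear : linear pres_rec_fun.
Proof.
move=> c x y; rewrite /pres_rec_fun.
rewrite (leval_cong (b := LAdd (LScale c (repr x)) (repr y))) //.
apply/ppiP; rewrite ppi_repr -ppiD -ppiZ !ppi_repr.
by [].
Qed.

HB.instance Definition _ :=
  GRing.isLinear.Build k pres W *:%R pres_rec_fun pres_rec_linear.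

Definition pres_rec : {linear pres -> W} := pres_rec_fun.

Lemma pres_recE s : pres_rec (pgen s) = f s.
Proof. exact: leval_cong (lcong_repr _). Qed.

End Rec.

Lemma pres_ext (W : lmodType k) (f g : {linear pres -> W}) :
  (forall s, f (pgen s) = g (pgen s)) -> forall x, f x = g x.
Proof.
move=> fg; apply: pres_ind => [s||x|x y|c x]; first exact: fg.
- by rewrite !linear0.
- by rewrite !linearN => ->.
- by rewrite !linearD => -> ->.
- by rewrite !linearZ => ->.
Qed.

End Presented.

Definition lcomp (k : fieldType) (V W Z : lmodType k) (g : {linear W -> Z})
  (f : {linear V -> W}) : {linear V -> Z} := g \o f.

Lemma lcompE (k : fieldType) (V W Z : lmodType k) (g : {linear W -> Z})
  (f : {linear V -> W}) x : lcomp g f x = g (f x).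
Proof. by []. Qed.

Section DirectSum.
Context (k : fieldType) (I : Type) (V : I -> lmodType k).

Inductive dsum_rel :
    lterm k {i : I & V i} -> lterm k {i : I & V i} -> Prop :=
| dsum_relD i (x y : V i) :
    dsum_rel (LGen (existT _ i (x + y)))
             (LAdd (LGen (existT _ i x)) (LGen (existT _ i y)))
| dsum_relZ i c (x : V i) :
    dsum_rel (LGen (existT _ i (c *: x))) (LScale c (LGen (existT _ i x))).

Definition dsum : lmodType k := pres dsum_rel.

Definition dsum_in_fun (i : I) (x : V i) : dsum := pgen dsum_rel (existT _ i x).

Lemma dsum_in_linear i : linear (@dsum_in_fun i).
Proof.
move=> c x y; rewrite /dsum_in_fun.
transitivity (ppi dsum_rel
  (LAdd (LScale c (LGen (existT _ i x))) (LGen (existT _ i y)))).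
  apply/ppiP; apply: lcong_trans (lcong_rel (dsum_relD _ _)) _.
  by apply: lcong_add; [exact/lcong_rel/dsum_relZ | exact: lcong_refl].
by rewrite -ppiD -ppiZ.
Qed.

HB.instance Definition _ i :=
  GRing.isLinear.Build k (V i) dsum *:%R (@dsum_in_fun i) (@dsum_in_linear i).

Definition dsum_in i : {linear V i -> dsum} := @dsum_in_fun i.

Lemma dsum_ext (W : lmodType k) (f g : {linear dsum -> W}) :
  (forall i (x : V i), f (dsum_in i x) = g (dsum_in i x)) ->
  forall z, f z = g z.
Proof. by move=> fg; apply: pres_ext => -[i x]; exact: fg. Qed.

Section Rec.
Context (W : lmodType k) (f : forall i, {linear V i -> W}).

Lemma dsum_recP a b : dsum_rel a b ->
  leval (fun s : {i : I & V i} => f (projT1 s) (projT2 s)) a =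
  leval (fun s : {i : I & V i} => f (projT1 s) (projT2 s)) b.
Proof. by case=> [i x y|i c x] /=; rewrite (linearD, linearZ). Qed.

Definition dsum_rec : {linear dsum -> W} := pres_rec dsum_recP.

Lemma dsum_recE i x : dsum_rec (dsum_in i x) = f i x.
Proof. exact: (pres_recE dsum_recP). Qed.

End Rec.
End DirectSum.
Arguments dsum_in {k I} V i.

Section Tensor.
Context (k : fieldType) (V W : lmodType k).

Inductive tens_rel : lterm k (V * W) -> lterm k (V * W) -> Prop :=
| tens_relDl x x' y :
    tens_rel (LGen (x + x', y)) (LAdd (LGen (x, y)) (LGen (x', y)))
| tens_relDr x y y' :
    tens_rel (LGen (x, y + y')) (LAdd (LGen (x, y)) (LGen (x, y')))
| tens_relZl c x y : tens_rel (LGen (c *: x, y)) (LScale c (LGen (x, y)))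
| tens_relZr c x y : tens_rel (LGen (x, c *: y)) (LScale c (LGen (x, y))).

Definition tens : lmodType k := pres tens_rel.

Definition tpure (x : V) (y : W) : tens := pgen tens_rel (x, y).

Lemma tpureDl x x' y : tpure (x + x') y = tpure x y + tpure x' y.
Proof.
transitivity (ppi tens_rel (LAdd (LGen (x, y)) (LGen (x', y)))).
  by apply/ppiP/lcong_rel/tens_relDl.
by rewrite -ppiD.
Qed.

Lemma tpureDr x y y' : tpure x (y + y') = tpure x y + tpure x y'.
Proof.
transitivity (ppi tens_rel (LAdd (LGen (x, y)) (LGen (x, y')))).
  by apply/ppiP/lcong_rel/tens_relDr.
by rewrite -ppiD.
Qed.

Lemma tpureZl c x y : tpure (c *: x) y = c *: tpure x y.
Proof.
transitivity (ppi tens_rel (LScale c (LGen (x, y)))).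
  by apply/ppiP/lcong_rel/tens_relZl.
by rewrite -ppiZ.
Qed.

Lemma tpureZr c x y : tpure x (c *: y) = c *: tpure x y.
Proof.
transitivity (ppi tens_rel (LScale c (LGen (x, y)))).
  by apply/ppiP/lcong_rel/tens_relZr.
by rewrite -ppiZ.
Qed.

Lemma tens_ext (Z : lmodType k) (f g : {linear tens -> Z}) :
  (forall x y, f (tpure x y) = g (tpure x y)) -> forall z, f z = g z.
Proof. by move=> fg; apply: pres_ext => -[x y]; exact: fg. Qed.

End Tensor.

Section TensorMap.
Context (k : fieldType) (V W V' W' : lmodType k).
Context (f : {linear V -> V'}) (g : {linear W -> W'}).

Lemma tens_mapP a b : tens_rel a b ->
  leval (fun s : V * W => tpure (f s.1) (g s.2)) a =
  leval (fun s : V * W => tpure (f s.1) (g s.2)) b.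
Proof.
by case=> *; rewrite /= ?linearD ?linearZ /= ?(tpureDl, tpureDr, tpureZl, tpureZr).
Qed.

Definition tens_map : {linear tens V W -> tens V' W'} := pres_rec tens_mapP.

Lemma tens_mapE x y : tens_map (tpure x y) = tpure (f x) (g y).
Proof. exact: (pres_recE tens_mapP). Qed.

End TensorMap.

Definition lin_fun (k : fieldType) (V W : lmodType k) (f : V -> W)
  & linear f := f.
Arguments lin_fun {k V W f} _ /.

HB.instance Definition _ (k : fieldType) (V W : lmodType k) (f : V -> W)
    (fP : linear f) :=
  GRing.isLinear.Build k V W *:%R (lin_fun fP) fP.

Definition mklin (k : fieldType) (V W : lmodType k) (f : V -> W)
  (fP : linear f) : {linear V -> W} := lin_fun fP.

Section ProdMaps.
Context (k : fieldType) (V W V' W' : lmodType k).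

Section Pair.
Context (f : {linear V -> V'}) (g : {linear W -> W'}).

Lemma pair_map_linear :
  linear ((fun z => (f z.1, g z.2)) : V * W -> V' * W').
Proof. by move=> c x y; congr pair; rewrite /= linearP. Qed.

Definition pair_map := mklin pair_map_linear.
End Pair.

Section Cone.
Context (d : {linear V -> V'}) (f : {linear V -> W'}) (e : {linear W -> W'}).

Lemma cone_map_linear :
  linear ((fun z => (- d z.1, f z.1 + e z.2)) : V * W -> V' * W').
Proof.
move=> c x y; congr pair; rewrite /=.
  by rewrite (linearP d) opprD scalerN.
by rewrite (linearP f) (linearP e) scalerDr addrACA.
Qed.

Definition cone_map := mklin cone_map_linear.
End Cone.

Lemma pair_inr_linear : linear ((fun y => (0, y)) : W -> V * W).
Proof. by move=> c x y; congr pair; rewrite /= scaler0 addr0. Qed.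

Definition pair_inr := mklin pair_inr_linear.

Lemma pair_swap_linear : linear ((fun z => (z.2, z.1)) : V * W -> W * V).
Proof. by []. Qed.

Definition pair_swap := mklin pair_swap_linear.

Lemma pair_diag_linear : linear ((fun x => (x, x)) : V -> V * V).
Proof. by []. Qed.

Definition pair_diag := mklin pair_diag_linear.

Lemma pair_fold_linear : linear ((fun z => z.1 + z.2) : V * V -> V).
Proof. by move=> c x y; rewrite /= scalerDr addrACA. Qed.

Definition pair_fold := mklin pair_fold_linear.

Lemma pair_fst_linear : linear (fst : V * W -> V).
Proof. by []. Qed.

Definition pair_fst := mklin pair_fst_linear.

End ProdMaps.

#[local] Obligation Tactic := idtac.

Record epi (G H : finGroupType) := Epi {
  epi_fun :> {multiplicative G -> H};
  epi_surj : forall y, exists x, epi_fun x = y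
}.

Definition epi_id (G : finGroupType) : epi G G :=
  @Epi G G idfun (fun y => ex_intro _ y erefl).

Lemma epi_comp_surj (G H K : finGroupType) (g : epi H K) (f : epi G H) y :
  exists x, (g \o f) x = y.
Proof.
have [z <-] := epi_surj g y; have [x <-] := epi_surj f z; by exists x.
Qed.

Definition epi_comp (G H K : finGroupType) (g : epi H K) (f : epi G H) :
  epi G K := @Epi G K (g \o f) (epi_comp_surj g f).

Definition epi_conj (G H : finGroupType) (f g : epi G H) : Prop :=
  exists h : H, forall x, g x = (f x ^ h)%g.

(* The objects of the full subcategory spanned by the groups satisfying [U];
   a morphism from [A] to [B] is an [epi A B] up to [epi_conj]. *)
Record grp (U : finGroupType -> Prop) := Grp {
  grp_group :> finGroupType;
  grpP : U grp_group
}.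

Definition abelian_p_rank_le (p r : nat) (G : finGroupType) : Prop :=
  [/\ abelian [set: G], (p.-group [set: G])%g & ('r_p([set: G])%g <= r)%N].

Section Derived.
Context (k : fieldType) (U : finGroupType -> Prop).
Implicit Types A B C : grp U.

(* An object of A(U); by [res_conj], [res] is defined on conjugacy classes. *)
Record rep := Rep {
  rep_ob :> grp U -> lmodType k;
  res : forall A B, epi A B -> {linear rep_ob B -> rep_ob A};
  res_id : forall A x, res (epi_id A) x = x;
  res_comp : forall A B C (g : epi B C) (f : epi A B) x,
    res (epi_comp g f) x = res f (res g x);
  res_conj : forall A B (f g : epi A B) x, epi_conj f g -> res f x = res g x
}.

Record rhom (F G : rep) := RHom {
  rhom_at :> forall A, {linear F A -> G A};
  rhom_nat : forall A B (f : epi A B) x,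
    rhom_at A (res F f x) = res G f (rhom_at B x)
}.

Definition rhom_id (F : rep) : rhom F F :=
  @RHom F F (fun A => idfun) (fun _ _ _ _ => erefl).

Program Definition rhom_comp (F G H : rep) (g : rhom G H) (f : rhom F G) :
  rhom F H := @RHom F H (fun A => g A \o f A) _.
Next Obligation. by move=> F G H g f A B e x /=; rewrite !rhom_nat. Qed.

Program Definition rep_prod (F G : rep) : rep :=
  @Rep (fun A => (F A * G A)%type) (fun A B f => pair_map (res F f) (res G f))
    _ _ _.
Next Obligation.
by move=> F G A [x y]; rewrite /= !res_id.
Qed.
Next Obligation.
by move=> F G A B C g f x; rewrite /= !res_comp.
Qed.
Next Obligation.
by move=> F G A B f g x fg; rewrite /= !(res_conj _ fg).
Qed.

Program Definition rep_tens (F G : rep) : rep :=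
  @Rep (fun A => tens (F A) (G A)) (fun A B f => tens_map (res F f) (res G f))
    _ _ _.
Next Obligation.
move=> F G A; apply: (@tens_ext _ _ _ _ (tens_map _ _) idfun) => x y.
by rewrite tens_mapE !res_id.
Qed.
Next Obligation.
move=> F G A B C g f.
apply: (@tens_ext _ _ _ _ (tens_map _ _) (lcomp (tens_map _ _) (tens_map _ _))).
by move=> x y; rewrite lcompE !tens_mapE !res_comp.
Qed.
Next Obligation.
move=> F G A B f g + fg; apply: tens_ext => x y.
by rewrite !tens_mapE !(res_conj _ fg).
Qed.

Program Definition rep_dsum (I : Type) (F : I -> rep) : rep :=
  @Rep (fun A => dsum (fun i => F i A))
    (fun A B f => dsum_rec (fun i => lcomp (dsum_in (fun i => F i A) i) (res (F i) f)))
    _ _ _.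
Next Obligation.
move=> I F A; apply: (@dsum_ext _ _ _ _ (dsum_rec _) idfun) => i x.
by rewrite dsum_recE lcompE res_id.
Qed.
Next Obligation.
move=> I F A B C g f.
apply: (@dsum_ext _ _ _ _ (dsum_rec _) (lcomp (dsum_rec _) (dsum_rec _))) => i x.
by rewrite !(lcompE, dsum_recE) res_comp.
Qed.
Next Obligation.
move=> I F A B f g + fg; apply: dsum_ext => i x.
by rewrite !(dsum_recE, lcompE) (res_conj _ fg).
Qed.

Record cpx := Cpx {
  cob :> int -> rep;
  cd : forall n, rhom (cob n) (cob (n - 1));
  cdd : forall n A (x : cob n A), cd (n - 1) A (cd n A x) = 0
}.

Record cmap (X Y : cpx) := CMap {
  cmap_at :> forall n, rhom (X n) (Y n);
  cmap_d : forall n A (x : X n A),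
    cmap_at (n - 1) A (cd X n A x) = cd Y n A (cmap_at n A x)
}.

Definition cmap_eq (X Y : cpx) (f g : cmap X Y) : Prop :=
  forall n A (x : X n A), f n A x = g n A x.

Definition cmap_id (X : cpx) : cmap X X :=
  @CMap X X (fun n => rhom_id (X n)) (fun _ _ _ => erefl).

Program Definition cmap_comp (X Y Z : cpx) (g : cmap Y Z) (f : cmap X Y) :
  cmap X Z := @CMap X Z (fun n => rhom_comp (g n) (f n)) _.
Next Obligation. by move=> X Y Z g f n A x; rewrite /= !cmap_d. Qed.

(* Bijectivity of the induced map on homology in degree n - 1, for all n;
   kernels, cokernels and hence homology in A(U) are computed pointwise. *)
Definition quasi_iso (X Y : cpx) (f : cmap X Y) : Prop :=
  forall n A,
    (forall x : X (n - 1) A, cd X (n - 1) A x = 0 ->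
       (exists y : Y n A, f (n - 1) A x = cd Y n A y) ->
       exists z : X n A, x = cd X n A z) /\
    (forall y : Y (n - 1) A, cd Y (n - 1) A y = 0 ->
       exists2 x : X (n - 1) A, cd X (n - 1) A x = 0 &
         exists z : Y n A, y = f (n - 1) A x + cd Y n A z).

(* The morphisms of D(U) are those of the localization of the category of
   complexes at the quasi-isomorphisms: formal composites of chain maps and of
   inverses of quasi-isomorphisms, up to [deq]. *)
Inductive dhom : cpx -> cpx -> Type :=
| DMap X Y of cmap X Y : dhom X Y
| DInv X Y (s : cmap X Y) of quasi_iso s : dhom Y X
| DComp X Y Z of dhom Y Z & dhom X Y : dhom X Z.

Definition did (X : cpx) : dhom X X := DMap (cmap_id X).

Inductive deq : forall X Y, dhom X Y -> dhom X Y -> Prop :=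
| deq_refl X Y (f : dhom X Y) : deq f f
| deq_sym X Y (f g : dhom X Y) : deq f g -> deq g f
| deq_trans X Y (f g h : dhom X Y) : deq f g -> deq g h -> deq f h
| deq_comp X Y Z (g g' : dhom Y Z) (f f' : dhom X Y) :
    deq g g' -> deq f f' -> deq (DComp g f) (DComp g' f')
| deq_compA X Y Z T (h : dhom Z T) (g : dhom Y Z) (f : dhom X Y) :
    deq (DComp h (DComp g f)) (DComp (DComp h g) f)
| deq_idl X Y (f : dhom X Y) : deq (DComp (did Y) f) f
| deq_idr X Y (f : dhom X Y) : deq (DComp f (did X)) f
| deq_map X Y (f g : cmap X Y) : cmap_eq f g -> deq (DMap f) (DMap g)
| deq_mapM X Y Z (g : cmap Y Z) (f : cmap X Y) :
    deq (DMap (cmap_comp g f)) (DComp (DMap g) (DMap f))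
| deq_invl X Y (s : cmap X Y) (qs : quasi_iso s) :
    deq (DComp (DInv qs) (DMap s)) (did X)
| deq_invr X Y (s : cmap X Y) (qs : quasi_iso s) :
    deq (DComp (DMap s) (DInv qs)) (did Y).

Definition diso (X Y : cpx) (f : dhom X Y) : Prop :=
  exists2 g : dhom Y X, deq (DComp g f) (did X) & deq (DComp f g) (did Y).

(* The functor induced on D(U) by a functor on complexes which preserves
   quasi-isomorphisms. *)
Section DFunctor.
Context (T : cpx -> cpx) (Tm : forall X Y, cmap X Y -> cmap (T X) (T Y)).
Hypothesis Tq : forall X Y (s : cmap X Y), quasi_iso s -> quasi_iso (Tm s).

Fixpoint dfun (X Y : cpx) (f : dhom X Y) : dhom (T X) (T Y) :=
  match f with
  | DMap _ _ f => DMap (Tm f)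
  | DInv _ _ _ qs => DInv (Tq qs)
  | DComp _ _ _ g f => DComp (dfun g) (dfun f)
  end.
End DFunctor.

Program Definition rhom_opp (F G : rep) (f : rhom F G) : rhom F G :=
  @RHom F G (fun A => \- (f A))%R _.
Next Obligation. by move=> F G f A B e x; rewrite /= rhom_nat linearN. Qed.

Program Definition shift (X : cpx) : cpx :=
  @Cpx (fun n => X (n - 1)) (fun n => rhom_opp (cd X (n - 1))) _.
Next Obligation. by move=> X n A x; rewrite /= linearN cdd !oppr0. Qed.

Program Definition shift_map (X Y : cpx) (f : cmap X Y) :
  cmap (shift X) (shift Y) := @CMap (shift X) (shift Y) (fun n => f (n - 1)) _.
Next Obligation. by move=> X Y f n A x; rewrite /= linearN cmap_d. Qed.

Lemma shift_quasi_iso (X Y : cpx) (s : cmap X Y) :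
  quasi_iso s -> quasi_iso (shift_map s).
Proof.
move=> qs n A; have [qi qq] := qs (n - 1) A; split=> /=.
  move=> x /eqP; rewrite oppr_eq0 => /eqP dx [y e].
  have [|z ->] := qi x dx; first by exists (- y); rewrite linearN.
  by exists (- z); rewrite linearN opprK.
move=> y /eqP; rewrite oppr_eq0 => /eqP /qq[x dx [z ->]].
by exists x; [rewrite dx oppr0 | exists (- z); rewrite linearN opprK].
Qed.

Program Definition cone (X Y : cpx) (f : cmap X Y) : cpx :=
  @Cpx (fun n => rep_prod (X (n - 1)) (Y n))
    (fun n => @RHom _ _
       (fun A => cone_map (cd X (n - 1) A) (f (n - 1) A) (cd Y n A)) _) _.
Next Obligation.
move=> X Y f n A B e x; congr pair; rewrite /= !rhom_nat ?linearN //.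
by rewrite linearD.
Qed.
Next Obligation.
move=> X Y f n A x; congr pair; rewrite /=.
  by rewrite linearN cdd !oppr0.
by rewrite linearN linearD cdd addr0 cmap_d addNr.
Qed.

Program Definition cone_in (X Y : cpx) (f : cmap X Y) : cmap Y (cone f) :=
  @CMap Y (cone f)
    (fun n => @RHom (Y n) (cone f n) (fun A => pair_inr _ _) _) _.
Next Obligation.
by move=> X Y f n A B e x; congr pair; rewrite linear0.
Qed.
Next Obligation.
by move=> X Y f n A x; congr pair; rewrite /= ?linear0 ?oppr0 ?add0r.
Qed.

Program Definition cone_out (X Y : cpx) (f : cmap X Y) :
  cmap (cone f) (shift X) :=
  @CMap (cone f) (shift X)
    (fun n => @RHom (cone f n) (shift X n) (fun A => pair_fst _ _) _) _.
Next Obligation. by []. Qed.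
Next Obligation. by []. Qed.

Definition dshift (X Y : cpx) (f : dhom X Y) : dhom (shift X) (shift Y) :=
  dfun shift_quasi_iso f.

(* The triangles isomorphic in D(U) to X' -> Y' -> cone f -> shift X' for some
   chain map f from X' to Y'. *)
Definition distinguished (X Y Z : cpx)
    (u : dhom X Y) (v : dhom Y Z) (w : dhom Z (shift X)) : Prop :=
  exists (X' Y' : cpx) (f : cmap X' Y')
    (a : dhom X X') (b : dhom Y Y') (c : dhom Z (cone f)),
    [/\ diso a, diso b & diso c] /\
    [/\ deq (DComp b u) (DComp (DMap f) a),
        deq (DComp c v) (DComp (DMap (cone_in f)) b) &
        deq (DComp (dshift a) w) (DComp (DMap (cone_out f)) c)].

Program Definition biprod (X Y : cpx) : cpx :=
  @Cpx (fun n => rep_prod (X n) (Y n))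
    (fun n => @RHom _ _ (fun A => pair_map (cd X n A) (cd Y n A)) _) _.
Next Obligation.
by move=> X Y n A B e x; congr pair; rewrite /= !rhom_nat.
Qed.
Next Obligation. by move=> X Y n A x; congr pair; rewrite /= !cdd. Qed.

Program Definition biprod_map (Z X Y : cpx) (f : cmap X Y) :
  cmap (biprod X Z) (biprod Y Z) :=
  @CMap (biprod X Z) (biprod Y Z) (fun n =>
    @RHom (biprod X Z n) (biprod Y Z n) (fun A => pair_map (f n A) idfun) _) _.
Next Obligation.
by move=> Z X Y f n A B e x; congr pair; rewrite /= !rhom_nat.
Qed.
Next Obligation. by move=> Z X Y f n A x; congr pair; rewrite /= !cmap_d. Qed.

Lemma biprod_quasi_iso (Z X Y : cpx) (s : cmap X Y) :
  quasi_iso s -> quasi_iso (biprod_map Z s).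
Proof.
move=> qs n A; have [qi qq] := qs n A; split.
  case=> [x t] [dx dt] [[y u]] [sx su].
  have [|z xz] := qi x dx; first by exists y.
  by exists (z, u); congr pair.
case=> [y t] [/qq[x dx [z yz]] dt].
exists (x, t); first by congr pair.
by exists (z, 0); congr pair; rewrite //= linear0 addr0.
Qed.

Program Definition biprod_swap (X Y : cpx) : cmap (biprod X Y) (biprod Y X) :=
  @CMap (biprod X Y) (biprod Y X) (fun n =>
    @RHom (biprod X Y n) (biprod Y X n) (fun A => pair_swap _ _) _) _.
Next Obligation. by []. Qed.
Next Obligation. by []. Qed.

Program Definition biprod_diag (X : cpx) : cmap X (biprod X X) :=
  @CMap X (biprod X X) (fun n =>
    @RHom (X n) (biprod X X n) (fun A => pair_diag _) _) _.
Next Obligation. by []. Qed.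
Next Obligation. by []. Qed.

Program Definition biprod_fold (X : cpx) : cmap (biprod X X) X :=
  @CMap (biprod X X) X (fun n =>
    @RHom (biprod X X n) (X n) (fun A => pair_fold _) _) _.
Next Obligation. by move=> X n A B e x; rewrite /= linearD. Qed.
Next Obligation. by move=> X n A x; rewrite /= linearD. Qed.

Definition dbiprod (Z X Y : cpx) (f : dhom X Y) :
  dhom (biprod X Z) (biprod Y Z) := dfun (@biprod_quasi_iso Z) f.

(* The addition of the additive category D(U):
   X -> X + X -> Y + X -> X + Y -> Y + Y -> Y. *)
Definition dadd (X Y : cpx) (f g : dhom X Y) : dhom X Y :=
  DComp (DMap (biprod_fold Y))
    (DComp (dbiprod Y g)
      (DComp (DMap (biprod_swap Y X))
        (DComp (dbiprod X f) (DMap (biprod_diag X))))).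

Program Definition rhom_zero (F G : rep) : rhom F G :=
  @RHom F G (fun A => \0)%R _.
Next Obligation. by move=> F G A B e x; rewrite /= linear0. Qed.

Program Definition cmap_zero (X Y : cpx) : cmap X Y :=
  @CMap X Y (fun n => rhom_zero (X n) (Y n)) _.
Next Obligation. by move=> X Y n A x; rewrite /= linear0. Qed.

Definition dzero (X Y : cpx) : dhom X Y := DMap (cmap_zero X Y).

Program Definition csum (I : Type) (Y : I -> cpx) : cpx :=
  @Cpx (fun n => rep_dsum (fun i => Y i n))
    (fun n => @RHom (rep_dsum (fun i => Y i n))
      (rep_dsum (fun i => Y i (n - 1)))
      (fun A => dsum_rec (fun i =>
         lcomp (dsum_in (fun i => Y i (n - 1) A) i) (cd (Y i) n A))) _) _.
Next Obligation.
move=> I Y n A B e.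
apply: (@dsum_ext _ _ _ _ (lcomp (dsum_rec _) (dsum_rec _))
  (lcomp (dsum_rec _) (dsum_rec _))) => i x.
by rewrite !(lcompE, dsum_recE) rhom_nat.
Qed.
Next Obligation.
move=> I Y n A.
apply: (@dsum_ext _ _ _ _ (lcomp (dsum_rec _) (dsum_rec _)) \0) => i x.
by rewrite !(lcompE, dsum_recE) cdd linear0.
Qed.

Program Definition csum_in (I : Type) (Y : I -> cpx) (i : I) :
  cmap (Y i) (csum Y) :=
  @CMap (Y i) (csum Y) (fun n =>
    @RHom (Y i n) (csum Y n) (fun A => dsum_in (fun i => Y i n A) i) _) _.
Next Obligation.
move=> I Y i n A B e x.
by symmetry; etransitivity; first exact: dsum_recE.
Qed.
Next Obligation.
move=> I Y i n A x.
by symmetry; etransitivity; first exact: dsum_recE.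
Qed.

(* The image of the family [g], supported on the finite list [s], under the
   canonical map from the direct sum of the groups Hom(X, Y i) to
   Hom(X, csum Y). *)
Fixpoint dsum_hom (X : cpx) (I : Type) (Y : I -> cpx)
    (g : forall i, dhom X (Y i)) (s : seq I) : dhom X (csum Y) :=
  if s is i :: s' then
    dadd (DComp (DMap (csum_in Y i)) (g i)) (dsum_hom g s')
  else dzero X (csum Y).

(* X is compact: for every family Y, the canonical homomorphism above is
   injective and surjective. *)
Definition compact_obj (X : cpx) : Prop :=
  forall (I : Type) (Y : I -> cpx),
    (forall (g : forall i, dhom X (Y i)) (s : seq I), List.NoDup s ->
       deq (dsum_hom g s) (dzero X (csum Y)) ->
       forall i, List.In i s -> deq (g i) (dzero X (Y i))) /\
    (forall f : dhom X (csum Y),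
       exists (g : forall i, dhom X (Y i)) (s : seq I),
         List.NoDup s /\ deq f (dsum_hom g s)).

Definition bideg (n : int) := {ij : int * int | ij.1 + ij.2 == n}.

Lemma bideg_lP n (t : bideg n) : ((sval t).1 - 1) + (sval t).2 == n - 1.
Proof. by case: t => -[i j] /= /eqP <-; rewrite addrAC. Qed.

Lemma bideg_rP n (t : bideg n) : (sval t).1 + ((sval t).2 - 1) == n - 1.
Proof. by case: t => -[i j] /= /eqP <-; rewrite addrA. Qed.

Definition bideg_l n (t : bideg n) : bideg (n - 1) :=
  exist _ ((sval t).1 - 1, (sval t).2) (bideg_lP t).

Definition bideg_r n (t : bideg n) : bideg (n - 1) :=
  exist _ ((sval t).1, (sval t).2 - 1) (bideg_rP t).

Section TensorComplex.
Context (X Y : cpx).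

Definition tens_at (n : int) (t : bideg n) : rep :=
  rep_tens (X (sval t).1) (Y (sval t).2).

(* d (x (x) y) = d x (x) y + (-1)^i x (x) d y for x of degree i. *)
Definition tens_d_at n A (t : bideg n) :
    {linear tens_at t A -> rep_dsum (@tens_at (n - 1)) A} :=
  lcomp (dsum_in (fun t => tens_at t A) (bideg_l t))
        (tens_map (cd X (sval t).1 A) idfun) \+
  (-1) ^ (sval t).1 \*:
    lcomp (dsum_in (fun t => tens_at t A) (bideg_r t))
          (tens_map idfun (cd Y (sval t).2 A)).

Definition tens_d n A :
    {linear rep_dsum (@tens_at n) A -> rep_dsum (@tens_at (n - 1)) A} :=
  dsum_rec (@tens_d_at n A).

Definition tgen n A (t : bideg n)
    (x : X (sval t).1 A) (y : Y (sval t).2 A) : rep_dsum (@tens_at n) A :=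
  dsum_in (fun t => tens_at t A) t (tpure x y).

Lemma tens_dE n A (t : bideg n) x y :
  tens_d n A (tgen (t := t) x y) =
  tgen (t := bideg_l t) (cd X (sval t).1 A x) y +
  (-1) ^ (sval t).1 *: tgen (t := bideg_r t) x (cd Y (sval t).2 A y).
Proof.
rewrite /tens_d /tgen dsum_recE.
rewrite -[LHS]/(lcomp _ _ _ + _ *: lcomp _ _ _).
by rewrite !lcompE !tens_mapE.
Qed.

Lemma tgen0l n A (t : bideg n) y : tgen (t := t) (0 : X (sval t).1 A) y = 0.
Proof.
rewrite /tgen; have -> : tpure (0 : X (sval t).1 A) y = 0.
  by rewrite -(scale0r (0 : X (sval t).1 A)) tpureZl scale0r.
by rewrite linear0.
Qed.

Lemma tgen0r n A (t : bideg n) x : tgen (t := t) x (0 : Y (sval t).2 A) = 0.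
Proof.
rewrite /tgen; have -> : tpure x (0 : Y (sval t).2 A) = 0.
  by rewrite -(scale0r (0 : Y (sval t).2 A)) tpureZr scale0r.
by rewrite linear0.
Qed.

Lemma tens_d_ext n A (W : lmodType k)
    (f g : {linear rep_dsum (@tens_at n) A -> W}) :
  (forall (t : bideg n) x y, f (tgen (t := t) x y) = g (tgen (t := t) x y)) ->
  forall z, f z = g z.
Proof.
move=> fg; apply: dsum_ext => t.
by apply: (@tens_ext _ _ _ _ (lcomp _ _) (lcomp _ _)) => x y; exact: fg.
Qed.

Lemma res_tgen n A B (e : epi A B) (t : bideg n) x y :
  res (rep_dsum (@tens_at n)) e (tgen (t := t) x y) =
  tgen (t := t) (res (X (sval t).1) e x) (res (Y (sval t).2) e y).
Proof.
rewrite /tgen [LHS]dsum_recE lcompE; congr (dsum_in _ _ _).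
exact: tens_mapE.
Qed.

Lemma tens_d_nat n A B (e : epi A B) z :
  tens_d n A (res (rep_dsum (@tens_at n)) e z) =
  res (rep_dsum (@tens_at (n - 1))) e (tens_d n B z).
Proof.
apply: (@tens_d_ext _ _ _ (lcomp (tens_d n A) (res _ e))
  (lcomp (res _ e) (tens_d n B))) => {z} t x y.
rewrite !lcompE res_tgen !tens_dE linearD linearZ.
by rewrite !res_tgen !rhom_nat.
Qed.

Lemma tgen_irr m A (ij : int * int) (e e' : ij.1 + ij.2 == m)
    (x : X ij.1 A) (y : Y ij.2 A) :
  tgen (t := exist _ ij e) x y = tgen (t := exist _ ij e') x y.
Proof. by rewrite (bool_irrelevance e e'). Qed.

Lemma tgen_lr n A (t : bideg n)
    (x : X ((sval t).1 - 1) A) (y : Y ((sval t).2 - 1) A) :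
  tgen (t := bideg_l (bideg_r t)) x y = tgen (t := bideg_r (bideg_l t)) x y.
Proof. exact: tgen_irr. Qed.

Lemma tens_dd n A z : tens_d (n - 1) A (tens_d n A z) = 0.
Proof.
apply: (@tens_d_ext _ _ _ (lcomp (tens_d (n - 1) A) (tens_d n A)) \0).
move=> {z} t x y.
rewrite lcompE tens_dE linearD linearZ !tens_dE !cdd tgen0l tgen0r.
rewrite scaler0 addr0 add0r tgen_lr.
rewrite [(sval (bideg_l t)).1]/= expfzDr ?oppr_eq0 ?oner_eq0 //.
rewrite -[(-1) ^ (-1)]/((-1)^-1) invrN1 mulrN1 scaleNr.
exact: addNr.
Qed.

End TensorComplex.
(* Tensoring over the field k is exact, so this also computes the tensor
   product of D(U). *)
Program Definition ctens (X Y : cpx) : cpx :=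
  @Cpx (fun n => rep_dsum (@tens_at X Y n))
    (fun n => @RHom _ _ (tens_d X Y n) _) _.
Next Obligation. by move=> X Y n A B e x; exact: tens_d_nat. Qed.
Next Obligation. by move=> X Y n A x; exact: tens_dd. Qed.

(* A full replete subcategory of the category D(U)^c of compact objects is given
   by the complexes it contains; closure under isomorphism is contained in
   [prime_retract]. *)
Record prime_ideal (P : cpx -> Prop) : Prop := PrimeIdeal {
  prime_compact : forall X, P X -> compact_obj X;
  prime_nonempty : exists X, P X;
  prime_shift : forall X, P (shift X) <-> P X;
  prime_triangle : forall X Y Z (u : dhom X Y) (v : dhom Y Z)
    (w : dhom Z (shift X)), distinguished u v w -> P X -> P Y -> P Z;
  prime_retract : forall X Y (i : dhom X Y) (q : dhom Y X),
    deq (DComp q i) (did X) -> P Y -> P X;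
  prime_tens : forall X Y, P X -> compact_obj Y -> P (ctens X Y);
  prime_proper : exists2 X, compact_obj X & ~ P X;
  prime_prime : forall X Y, compact_obj X -> compact_obj Y ->
    P (ctens X Y) -> P X \/ P Y
}.

Record spc := SpcPoint {
  spc_ideal :> cpx -> Prop;
  spcP : prime_ideal spc_ideal
}.

Definition supp (X : cpx) (P : spc) : Prop := ~ P X.

End Derived.

(* The points of a Balmer spectrum are families of complexes of functors to
   [lmodType k], hence live in a universe too large for [topologicalType], whose
   carriers the library constrains to lie below the type [lmodType k]. *)

Record space := Space {
  pt :> Type;
  opn : (pt -> Prop) -> Prop;
  opn_full : opn (fun _ => True);
  opn_cap : forall A B, opn A -> opn B -> opn (fun x => A x /\ B x);
  opn_cup : forall C : (pt -> Prop) -> Prop, (forall A, C A -> opn A) ->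
    opn (fun x => exists2 A, C A & A x)
}.

Inductive generated (T : Type) (S : (T -> Prop) -> Prop) :
    (T -> Prop) -> Prop :=
| generated_in A : S A -> generated S A
| generated_full : generated S (fun _ => True)
| generated_cap A B :
    generated S A -> generated S B -> generated S (fun x => A x /\ B x)
| generated_cup (C : (T -> Prop) -> Prop) :
    (forall A, C A -> generated S A) ->
    generated S (fun x => exists2 A, C A & A x).

Definition generated_space (T : Type) (S : (T -> Prop) -> Prop) : space :=
  @Space T (generated S) (generated_full S) (@generated_cap T S)
    (@generated_cup T S).

(* Spc(D(U)^c): the topology whose closed sets are generated by the supports
   (these are closed under finite unions, so that they form a basis of closed
   sets). *)
Definition balmer_spectrum (k : fieldType) (U : finGroupType -> Prop) : space :=
  @generated_space (spc k U) (fun A => exists2 X : cpx k U,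
    compact_obj X & A = (fun P => ~ supp X P)).

Program Definition space_of (T : topologicalType) : space :=
  @Space T (@open T) (@openT T) (@openI T) _.
Next Obligation.
move=> T C oC.
have -> : (fun x => exists2 A, C A & A x) = (\bigcup_(A in C) A)%classic by [].
exact: bigcup_open.
Qed.

Definition hausdorff (T : space) : Prop :=
  forall x y : T, x <> y -> exists A B : T -> Prop,
    [/\ opn A, opn B, A x, B y & forall z, A z -> ~ B z].

Definition homeomorphic (T T' : space) : Prop :=
  exists (f : T -> T') (g : T' -> T),
    [/\ cancel f g, cancel g f,
        forall A, opn A -> opn (fun x => A (f x)) &
        forall A, opn A -> opn (fun y => A (g y))].

(* Notations for ordinals, up to the equivalence associated with [ole]; [OLim f]
   denotes the supremum of the family [f]. *)
Inductive ord : Type :=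
| OZero
| OSucc of ord
| OLim (I : Type) of I -> ord.

Inductive ole : ord -> ord -> Prop :=
| ole_zero b : ole OZero b
| ole_succ a b : olt a b -> ole (OSucc a) b
| ole_lim I (f : I -> ord) b : (forall i, ole (f i) b) -> ole (OLim f) b
with olt : ord -> ord -> Prop :=
| olt_succ a b : ole a b -> olt a (OSucc b)
| olt_lim I (f : I -> ord) a i : olt a (f i) -> olt a (OLim f).

Definition ord_of_nat (n : nat) : ord := iter n OSucc OZero.

Definition cb_derivative (T : space) (A : T -> Prop) (x : T) : Prop :=
  A x /\ ~ exists B : T -> Prop,
    [/\ opn B, B x & forall y, B y -> A y -> y = x].

Fixpoint cb_derived (T : space) (a : ord) : T -> Prop :=
  match a with
  | OZero => fun _ => True
  | OSucc b => cb_derivative (@cb_derived T b)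
  | OLim _ f => fun x => forall i, @cb_derived T (f i) x
  end.

(* [T] is non-empty and its Cantor-Bendixson rank is the ordinal [a]. *)
Definition has_cb_rank (T : space) (a : ord) : Prop :=
  [/\ exists x : T, True,
      forall b, (exists x : T, cb_derived b x) -> ole b a &
      forall c, (forall b, (exists x : T, cb_derived b x) -> ole b c) -> ole a c].

(* The one-point compactification of the discrete space of natural numbers;
   [None] is the point at infinity. *)
Definition natinf := one_point_compactification nat.

Definition natinf_le (a b : natinf) : Prop :=
  match a, b with
  | _, None => True
  | None, Some _ => False
  | Some m, Some n => (m <= n)%N
  end.

Definition decreasing_seqs (r : nat) :
    set (prod_topology (fun _ : 'I_r => natinf)) :=
  [set v | forall i j : 'I_r, (i <= j)%N -> natinf_le (v j) (v i)]%classic.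

Definition decreasing_space (r : nat) : space :=
  space_of (set_type (@decreasing_seqs r)).

(* Main.v *)
(* Write [Q_n A] for A / p^n A and call a complex X n-truncated if
   X(Q_n A) -> X(A) is a quasi-isomorphism for every A.  Over a field of
   characteristic zero, averaging over automorphisms makes the complexes induced
   from a single group projective; it follows that X is compact if and only if it
   is n-truncated for some n and has finite-dimensional total homology at every
   group.  Groups G_n killed by p^n with Q_n G_m isomorphic to G_n for n <= m
   define the prime ideal of all compact X with X(G_n) acyclic for large n.

   Conversely, let P be a prime ideal and let chi_G be k on the groups A with Q_n A
   isomorphic to G, and 0 elsewhere.  If all chi_G were in P then so would be the
   unit, filtered by the order of Q_n A; hence chi_G is not in P for some G = G_n.
   An n-truncated compact X is then in P if and only if X(G) is acyclic: if it is,
   X (x) chi_G is acyclic; if not, a nonzero homology class makes the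
   linearization of A |-> Iso(Q_n A, G), of which chi_G is a retract, a retract of
   a shift of its tensor product with X.

   The sequences (G_n) correspond to the antitone functions c from the natural
   numbers to {0, ..., r}, where c i counts the invariant factors of order greater
   than p^i; such a c is the conjugate partition of a decreasing sequence with r
   entries, the infinite entries being counted by the limit of c.  Both topologies
   are generated by the cylinders of functions with a given restriction to
   {0, ..., N - 1}, and the j-th Cantor-Bendixson derivative is {c | c >= j}. *)

Require Import Defs.
From Corelib Require Setoid.
From HB Require Import structures.
From mathcomp Require Import fingroup morphism quotient pgroup abelian gproduct.
From mathcomp Require Import cyclic.
From mathcomp Require Import all_boot all_order all_algebra.
From mathcomp Require Import zify.
From mathcomp Require Import boolp classical_sets topology_structure.
From mathcomp Require Import function_spaces nat_topology.
From mathcomp Require Import one_point_compactification subtype_topology.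
From mathcomp Require Import filter functions cardinality compact discrete_topology.
From mathcomp Require Import initial_topology supremum_topology.

Set Implicit Arguments.
Unset Strict Implicit.
Unset Printing Implicit Defensive.

Import GRing.Theory.

Local Open Scope ring_scope.
(** * The derived category *)

(** Morphisms of D(U) are words in chain maps and formal inverses, so neither equality nor vanishing
    can be read off a word. Two tools bridge the gap: words act on homology by relations invariant
    under [deq], and homotopic chain maps are [deq]-equal, because the two ends of a cylinder are
    sections of one quasi-isomorphism. Projectivity enters in the form that every word out of an
    induced complex equals a chain map, which is null-homotopic as soon as it vanishes on homology
    at the inducing group.

    A compact X must be truncated because of the cones of X(Q_n A) -> X(A): at each group almost all
    of them are acyclic, so their sum agrees with their product, and the family of canonical maps
    from X has to vanish at some n. Finite-dimensional homology is forced by maps to sums of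
    coinduced objects. Conversely, up to isomorphism only finitely many groups of rank at most r are
    killed by p^n; coning off counits at these, in increasing order of cardinality, turns a
    truncated X into an acyclic complex. *)

#[global] Arguments deq_refl {k U X Y}.
#[export] Hint Resolve deq_refl : core.

Section Localization.
Context (k : fieldType) (U : finGroupType -> Prop).
Implicit Types X Y Z W : cpx k U.

#[export] Instance deq_equivalence X Y :
  RelationClasses.Equivalence (@deq k U X Y).
Proof.
split; [exact: deq_refl|exact: deq_sym|exact: deq_trans].
Qed.

#[export] Instance DComp_deq X Y Z : Morphisms.Proper
  (Morphisms.respectful (@deq k U Y Z)
    (Morphisms.respectful (@deq k U X Y) (@deq k U X Z))) (@DComp k U X Y Z).
Proof. by move=> g g' gg' f f' ff'; exact: deq_comp. Qed.

Lemma deq_mapE X Y Z (g : cmap Y Z) (f : cmap X Y) (h : cmap X Z) :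
  cmap_eq (cmap_comp g f) h -> deq (DComp (DMap g) (DMap f)) (DMap h).
Proof. by move=> e; rewrite -deq_mapM; exact: deq_map. Qed.

Lemma deq_mapE2 X Y Y' Z (g : cmap Y Z) (f : cmap X Y) (g' : cmap Y' Z)
    (f' : cmap X Y') :
  cmap_eq (cmap_comp g f) (cmap_comp g' f') ->
  deq (DComp (DMap g) (DMap f)) (DComp (DMap g') (DMap f')).
Proof. by move=> e; rewrite -!deq_mapM; exact: deq_map. Qed.

Lemma deq_invl' X Y Z (s : cmap X Y) (q : quasi_iso s) (f : dhom Z X) :
  deq (DComp (DInv q) (DComp (DMap s) f)) f.
Proof. by rewrite deq_compA deq_invl deq_idl. Qed.

Lemma deq_invr' X Y Z (s : cmap X Y) (q : quasi_iso s) (f : dhom Z Y) :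
  deq (DComp (DMap s) (DComp (DInv q) f)) f.
Proof. by rewrite deq_compA deq_invr deq_idl. Qed.

Lemma deq_cancell X Y Z (s : cmap Y Z) (q : quasi_iso s) (f g : dhom X Y) :
  deq (DComp (DMap s) f) (DComp (DMap s) g) -> deq f g.
Proof. by move=> e; rewrite -(deq_invl' q f) e deq_invl'. Qed.

Lemma deq_cancelr X Y Z (s : cmap X Y) (q : quasi_iso s) (f g : dhom Y Z) :
  deq (DComp f (DMap s)) (DComp g (DMap s)) -> deq f g.
Proof.
move=> e; rewrite -(deq_idr f) -(deq_idr g) -!(deq_invr q) !deq_compA.
by rewrite e.
Qed.

(** The case of a formal inverse in inductions over words: a commuting square stays commutative when
    two opposite sides, both quasi-isomorphisms, are inverted. *)
Lemma deq_inv_nat X X' Y Y' (s : cmap X Y) (q : quasi_iso s) (s' : cmap X' Y')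
    (q' : quasi_iso s') (a : dhom X X') (b : dhom Y Y') :
  deq (DComp b (DMap s)) (DComp (DMap s') a) ->
  deq (DComp a (DInv q)) (DComp (DInv q') b).
Proof.
move=> e; apply: (deq_cancell q'); rewrite deq_invr' deq_compA -e.
by rewrite -deq_compA deq_invr deq_idr.
Qed.

Record functorial (T : cpx k U -> cpx k U)
    (Tm : forall X Y, cmap X Y -> cmap (T X) (T Y)) : Prop := Functorial {
  functor_id : forall X, cmap_eq (Tm _ _ (cmap_id X)) (cmap_id (T X));
  functor_comp : forall X Y Z (g : cmap Y Z) (f : cmap X Y),
    cmap_eq (Tm _ _ (cmap_comp g f)) (cmap_comp (Tm _ _ g) (Tm _ _ f));
  functor_eq : forall X Y (f g : cmap X Y),
    cmap_eq f g -> cmap_eq (Tm _ _ f) (Tm _ _ g)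
}.

Section Functors.
Context (T : cpx k U -> cpx k U)
  (Tm : forall X Y, cmap X Y -> cmap (T X) (T Y)).
Context (Tq : forall X Y (s : cmap X Y), quasi_iso s -> quasi_iso (Tm s)).

Lemma dfun_deq X Y (f g : dhom X Y) :
  functorial Tm -> deq f g -> deq (dfun Tq f) (dfun Tq g).
Proof.
case=> Ti Tc Te; elim=> {X Y f g} //=.
- by move=> X Y f g _ ->.
- by move=> X Y f g h _ -> _ ->.
- by move=> X Y Z g g' f f' _ -> _ ->.
- by move=> *; rewrite deq_compA.
- by move=> X Y f; rewrite (deq_map (Ti Y)) deq_idl.
- by move=> X Y f; rewrite (deq_map (Ti X)) deq_idr.
- by move=> X Y f g /Te; exact: deq_map.
- by move=> X Y Z g f; rewrite (deq_map (Tc _ _ _ g f)) deq_mapM.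
- by move=> X Y s q; rewrite deq_invl (deq_map (Ti X)).
- by move=> X Y s q; rewrite deq_invr (deq_map (Ti Y)).
Qed.

Context (T' : cpx k U -> cpx k U)
  (Tm' : forall X Y, cmap X Y -> cmap (T' X) (T' Y)).
Context (Tq' : forall X Y (s : cmap X Y), quasi_iso s -> quasi_iso (Tm' s)).
Context (tau : forall X, cmap (T X) (T' X)).

Lemma dfun_nat X Y (f : dhom X Y) :
  (forall X Y (f : cmap X Y),
     cmap_eq (cmap_comp (tau Y) (Tm f)) (cmap_comp (Tm' f) (tau X))) ->
  deq (DComp (DMap (tau Y)) (dfun Tq f)) (DComp (dfun Tq' f) (DMap (tau X))).
Proof.
move=> n; elim: f => {X Y} [X Y f|X Y s q|X Y Z g IHg f IHf] /=.
- exact: deq_mapE2.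
- by apply: deq_inv_nat; exact: deq_mapE2.
- by rewrite deq_compA IHg -deq_compA IHf deq_compA.
Qed.
End Functors.

(** Rewriting a word as its image under the identity functor lets [dfun_nat] apply to
    transformations into or out of the identity. *)
Lemma dfun_id X Y (f : dhom X Y) :
  deq (dfun (T := id) (Tm := fun X Y f => f) (fun X Y s q => q) f) f.
Proof.
elim: f => {X Y} [X Y f|X Y s q|X Y Z g IHg f IHf] /=; try exact: deq_refl.
by rewrite IHg IHf.
Qed.

Program Definition biprod_mapr Z X Y (f : cmap X Y) :
  cmap (biprod Z X) (biprod Z Y) :=
  @CMap k U (biprod Z X) (biprod Z Y) (fun n =>
    @RHom k U (biprod Z X n) (biprod Z Y n) (fun A => pair_map idfun (f n A)) _) _.
Next Obligation.
by move=> Z X Y f n A B e x; congr pair; rewrite /= !rhom_nat.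
Qed.
Next Obligation. by move=> Z X Y f n A x; congr pair; rewrite /= !cmap_d. Qed.

Lemma biprod_mapr_quasi_iso Z X Y (s : cmap X Y) :
  quasi_iso s -> quasi_iso (biprod_mapr Z s).
Proof.
move=> qs n A; have [qi qq] := qs n A; split.
  case=> [t x] [dt dx] [[u y]] [su sx].
  have [|z xz] := qi x dx; first by exists y.
  by exists (u, z); congr pair.
case=> [t y] [dt /qq[x dx [z yz]]].
exists (t, x); first by congr pair.
by exists (0, z); congr pair; rewrite //= linear0 addr0.
Qed.

Definition dbiprodr Z X Y (f : dhom X Y) :
  dhom (biprod Z X) (biprod Z Y) := dfun (@biprod_mapr_quasi_iso Z) f.

Lemma biprod_map_functorial Z : functorial (@biprod_map k U Z).
Proof.
split=> // [X n A [x y] //|X Y f g fg n A [x y]].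
by congr pair; exact: fg.
Qed.

Lemma biprod_mapr_functorial Z : functorial (@biprod_mapr Z).
Proof.
split=> // [X n A [x y] //|X Y f g fg n A [x y]].
by congr pair; exact: fg.
Qed.

(** When [f] is a chain map, the maps [biprod_map Z f] are natural in Z, so [dfun_nat] handles an
    arbitrary word [h]; induction on [f] does the rest. *)
Lemma dbiprod_exch X X' Z Z' (f : dhom X X') (h : dhom Z Z') :
  deq (DComp (dbiprod Z' f) (dbiprodr X h))
      (DComp (dbiprodr X' h) (dbiprod Z f)).
Proof.
elim: f => {X X'} [X Y f|X Y s q|X Y W g IHg f IHf].
- exact: (dfun_nat (@biprod_mapr_quasi_iso X) (@biprod_mapr_quasi_iso Y)
    (tau := fun Z => biprod_map Z f) h).
- rewrite /dbiprod /=; apply: deq_sym; apply: deq_inv_nat; apply: deq_sym.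
  exact: (dfun_nat (@biprod_mapr_quasi_iso X) (@biprod_mapr_quasi_iso Y)
    (tau := fun Z => biprod_map Z s) h).
- by rewrite -deq_compA [deq _ _]/= -/(dbiprod _ f) -/(dbiprod _ g) IHf
    deq_compA IHg -deq_compA.
Qed.

End Localization.

(** * Addition of morphisms, direct sums, and compactness as smallness *)

Section Additive.
Context (k : fieldType) (U : finGroupType -> Prop).
Implicit Types X Y Z W : cpx k U.

Program Definition biprod2 X Y (f : cmap X Y) :
  cmap (biprod X X) (biprod Y Y) :=
  @CMap k U (biprod X X) (biprod Y Y) (fun n =>
    @RHom k U (biprod X X n) (biprod Y Y n) (fun A => pair_map (f n A) (f n A)) _) _.
Next Obligation.
by move=> X Y f n A B e x; congr pair; rewrite /= !rhom_nat.
Qed.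
Next Obligation. by move=> X Y f n A x; congr pair; rewrite /= !cmap_d. Qed.

Lemma biprod2_quasi_iso X Y (s : cmap X Y) : quasi_iso s -> quasi_iso (biprod2 s).
Proof.
move=> qs n A; have [qi qq] := qs n A; split.
  case=> [t x] [dt dx] [[u y]] [su sx].
  have [|z ->] := qi x dx; first by exists y.
  have [|v ->] := qi t dt; first by exists u.
  by exists (v, z).
case=> [t y] [/qq[s' ds [v ->]] /qq[x dx [z ->]]].
by exists (s', x); [congr pair | exists (v, z)].
Qed.

Lemma dbiprod_deq Z X Y (f g : dhom X Y) :
  deq f g -> deq (dbiprod Z f) (dbiprod Z g).
Proof. by apply: dfun_deq; exact: biprod_map_functorial. Qed.

Lemma dbiprodr_deq Z X Y (f g : dhom X Y) :
  deq f g -> deq (dbiprodr Z f) (dbiprodr Z g).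
Proof. by apply: dfun_deq; exact: biprod_mapr_functorial. Qed.

Lemma dbiprod_id Z X : deq (dbiprod Z (did X)) (did (biprod X Z)).
Proof. by apply: deq_map => n A []. Qed.

Lemma dbiprodr_id Z X : deq (dbiprodr Z (did X)) (did (biprod Z X)).
Proof. by apply: deq_map => n A []. Qed.

(** The diagonal and the fold are natural for the functor X -> X + X, whereas [dadd] acts on one
    summand at a time. Bilinearity of [dadd] follows by passing between the two. *)
Lemma biprod2E X Y (h : dhom X Y) :
  deq (dfun biprod2_quasi_iso h) (DComp (dbiprodr Y h) (dbiprod X h)).
Proof.
elim: h => {X Y} [X Y f|X Y s q|X Y Z g IHg f IHf].
- by rewrite /= -deq_mapM; apply: deq_map => n A [].
(* After cancelling the doubled quasi-isomorphism, the exchange law moves each inverse next to the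
   map on its own summand. *)
- apply: (deq_cancelr (biprod2_quasi_iso q)); rewrite deq_invl.
  have -> : deq (DMap (biprod2 s))
      (DComp (dbiprodr Y (DMap s)) (dbiprod X (DMap s))).
    by rewrite /= -deq_mapM; apply: deq_map => n A [].
  rewrite -deq_compA.
  rewrite (deq_compA (dbiprod Y _)) dbiprod_exch -deq_compA.
  rewrite -[DComp (dbiprod X (DInv q)) (dbiprod X (DMap s))]/(dbiprod X (DComp (DInv q) (DMap s))).
  rewrite (dbiprod_deq _ (deq_invl q)) dbiprod_id deq_idr.
  rewrite -[DComp _ _]/(dbiprodr X (DComp (DInv q) (DMap s))).
  by rewrite (dbiprodr_deq _ (deq_invl q)) dbiprodr_id.
- change (deq (DComp (dfun biprod2_quasi_iso g) (dfun biprod2_quasi_iso f))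
    (DComp (DComp (dbiprodr Z g) (dbiprodr Z f))
      (DComp (dbiprod X g) (dbiprod X f)))).
  rewrite IHg IHf -!deq_compA; apply: deq_comp => //.
  rewrite !deq_compA; apply: deq_comp => //.
  exact: dbiprod_exch.
Qed.

Lemma biprod_diag_nat X Y (h : dhom X Y) :
  deq (DComp (DMap (biprod_diag Y)) h)
    (DComp (dbiprodr Y h) (DComp (dbiprod X h) (DMap (biprod_diag X)))).
Proof.
rewrite deq_compA -biprod2E -{1}(dfun_id h).
exact: (dfun_nat (Tm := fun X Y f => f) _ biprod2_quasi_iso (tau := biprod_diag (U:=U))).
Qed.

Lemma biprod_fold_nat X Y (h : dhom X Y) :
  deq (DComp h (DMap (biprod_fold X)))
    (DComp (DMap (biprod_fold Y)) (DComp (dbiprodr Y h) (dbiprod X h))).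
Proof.
rewrite -biprod2E -{1}(dfun_id h); apply: deq_sym.
apply: (dfun_nat _ (Tm' := fun X Y f => f) _ (tau := biprod_fold (U:=U))).
by move=> X' Y' f n A [x y]; rewrite /= linearD.
Qed.

Lemma dbiprod_swap Z X Y (h : dhom X Y) :
  deq (DComp (dbiprod Z h) (DMap (biprod_swap Z X)))
      (DComp (DMap (biprod_swap Z Y)) (dbiprodr Z h)).
Proof.
apply: deq_sym.
by apply: (dfun_nat _ _ (tau := fun X => biprod_swap Z X)).
Qed.

Lemma daddE X Y (f g : dhom X Y) :
  deq (dadd f g) (DComp (DMap (biprod_fold Y)) (DComp (dbiprodr Y g)
    (DComp (dbiprod X f) (DMap (biprod_diag X))))).
Proof.
rewrite /dadd (deq_compA (dbiprod Y g)) dbiprod_swap -deq_compA deq_compA.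
rewrite (_ : deq (DComp (DMap (biprod_fold Y)) (DMap (biprod_swap Y Y)))
  (DMap (biprod_fold Y))) //.
by rewrite -deq_mapM; apply: deq_map => n A [x y]; rewrite /= addrC.
Qed.

#[export] Instance dadd_deq X Y : Morphisms.Proper
  (Morphisms.respectful (@deq k U X Y)
    (Morphisms.respectful (@deq k U X Y) (@deq k U X Y))) (@dadd k U X Y).
Proof.
move=> f f' ff g g' gg.
by rewrite /dadd (dbiprod_deq _ ff) (dbiprod_deq _ gg).
Qed.

Lemma dbiprod_comp W X Y Z (g : dhom Y Z) (f : dhom X Y) :
  dbiprod W (DComp g f) = DComp (dbiprod W g) (dbiprod W f).
Proof. by []. Qed.

Lemma dbiprodr_comp W X Y Z (g : dhom Y Z) (f : dhom X Y) :
  dbiprodr W (DComp g f) = DComp (dbiprodr W g) (dbiprodr W f).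
Proof. by []. Qed.

Lemma dadd_compl X Y Z (f g : dhom X Y) (h : dhom Z X) :
  deq (DComp (dadd f g) h) (dadd (DComp f h) (DComp g h)).
Proof.
rewrite !daddE dbiprod_comp dbiprodr_comp -!deq_compA biprod_diag_nat.
do 2!apply: deq_comp => //; rewrite !deq_compA.
by do 2!apply: deq_comp => //; exact: dbiprod_exch.
Qed.

Lemma dadd_compr X Y Z (f g : dhom X Y) (h : dhom Y Z) :
  deq (DComp h (dadd f g)) (dadd (DComp h f) (DComp h g)).
Proof.
rewrite !daddE dbiprod_comp dbiprodr_comp (deq_compA h) biprod_fold_nat.
rewrite -!deq_compA; do 2!apply: deq_comp => //; rewrite !deq_compA.
by do 2!apply: deq_comp => //; exact: dbiprod_exch.
Qed.

Program Definition cmap_add X Y (f g : cmap X Y) : cmap X Y :=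
  @CMap k U X Y (fun n => @RHom k U (X n) (Y n) (fun A => f n A \+ g n A) _) _.
Next Obligation. by move=> X Y f g n A B e x; rewrite /= linearD !rhom_nat. Qed.
Next Obligation. by move=> X Y f g n A x; rewrite /= linearD !cmap_d. Qed.

Lemma dadd_map X Y (f g : cmap X Y) :
  deq (dadd (DMap f) (DMap g)) (DMap (cmap_add f g)).
Proof. by rewrite /dadd /dbiprod /= -!deq_mapM; apply: deq_map => n A x /=; rewrite addrC. Qed.

Program Definition biprod_fst X Y : cmap (biprod X Y) X :=
  @CMap k U (biprod X Y) X (fun n =>
    @RHom k U (biprod X Y n) (X n) (fun A => pair_fst _ _) _) _.
Next Obligation. by []. Qed.
Next Obligation. by []. Qed.

Lemma dbiprod_fst Z X Y (f : dhom X Y) :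
  deq (DComp (DMap (biprod_fst Y Z)) (dbiprod Z f))
      (DComp f (DMap (biprod_fst X Z))).
Proof.
rewrite -{2}(dfun_id f).
by apply: (dfun_nat _ (Tm' := fun X Y f => f) _ (tau := fun X => biprod_fst X Z)).
Qed.

Lemma dadd0 X Y (f : dhom X Y) : deq (dadd f (dzero X Y)) f.
Proof.
have e : deq (DComp (DMap (biprod_fold Y)) (dbiprodr Y (dzero X Y)))
    (DMap (biprod_fst Y X)).
  rewrite /dbiprodr /dzero /= -deq_mapM.
  by apply: deq_map => n A [x y]; rewrite /= addr0.
rewrite daddE (deq_compA (DMap (biprod_fold Y))) e deq_compA dbiprod_fst.
by rewrite -deq_compA (deq_mapE (h := cmap_id X)) // deq_idr.
Qed.

Lemma pair_inl_linear (V W' : lmodType k) : linear ((fun x => (x, 0)) : V -> V * W').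
Proof. by move=> c x y; congr pair; rewrite /= scaler0 addr0. Qed.

Program Definition biprod_inl X Y : cmap X (biprod X Y) :=
  @CMap k U X (biprod X Y) (fun n =>
    @RHom k U (X n) (biprod X Y n) (fun A => mklin (@pair_inl_linear (X n A) (Y n A))) _) _.
Next Obligation. by move=> X Y n A B e x; congr pair; rewrite linear0. Qed.
Next Obligation. by move=> X Y n A x; congr pair; rewrite /= linear0. Qed.

Lemma dbiprod_inl Z X Y (f : dhom X Y) :
  deq (DComp (DMap (biprod_inl Y Z)) f)
      (DComp (dbiprod Z f) (DMap (biprod_inl X Z))).
Proof.
rewrite -{1}(dfun_id f).
by apply: (dfun_nat (Tm := fun X Y f => f) _ _ (tau := fun X => biprod_inl X Z)).
Qed.

Lemma dadd0l X Y (f : dhom X Y) : deq (dadd (dzero X Y) f) f.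
Proof.
rewrite /dadd.
have -> : deq (DComp (DMap (biprod_swap Y X))
    (DComp (dbiprod X (dzero X Y)) (DMap (biprod_diag X))))
  (DMap (biprod_inl X Y)).
  by rewrite /dbiprod /= -!deq_mapM; apply: deq_map => n A x.
rewrite -dbiprod_inl deq_compA (deq_mapE (h := cmap_id Y)) ?deq_idl //.
by move=> n A x; rewrite /= addr0.
Qed.

Lemma dzero_compl X Y Z (f : dhom X Y) : deq (DComp (dzero Y Z) f) (dzero X Z).
Proof.
elim: f Z => {X Y} [X Y f|X Y s q|X Y W g IHg f IHf] Z.
- by apply: deq_mapE => n A x; rewrite /= .
- apply: (deq_cancelr q); rewrite -deq_compA deq_invl deq_idr.
  by apply: deq_sym; apply: deq_mapE.
- by rewrite deq_compA IHg IHf.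
Qed.

Lemma dzero_compr X Y Z (f : dhom Y Z) : deq (DComp f (dzero X Y)) (dzero X Z).
Proof.
elim: f X => {Y Z} [Y Z f|Y Z s q|Y Z W g IHg f IHf] X.
- by apply: deq_mapE => n A x; rewrite /= linear0.
- apply: (deq_cancell q); rewrite deq_invr'.
  by apply: deq_sym; apply: deq_mapE => n A x; rewrite /= linear0.
- by rewrite -deq_compA IHf IHg.
Qed.

Section Sums.
Context (I : Type) (Y : I -> cpx k U).

Lemma csum_ext n A (W : lmodType k) (f g : {linear csum Y n A -> W}) :
  (forall i (x : Y i n A), f (csum_in Y i n A x) = g (csum_in Y i n A x)) ->
  forall z, f z = g z.
Proof. exact: dsum_ext. Qed.

Section Rec.
Context (Z : cpx k U) (f : forall i, cmap (Y i) Z).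

Definition csum_rec_at n A : {linear csum Y n A -> Z n A} :=
  dsum_rec (fun i => f i n A).

Lemma csum_rec_atE i n A (x : Y i n A) :
  csum_rec_at n A (csum_in Y i n A x) = f i n A x.
Proof. exact: dsum_recE. Qed.

Program Definition csum_rec : cmap (csum Y) Z :=
  @CMap k U (csum Y) Z (fun n =>
    @RHom k U (csum Y n) (Z n) (csum_rec_at n) _) _.
Next Obligation.
move=> n A B e.
apply: (csum_ext (f := lcomp (csum_rec_at n A) (res (csum Y n) e))
  (g := lcomp (res (Z n) e) (csum_rec_at n B))) => i x.
by rewrite !lcompE -rhom_nat !csum_rec_atE rhom_nat.
Qed.
Next Obligation.
move=> n A.
apply: (csum_ext (f := lcomp (csum_rec_at (n - 1) A) (cd (csum Y) n A))
  (g := lcomp (cd Z n A) (csum_rec_at n A))) => i x.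
by rewrite !lcompE -cmap_d !csum_rec_atE cmap_d.
Qed.

Lemma csum_recE i n A (x : Y i n A) :
  csum_rec n A (csum_in Y i n A x) = f i n A x.
Proof. exact: dsum_recE. Qed.
End Rec.

Lemma csum_cmap_ext (Z : cpx k U) (f g : cmap (csum Y) Z) :
  (forall i, cmap_eq (cmap_comp f (csum_in Y i)) (cmap_comp g (csum_in Y i))) ->
  cmap_eq f g.
Proof. by move=> fg n A; apply: csum_ext => i x; exact: fg. Qed.

Definition csum_proj i : cmap (csum Y) (Y i) :=
  csum_rec (fun j => if pselect (j = i) is left e
    then eq_rect j (fun j' => cmap (Y j) (Y j')) (cmap_id (Y j)) i e
    else cmap_zero (Y j) (Y i)).

Lemma csum_projE i n A x : csum_proj i n A (csum_in Y i n A x) = x.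
Proof.
rewrite /csum_proj csum_recE; case: pselect => // e.
by rewrite (Prop_irrelevance e erefl).
Qed.

Lemma csum_proj_ne i j n A x : j <> i -> csum_proj i n A (csum_in Y j n A x) = 0.
Proof. by move=> ne; rewrite /csum_proj csum_recE; case: pselect. Qed.

Definition csum_cut (s : seq I) : cmap (csum Y) (csum Y) :=
  csum_rec (fun j => if pselect (List.In j s) is left _
    then cmap_zero (Y j) (csum Y) else csum_in Y j).

Lemma csum_cut_in s j n A x : List.In j s ->
  csum_cut s n A (csum_in Y j n A x) = 0.
Proof. by move=> js; rewrite /csum_cut csum_recE; case: pselect. Qed.

Lemma csum_cut_out s j n A x : ~ List.In j s ->
  csum_cut s n A (csum_in Y j n A x) = csum_in Y j n A x.
Proof. by move=> js; rewrite /csum_cut csum_recE; case: pselect. Qed.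

Lemma csum_cut_sub s t n A z : (forall i, List.In i s -> List.In i t) ->
  csum_cut t n A (csum_cut s n A z) = csum_cut t n A z.
Proof.
move=> st; move: z.
apply: (csum_ext (f := lcomp (csum_cut t n A) (csum_cut s n A))) => i x.
rewrite lcompE; case: (pselect (List.In i s)) => si.
  by rewrite (csum_cut_in _ si) linear0 csum_cut_in //; exact: st.
by rewrite (csum_cut_out _ si).
Qed.

(** An element is a finite combination of generators, each in a single summand. All finiteness in
    the treatment of compact objects starts here. *)
Lemma csum_support n A (z : csum Y n A) :
  exists s, csum_cut s n A z = 0.
Proof.
move: z; apply: pres_ind => [[i x]||x [s xs]|x y [s xs] [t yt]|c x [s xs]].
- by exists [:: i]; apply: (csum_cut_in (x : Y i n A)); left.
- by exists [::]; rewrite linear0.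
- by exists s; rewrite linearN xs oppr0.
- exists (s ++ t); rewrite linearD.
  rewrite -(csum_cut_sub (s := s)) ?xs; last by move=> i si; apply/List.in_or_app; left.
  rewrite -[csum_cut _ _ _ y](csum_cut_sub (s := t)) ?yt; last by move=> i si; apply/List.in_or_app; right.
  by rewrite !linear0 addr0.
- by exists s; rewrite linearZ_LR xs scaler0.
Qed.

Fixpoint csum_part (s : seq I) : cmap (csum Y) (csum Y) :=
  if s is i :: s' then cmap_add (cmap_comp (csum_in Y i) (csum_proj i)) (csum_part s')
  else cmap_zero _ _.

Lemma csum_part_cons i s n A z : csum_part (i :: s) n A z =
  csum_in Y i n A (csum_proj i n A z) + csum_part s n A z.
Proof. by []. Qed.

Lemma csum_part_notin s j n A x : ~ List.In j s -> csum_part s n A (csum_in Y j n A x) = 0.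
Proof.
elim: s => // i s IH /not_orP[ij js].
by rewrite csum_part_cons IH // csum_proj_ne ?linear0 ?addr0 // => /esym.
Qed.

Lemma csum_part_in s j n A x : List.NoDup s -> List.In j s ->
  csum_part s n A (csum_in Y j n A x) = csum_in Y j n A x.
Proof.
move=> us; elim: us j x => {s} [//|i s nis us IH] j x [ij|js].
  case: j / ij x => x.
  by rewrite csum_part_cons csum_projE csum_part_notin // addr0.
rewrite csum_part_cons IH // csum_proj_ne ?linear0 ?add0r // => ij.
by apply: nis; rewrite -ij.
Qed.

Lemma csum_part_cut s : List.NoDup s ->
  cmap_eq (cmap_add (csum_part s) (csum_cut s)) (cmap_id _).
Proof.
move=> us; apply: csum_cmap_ext => j n A x.
rewrite -[LHS]/(csum_part s n A (csum_in Y j n A x) + csum_cut s n A (csum_in Y j n A x)).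
case: (pselect (List.In j s)) => js.
  by rewrite csum_cut_in // addr0 csum_part_in.
by rewrite csum_part_notin // csum_cut_out // add0r.
Qed.

End Sums.

(** The working form of compactness: a morphism to a sum factors through a finite subsum, expressed
    by deleting finitely many summands so that no components have to be named. *)
Definition small X : Prop :=
  forall (I : Type) (Y : I -> cpx k U) (f : dhom X (csum Y)),
    exists s, deq (DComp (DMap (csum_cut Y s)) f) (dzero _ _).

Lemma dsum_hom_proj X I (Y : I -> cpx k U) (g : forall i, dhom X (Y i)) s i :
  ~ List.In i s -> deq (DComp (DMap (csum_proj Y i)) (dsum_hom g s)) (dzero _ _).
Proof.
elim: s => [_|j s IH /not_orP[ij js]] /=; first exact: dzero_compr.
rewrite dadd_compr IH // dadd0 deq_compA.
rewrite (deq_mapE (h := cmap_zero _ _)) ?dzero_compl //.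
by move=> n A x /=; rewrite csum_proj_ne.
Qed.

Lemma dsum_hom_proj_in X I (Y : I -> cpx k U) (g : forall i, dhom X (Y i)) s i :
  List.NoDup s -> List.In i s ->
  deq (DComp (DMap (csum_proj Y i)) (dsum_hom g s)) (g i).
Proof.
elim=> {s} [//|j s js us IH] /= [<-|si]; rewrite dadd_compr.
  rewrite dsum_hom_proj // dadd0 deq_compA (deq_mapE (h := cmap_id _)) ?deq_idl //.
  by move=> n A x /=; rewrite csum_projE.
rewrite IH // deq_compA (deq_mapE (h := cmap_zero _ _)) ?dzero_compl ?dadd0l //.
by move=> n A x /=; rewrite csum_proj_ne // => ji; apply: js; rewrite ji.
Qed.

Lemma dsum_hom_cut X I (Y : I -> cpx k U) (g : forall i, dhom X (Y i)) s t :
  (forall i, List.In i s -> List.In i t) ->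
  deq (DComp (DMap (csum_cut Y t)) (dsum_hom g s)) (dzero _ _).
Proof.
elim: s => [_|j s IH st] /=; first exact: dzero_compr.
rewrite dadd_compr IH => [|i si]; last by apply: st; right.
rewrite dadd0 deq_compA (deq_mapE (h := cmap_zero _ _)) ?dzero_compl //.
by move=> n A x /=; rewrite csum_cut_in //; apply: st; left.
Qed.

Lemma dsum_hom_part X I (Y : I -> cpx k U) (f : dhom X (csum Y)) s :
  deq (dsum_hom (fun i => DComp (DMap (csum_proj Y i)) f) s)
      (DComp (DMap (csum_part Y s)) f).
Proof.
elim: s => [|i s IH] /=; first by apply: deq_sym; exact: dzero_compl.
by rewrite IH deq_compA -deq_mapM -dadd_compl dadd_map.
Qed.

Lemma nodup_seq (I : Type) (s : seq I) :
  exists2 t, List.NoDup t & forall i, List.In i s -> List.In i t.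
Proof.
elim: s => [|i s [t ut st]]; first by exists [::] => //; exact: List.NoDup_nil.
case: (pselect (List.In i t)) => it.
  by exists t => // j /= [<-|/st].
exists (i :: t); first exact: List.NoDup_cons.
by move=> j /= [<-|/st]; [left|right].
Qed.

(** Injectivity of the canonical map holds for every X, since projections recover the components.
    For surjectivity, the identity of the sum is [csum_part] plus [csum_cut] over a list without
    repetition, and smallness removes the second term. *)
Lemma compact_small X : compact_obj X <-> small X.
Proof.
split=> [cX I Y f|sX I Y].
  have [_ /(_ f) [g [s [us e]]]] := cX I Y.
  by exists s; rewrite e; exact: dsum_hom_cut.
split=> [g s us e i si|f].
  by rewrite -(dsum_hom_proj_in g us si) e dzero_compr.
have [s0 fs0] := sX I Y f; have [s us ss] := nodup_seq s0.
exists (fun i => DComp (DMap (csum_proj Y i)) f), s; split=> //.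
have fs : deq (DComp (DMap (csum_cut Y s)) f) (dzero _ _).
  have <- : deq (DComp (DMap (csum_cut Y s)) (DMap (csum_cut Y s0)))
      (DMap (csum_cut Y s)).
    by apply: deq_mapE => n A x /=; exact: csum_cut_sub.
  by rewrite -deq_compA fs0 dzero_compr.
rewrite dsum_hom_part -{1}(deq_idl f) /did -(deq_map (csum_part_cut us)).
by rewrite -dadd_map dadd_compl fs dadd0.
Qed.

End Additive.
Lemma addrKl (V : zmodType) (x y : V) : x + y - x = y.
Proof. by rewrite addrC addKr. Qed.

Lemma addNr_eq0 (V : zmodType) (x y : V) : - x + y = 0 -> y = x.
Proof. by move/eqP; rewrite addrC subr_eq0 => /eqP. Qed.

Lemma addrBB (V : zmodType) (b x y : V) : b = (x + y) + (b - x - y).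
Proof. by rewrite -(addrA b) -opprD subrKC. Qed.

(** * Action of words on homology, homotopies, and the calculus of fractions *)

Section Homology.
Context (k : fieldType) (U : finGroupType -> Prop).
Implicit Types (X Y Z W : cpx k U) (A B : grp U) (n : int).

(** Cycles are taken in degree n - 1 throughout, so that boundaries come from degree n and no
    transport along n + 1 - 1 = n occurs. *)
Definition bdry X n A (x : X (n - 1) A) : Prop := exists z, x = cd X n A z.
Arguments bdry : clear implicits.

Lemma bdry0 X n A : bdry X n A 0.
Proof. by exists 0; rewrite linear0. Qed.

Lemma bdryD X n A x y : bdry X n A x -> bdry X n A y -> bdry X n A (x + y).
Proof. by case=> a -> [b ->]; exists (a + b); rewrite linearD. Qed.

Lemma bdryN X n A x : bdry X n A x -> bdry X n A (- x).
Proof. by case=> a ->; exists (- a); rewrite linearN. Qed.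

Lemma bdry_d X n A z : bdry X n A (cd X n A z).
Proof. by exists z. Qed.

Lemma bdry_map X Y (f : cmap X Y) n A x : bdry X n A x -> bdry Y n A (f _ A x).
Proof. by case=> z ->; exists (f n A z); rewrite cmap_d. Qed.

Lemma bdry_res X n A B (e : epi A B) x : bdry X n B x -> bdry X n A (res _ e x).
Proof. by case=> z ->; exists (res _ e z); rewrite rhom_nat. Qed.

Lemma bdry_sym X n A x y : bdry X n A (x - y) -> bdry X n A (y - x).
Proof. by move/bdryN; rewrite opprB. Qed.

Lemma bdry_trans X n A y x z :
  bdry X n A (x - y) -> bdry X n A (y - z) -> bdry X n A (x - z).
Proof. by move=> xy /(bdryD xy); rewrite addrA subrK. Qed.

Lemma bdry_mapB X Y (f : cmap X Y) n A x y :
  bdry X n A (x - y) -> bdry Y n A (f _ A x - f _ A y).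
Proof. by move/(bdry_map f); rewrite linearB. Qed.

Lemma qi_inj X Y (s : cmap X Y) n A x : quasi_iso s ->
  cd X (n - 1) A x = 0 -> bdry Y n A (s _ A x) -> bdry X n A x.
Proof. by move=> qs dx b; have [+ _] := qs n A; apply. Qed.

Lemma qi_surj X Y (s : cmap X Y) n A y : quasi_iso s ->
  cd Y (n - 1) A y = 0 ->
  exists2 x, cd X (n - 1) A x = 0 & bdry Y n A (y - s _ A x).
Proof.
move=> qs dy; have [_ /(_ y dy)[x dx [z ->]]] := qs n A.
by exists x => //; exists z; exact: addrKl.
Qed.

Lemma quasi_isoP X Y (s : cmap X Y) :
  (forall n A x, cd X (n - 1) A x = 0 -> bdry Y n A (s _ A x) -> bdry X n A x) ->
  (forall n A y, cd Y (n - 1) A y = 0 ->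
    exists2 x, cd X (n - 1) A x = 0 & bdry Y n A (y - s _ A x)) ->
  quasi_iso s.
Proof.
move=> i q n A; split=> [x dx b|y /q[x dx [z e]]]; first exact: i.
by exists x => //; exists z; rewrite -e; exact/esym/subrKC.
Qed.

(* The relation on cycles that induces the action of [f] on homology. *)
Fixpoint hrel X Y (f : dhom X Y) n A : X (n - 1) A -> Y (n - 1) A -> Prop :=
  match f in dhom X Y return X (n - 1) A -> Y (n - 1) A -> Prop with
  | DMap X Y f => fun x y => bdry Y n A (y - f _ A x)
  | DInv X Y s _ => fun x y => bdry Y n A (x - s _ A y)
  | DComp X Y Z g f => fun x z =>
      exists y, [/\ cd Y (n - 1) A y = 0, @hrel X Y f n A x y & @hrel Y Z g n A y z]
  end.
Arguments hrel {X Y} f n A.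

Lemma hrel_bdry X Y (f : dhom X Y) n A x x' y y' :
  bdry X n A (x - x') -> bdry Y n A (y - y') -> hrel f n A x y -> hrel f n A x' y'.
Proof.
elim: f x x' y y' => {X Y} [X Y f|X Y s q|X Y Z g IHg f IHf] x x' y y' bx by_ /=.
- move=> b; apply: bdry_trans (bdry_sym by_) _.
  by apply: bdry_trans b _; exact: bdry_mapB.
- move=> b; apply: bdry_trans (bdry_sym bx) _.
  by apply: bdry_trans b _; exact: bdry_mapB.
- case=> w [dw fw gw]; exists w; split=> //.
    by apply: IHf fw => //; rewrite subrr; exact: bdry0.
  by apply: IHg gw => //; rewrite subrr; exact: bdry0.
Qed.

(** The way back from equalities in D(U) to complexes. As [deq] is inductively generated, each
    generator is checked separately; the two cancellation laws amount to injectivity and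
    surjectivity of a quasi-isomorphism on homology. *)
Lemma hrel_deq X Y (f g : dhom X Y) n A x y : deq f g ->
  cd X (n - 1) A x = 0 -> cd Y (n - 1) A y = 0 ->
  (hrel f n A x y <-> hrel g n A x y).
Proof.
move=> e; elim: e x y => {X Y f g} //=.
- by move=> X Y f g _ IH x y dx dy; split=> /IH; apply.
- by move=> X Y f g h _ IH1 _ IH2 x y dx dy; rewrite IH1 // IH2.
- move=> X Y Z g g' f f' _ IHg _ IHf x y dx dy; split=> -[w [dw a b]];
    exists w; split=> //; by [apply/IHf|apply/IHg].
- move=> X Y Z T h g f x y dx dy; split.
    by case=> w [dw [v [dv a b]] c]; exists v; split=> //; exists w.
  by case=> w [dw a [v [dv b c]]]; exists v; split=> //; exists w.
- move=> X Y f x y dx dy; split=> [[w [dw a b]]|a].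
    apply: hrel_bdry a; last exact: bdry_sym.
    by rewrite subrr; exact: bdry0.
  by exists y; split=> //; rewrite subrr; exact: bdry0.
- move=> X Y f x y dx dy; split=> [[w [dw a b]]|a].
    by apply: hrel_bdry b => //; rewrite subrr; exact: bdry0.
  by exists x; split=> //; rewrite subrr; exact: bdry0.
- by move=> X Y f g fg x y dx dy; rewrite fg.
- move=> X Y Z g f x y dx dy; split=> [a|[w [dw a b]]].
    exists (f _ A x); split=> //; first by rewrite -cmap_d dx linear0.
    by rewrite subrr; exact: bdry0.
  by apply: bdry_trans b _; exact: bdry_mapB.
- move=> X Y s q x y dx dy; split=> [[w [dw a b]]|a].
    apply: (qi_inj q); first by rewrite linearB dx dy subrr.
    by rewrite linearB; apply: bdry_trans (bdry_sym b) a.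
  exists (s _ A x); split; first by rewrite -cmap_d dx linear0.
    by rewrite subrr; exact: bdry0.
  exact/bdry_mapB/bdry_sym.
- move=> X Y s q x y dx dy; split=> [[w [dw a b]]|a].
    exact: bdry_trans b (bdry_sym a).
  have [w dw xw] := qi_surj q dx.
  by exists w; split=> //; exact: bdry_trans a xw.
Qed.

Lemma deq_bdry X Y (f g : cmap X Y) n A x : deq (DMap f) (DMap g) ->
  cd X (n - 1) A x = 0 -> bdry Y n A (f _ A x - g _ A x).
Proof.
move=> e dx; apply: ((hrel_deq (y := f _ A x) e dx _).1 _).
  by rewrite -cmap_d dx linear0.
by rewrite /= subrr; exact: bdry0.
Qed.

Definition htp X Y (f g : cmap X Y) : Prop :=
  exists h : forall n, rhom (X (n - 1)) (Y n), forall n A x,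
    f (n - 1) A x = g (n - 1) A x + (cd Y n A (h n A x) +
                                     h (n - 1) A (cd X (n - 1) A x)).

(** The cone of x |-> (x, -x) is the cylinder of X: the two summands are its ends, and the shifted
    copy of X joins them. *)
Program Definition cyl_in X : cmap X (biprod X X) :=
  @CMap k U X (biprod X X) (fun n => @RHom k U (X n) (biprod X X n)
    (fun A => @mklin k (X n A) (X n A * X n A)%type (fun x => (x, - x)) _) _) _.
Next Obligation. by move=> X n A c x y; congr pair; rewrite /= opprD scalerN. Qed.
Next Obligation. by move=> X n A B e x; congr pair; rewrite /= linearN. Qed.
Next Obligation. by move=> X n A x; congr pair; rewrite /= linearN. Qed.

Program Definition cyl_out X : cmap (cone (cyl_in X)) X :=
  @CMap k U (cone (cyl_in X)) X (fun n => @RHom k U (cone (cyl_in X) n) (X n)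
    (fun A => @mklin k (cone (cyl_in X) n A) (X n A) (fun z => z.2.1 + z.2.2) _) _) _.
Next Obligation. by move=> X n A c [x [a b]] [x' [a' b']]; rewrite /= scalerDr addrACA. Qed.
Next Obligation. by move=> X n A B e [x [a b]]; rewrite /= linearD. Qed.
Next Obligation.
by move=> X n A [x [a b]]; rewrite /= addrACA subrr add0r linearD.
Qed.

Lemma cyl_out_qi X : quasi_iso (cyl_out X).
Proof.
apply: quasi_isoP => n A.
  move=> [x [a b]] [/= dx xa xb] [y /= yE].
  have xE : x = cd X (n - 1) A b.
    by apply/esym/eqP; rewrite -subr_eq0; apply/eqP; rewrite -xb; exact: addrC.
  exists (- b, (y, 0)); congr pair; rewrite /= ?linearN ?opprK //.
  by congr pair; rewrite ?linear0 ?addr0 // -yE /= (addrC a b) addKr.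
move=> y dy; exists (0, (y, 0)).
  by congr pair; rewrite /= ?linear0 ?oppr0 ?add0r // dy ?linear0.
by rewrite /= addr0 subrr; exact: bdry0.
Qed.

Section ConeRec.
Context X Y Z (f : cmap X Y) (u : cmap Y Z) (h : forall n, rhom (X (n - 1)) (Z n)).
Hypothesis hP : forall n A x, u (n - 1) A (f (n - 1) A x) =
  cd Z n A (h n A x) + h (n - 1) A (cd X (n - 1) A x).

Program Definition cone_rec : cmap (cone f) Z :=
  @CMap k U (cone f) Z (fun n => @RHom k U (cone f n) (Z n)
    (fun A => @mklin k (cone f n A) (Z n A) (fun z => h n A z.1 + u n A z.2) _) _) _.
Next Obligation.
by move=> n A c [x y] [x' y']; rewrite /= !linearP scalerDr addrACA.
Qed.
Next Obligation. by move=> n A B e [x y]; rewrite /= !rhom_nat linearD. Qed.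
Next Obligation.
move=> n A [x y]; rewrite /= linearN linearD hP cmap_d linearD.
by rewrite addrA addrCA addNr addr0.
Qed.

Lemma cone_rec_in : cmap_eq (cmap_comp cone_rec (cone_in f)) u.
Proof. by move=> n A x; rewrite /= linear0 add0r. Qed.
End ConeRec.

(** A homotopy is a map from the cylinder restricting to [f] and [g] on the ends. Both ends are
    sections of the quasi-isomorphism [cyl_out], hence equal in D(U). *)
Lemma htp_deq X Y (f g : cmap X Y) : htp f g -> deq (DMap f) (DMap g).
Proof.
case=> h hP.
pose u := cmap_comp (biprod_fold Y) (cmap_comp (biprod_map Y f) (biprod_mapr X g)).
have uP n A x : u (n - 1) A (cyl_in X _ A x) =
    cd Y n A (h n A x) + h (n - 1) A (cd X (n - 1) A x).
  by rewrite /= linearN hP addrAC subrr add0r.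
have e : deq (DMap (cmap_comp (cone_in (cyl_in X)) (biprod_inl X X)))
  (DMap (cmap_comp (cone_in (cyl_in X)) (cmap_comp (biprod_swap X X) (biprod_inl X X)))).
  apply: (deq_cancell (cyl_out_qi X)); apply: deq_mapE2 => n A x /=.
  by rewrite addrC.
have /(deq_comp (deq_refl (DMap (cone_rec uP)))) := e.
rewrite -!deq_mapM => e'; apply: deq_trans (deq_trans e' _).
  by apply: deq_map => n A x; rewrite /= !linear0 !addr0 add0r.
by apply: deq_map => n A x; rewrite /= !linear0 !add0r.
Qed.

Section Push.
Context X Y Z (s : cmap X Y) (u : cmap X Z).

(** The cone of x |-> (u x, - s x) is the homotopy pushout of [s] and [u]; it moves a formal inverse
    across a chain map, as the Ore condition requires. *)
Program Definition push_in : cmap X (biprod Z Y) :=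
  @CMap k U X (biprod Z Y) (fun n => @RHom k U (X n) (biprod Z Y n)
    (fun A => @mklin k (X n A) (Z n A * Y n A)%type (fun x => (u n A x, - s n A x)) _) _) _.
Next Obligation. by move=> n A c x y; congr pair; rewrite /= linearP // opprD scalerN. Qed.
Next Obligation. by move=> n A B e x; congr pair; rewrite /= rhom_nat ?linearN. Qed.
Next Obligation. by move=> n A x; congr pair; rewrite /= cmap_d ?linearN. Qed.

Definition push := cone push_in.
Definition push_l : cmap Z push := cmap_comp (cone_in push_in) (biprod_inl Z Y).
Definition push_r : cmap Y push :=
  cmap_comp (cone_in push_in) (cmap_comp (biprod_swap Y Z) (biprod_inl Y Z)).

Lemma push_htp : htp (cmap_comp push_l u) (cmap_comp push_r s).
Proof.
pose h n A : {linear X (n - 1) A -> push n A} :=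
  mklin (@pair_inl_linear k (X (n - 1) A) (biprod Z Y n A)).
have hn n A B (e : epi A B) x : h n A (res _ e x) = res (push n) e (h n B x).
  by congr pair; rewrite linear0.
exists (fun n => RHom (hn n)) => n A x.
congr pair; rewrite /= ?addNr ?addr0 ?add0r // !linear0 !addr0.
by congr pair; rewrite /= ?add0r // ?addr0 ?addrN // subrr.
Qed.

Lemma push_l_qi : quasi_iso s -> quasi_iso push_l.
Proof.
move=> q; apply: quasi_isoP => n A.
  move=> z dz [[y [a b]]] [/= e1 e2 e3].
  have dy : cd X (n - 1) A y = 0 by rewrite -[LHS]opprK -e1 oppr0.
  have /(qi_inj q dy)[y' yE] : bdry Y n A (s _ A y).
    by exists b; apply/esym/addNr_eq0.
  by exists (u _ A y' + a); rewrite linearD -cmap_d -yE.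
move=> [y [a b]] [/= e1 e2 e3].
have dy : cd X (n - 1 - 1) A y = 0 by rewrite -[LHS]opprK e1 oppr0.
have bE : cd Y (n - 1) A b = s _ A y.
  exact: addNr_eq0.
have /(qi_inj q dy)[y' yE] : bdry Y (n - 1) A (s _ A y) by exists b.
have [|w dw [c cE]] := qi_surj (y := b - s _ A y') q.
  by rewrite linearB -cmap_d -yE bE subrr.
have e4 : cd Z (n - 1) A (u (n - 1) A (y' + w)) = u (n - 1 - 1) A y.
  by rewrite -cmap_d linearD dw addr0 -yE.
exists (a + u _ A (y' + w)).
  by rewrite (linearD (cd Z (n - 1) A)) e4 -e2; exact: addrC.
exists (- (y' + w), (0, c)); congr pair; rewrite /= ?subr0.
  by rewrite linearN opprK linearD dw addr0.
congr pair; rewrite /= linearN ?opprK ?linear0 ?addr0 ?subr0.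
  by rewrite opprD addrA subrr add0r.
by rewrite -cE linearD; exact: addrBB.
Qed.
End Push.

(** In a composite of two roofs the inner inverse is moved outwards by a homotopy pushout. Its
    square commutes only up to homotopy, which [htp_deq] turns into an equality. *)
Lemma roof_ex X Y (f : dhom X Y) : exists Z (s : cmap Y Z) (q : quasi_iso s)
  (u : cmap X Z), deq f (DComp (DInv q) (DMap u)).
Proof.
have qid W : quasi_iso (cmap_id W).
  apply: quasi_isoP => // n A y dy; exists y => //.
  by rewrite subrr; exact: bdry0.
elim: f => {X Y} [X Y f|X Y s q|X Y W g [Z1 [s1 [q1 [u1 e1]]]] f [Z2 [s2 [q2 [u2 e2]]]]].
- exists Y, (cmap_id Y), (qid Y), f; apply: (deq_cancell (qid Y)).
  by rewrite deq_invr' deq_idl.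
- by exists Y, s, q, (cmap_id Y); rewrite deq_idr.
have ql := push_l_qi u1 q2.
have qc : quasi_iso (cmap_comp (push_l s2 u1) s1).
  apply: quasi_isoP => n A.
    move=> x dx b; apply: (qi_inj q1 dx); apply: (qi_inj ql _ b).
    by rewrite -cmap_d dx linear0.
  move=> y /(qi_surj ql)[z /(qi_surj q1)[x dx xz] zy]; exists x => //.
  by apply: bdry_trans zy _; exact: bdry_mapB.
exists (push s2 u1), (cmap_comp (push_l s2 u1) s1), qc, (cmap_comp (push_r s2 u1) u2).
have key : deq (DComp (DMap (push_l s2 u1)) (DMap u1))
    (DComp (DMap (push_r s2 u1)) (DMap s2)).
  by rewrite -!deq_mapM; exact/htp_deq/push_htp.
apply: (deq_cancell qc); rewrite deq_invr' e1 e2 (deq_mapM (push_l s2 u1)) (deq_mapM (push_r s2 u1)) -!deq_compA deq_invr'.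
by rewrite (deq_compA (DMap (push_l s2 u1))) key -!deq_compA deq_invr'.
Qed.

Definition acyclic X : Prop :=
  forall n A x, cd X (n - 1) A x = 0 -> bdry X n A x.

(** The zero map of an acyclic complex is a quasi-isomorphism, so the identity is its formal inverse
    composed with zero. *)
Lemma acyclic_did X : acyclic X -> deq (did X) (dzero X X).
Proof.
move=> aX; have q : quasi_iso (cmap_zero X X).
  apply: quasi_isoP => n A x dx; first by move=> _; exact: aX.
  by exists 0; [rewrite linear0 | rewrite linear0 subr0; exact: aX].
by rewrite -(deq_invl q) -/(dzero X X) dzero_compr.
Qed.

Lemma acyclic_small X : acyclic X -> small X.
Proof.
move=> /acyclic_did e I Y f; exists [::].
by rewrite -(deq_idr f) e !dzero_compr.
Qed.

(** After some summands are deleted [f] vanishes on E. The remainder is written as a roof; [hE]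
    makes its numerator null-homotopic on E, which is what extends it over the cone, and smallness
    of the cone deletes the rest. *)
Lemma small_cone_inv E X (phi : cmap E X) :
  small E -> (forall Z (a : cmap E Z), deq (DMap a) (dzero E Z) -> htp a (cmap_zero E Z)) ->
  small (cone phi) -> small X.
Proof.
move=> sE hE sC I Y f.
have [s es] := sE I Y (DComp f (DMap phi)).
have [Z [t [q [u eu]]]] := roof_ex (DComp (DMap (csum_cut Y s)) f).
have : deq (DMap (cmap_comp u phi)) (dzero E Z).
  rewrite deq_mapM -(deq_invr' q (DMap u)) -eu -!deq_compA es !dzero_compr.
  by [].
case/hE=> h hP.
have {}hP n A x : u (n - 1) A (phi (n - 1) A x) =
    cd Z n A (h n A x) + h (n - 1) A (cd E (n - 1) A x).
  by rewrite -[RHS]add0r; exact: hP.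
have [s' es'] := sC I Y (DComp (DInv q) (DMap (cone_rec hP))).
exists (s' ++ s).
have e : cmap_eq (csum_cut Y (s' ++ s))
    (cmap_comp (csum_cut Y (s' ++ s)) (cmap_comp (csum_cut Y s') (csum_cut Y s))).
  move=> n A x /=; rewrite !csum_cut_sub // => i si; apply: List.in_or_app; by [left|right].
rewrite (deq_map e) !deq_mapM -!deq_compA eu.
by rewrite -(deq_map (cone_rec_in hP)) deq_mapM !(deq_compA (DInv q)) (deq_compA (DMap (csum_cut Y s'))) es'
  dzero_compl dzero_compr.
Qed.

End Homology.
#[global] Arguments bdry {k U} X n A x.
(** * Homology over a field *)
Lemma int_pred_ind (P : int -> Prop) : (forall n, P (n - 1)) -> forall n, P n.
Proof. by move=> Pn n; rewrite -(addrK 1 n); exact: Pn. Qed.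

(** Homotopies and projections arise in degrees n - 1. The one transport needed to index them by all
    integers is done here, and it disappears in degree n - 1. *)
Lemma int_pred_ex (T : int -> Type) (g : forall n, T (n - 1)) :
  exists f : forall n, T n, forall n, f (n - 1) = g n.
Proof.
exists (fun n => eq_rect (n + 1 - 1) T (g (n + 1)) n (addrK 1 n)) => n.
move: (addrK 1 (n - 1)); have : n - 1 + 1 = n by rewrite subrK.
move: (n - 1 + 1) => m e; rewrite {}e => e.
by rewrite (Prop_irrelevance e erefl).
Qed.

Section Complement.
Context (k : fieldType) (V : lmodType k).

Definition lin_closed (S : V -> Prop) :=
  forall c x y, S x -> S y -> S (c *: x + y).

Lemma lin_closedZ S c x : lin_closed S -> S x -> S (c *: x).
Proof.
by move=> cS Sx; have := cS (c - 1) x x Sx Sx; rewrite scalerBl scale1r subrK.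
Qed.

Lemma complement_ex (S : V -> Prop) : lin_closed S -> S 0 ->
  exists C : V -> Prop, [/\ lin_closed C, C 0,
    forall x, S x -> C x -> x = 0 &
    forall v, exists s c, [/\ S s, C c & v = s + c]].
Proof.
move=> cS S0.
pose P (A : set V) := lin_closed A /\ forall x, S x -> A x -> x = 0.
have [F FP totF|A [[cA SA] maxA]] := @Zorn_bigcup V P.
  split=> [c x y [B FB Bx] [B' FB' By]|x Sx [B FB Bx]]; last exact: (FP B FB).2 Bx.
  have [BB|BB] := totF _ _ FB FB'.
    by exists B' => //; apply: (FP B' FB').1 => //; exact: BB.
  by exists B => //; apply: (FP B FB).1 => //; exact: BB.
(* The union of the empty chain is empty, so [P] does not demand 0; it is adjoined afterwards. *)
have cC : lin_closed (fun x => A x \/ x = 0).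
  move=> c x y [Ax|->] [Ay|->]; rewrite ?scaler0 ?addr0 ?add0r; try by [left|right].
  - by left; exact: cA.
  - by left; exact: lin_closedZ.
exists (fun x => A x \/ x = 0); split=> //.
- by right.
- by move=> x Sx [|//]; exact: SA.
move=> v; apply: contrapT => nv.
have nAv : ~ A v by move=> Av; apply: nv; exists 0, v; split; rewrite ?add0r //; left.
(* Otherwise the line through [v] could be added to the maximal set. *)
apply: (maxA [set x | exists c a, (A a \/ a = 0) /\ x = c *: v + a]%classic).
  split=> [x Ax|sub]; first by exists 0, x; split; [left | rewrite scale0r add0r].
  by apply/nAv/sub; exists 1, 0; split; [right | rewrite scale1r addr0].
split=> [c x y [a [b [Cb ->]]] [a' [b' [Cb' ->]]]|x Sx [c [a [Ca xE]]]].
  exists (c * a + a'), (c *: b + b'); split; first exact: cC.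
  by rewrite scalerDr scalerA scalerDl addrACA.
have [c0|c0] := eqVneq c 0.
  by move: xE Ca; rewrite c0 scale0r add0r => <- [|//]; exact: SA.
case: nv; exists (c^-1 *: x), ((- c^-1) *: a); split.
- exact: (lin_closedZ _ cS Sx).
- exact: (lin_closedZ (S := fun x => A x \/ x = 0) _ cC Ca).
- by rewrite xE scalerDr scalerA mulVf // scale1r scaleNr addrK.
Qed.
End Complement.

(** [m] inverts [d] between a complement of its kernel and its image, and vanishes on a complement
    of the image. *)
Lemma ginv_ex (k : fieldType) (V W : lmodType k) (d : {linear V -> W}) :
  exists m : {linear W -> V}, forall x, d (m (d x)) = d x.
Proof.
have [||C [cC C0 CK CE]] := @complement_ex k V (fun x => d x = 0).
- by move=> c x y dx dy; rewrite linearP dx dy scaler0 addr0.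
- exact: linear0.
have [||D [cD D0 DK DE]] := @complement_ex k W (fun y => exists x, y = d x).
- by move=> c _ _ [x ->] [y ->]; exists (c *: x + y); rewrite linearP.
- by exists 0; rewrite linear0.
have ex w : exists c, C c /\ D (w - d c).
  have [_ [e [[x ->] De wE]]] := DE w; have [s [c [ds Cc xE]]] := CE x.
  by exists c; split=> //; rewrite wE xE linearD ds add0r addrC addKr.
have cN (T : lmodType k) (S : T -> Prop) x y : lin_closed S -> S x -> S y -> S (x - y).
  by move=> cS Sx Sy; have := cS (-1) y x Sy Sx; rewrite scaleN1r addrC.
have un w c c' : C c -> D (w - d c) -> C c' -> D (w - d c') -> c = c'.
  move=> Cc Dc Cc' Dc'; apply/eqP; rewrite -subr_eq0; apply/eqP.
  apply: CK; last exact: cN.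
  apply: DK; first by exists (c - c').
  have := cN _ _ _ _ cD Dc' Dc; rewrite opprB addrC addrA subrK.
  by rewrite linearB.
have [m mP] := choice ex.
have lm : linear m.
  move=> c x y; have [Cx Dx] := mP x; have [Cy Dy] := mP y.
  have [Cm Dm] := mP (c *: x + y); apply: un Cm Dm _ _; first exact: cC.
  by rewrite linearP opprD addrACA -scalerBr; exact: cD.
exists (mklin lm) => x; have [Cx Dx] := mP (d x).
apply/eqP; rewrite eq_sym -subr_eq0; apply/eqP; apply: DK Dx.
by exists (x - m (d x)); rewrite linearB.
Qed.

Lemma addrBB' (V : zmodType) (b x y : V) : b = x - y + (b + y - x).
Proof. by rewrite addrC addrA subrK addrK. Qed.

Lemma addr_aux (V : zmodType) (x a b c : V) :
  x = - a + (- b + c) -> c = x + (a + b).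
Proof. by move=> ->; rewrite (addrA (- a)) -opprD addrAC addNr add0r. Qed.

Lemma addr_aux2 (V : zmodType) (y a b c : V) :
  y = a + b + c -> a = y + (- b - c).
Proof. by move=> ->; rewrite -opprD -(addrA a) addrK. Qed.

Section Constant.
Context (k : fieldType) (U : finGroupType -> Prop).
Implicit Types (X Y Z W : cpx k U) (A B C : grp U) (n : int).

Definition const_rep (V : lmodType k) : rep k U :=
  @Rep k U (fun _ => V) (fun _ _ _ => idfun) (fun _ _ => erefl)
    (fun _ _ _ _ _ _ => erefl) (fun _ _ _ _ _ _ => erefl).

Definition const_map (V W : lmodType k) (f : {linear V -> W}) :
  rhom (const_rep V) (const_rep W) :=
  @RHom k U (const_rep V) (const_rep W) (fun _ => f) (fun _ _ _ _ => erefl).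

(** The value of X at A is viewed as a constant complex, so that chain maps, cones, homotopies and
    tensor products apply to values at single, possibly different, groups. *)
Definition at_cpx A X : cpx k U :=
  @Cpx k U (fun n => const_rep (X n A)) (fun n => const_map (cd X n A))
    (fun n _ => @cdd k U X n A).

Definition at_map A B X Y (f : forall n, {linear X n A -> Y n B})
  (fP : forall n x, f (n - 1) (cd X n A x) = cd Y n B (f n x)) :
  cmap (at_cpx A X) (at_cpx B Y) :=
  @CMap k U (at_cpx A X) (at_cpx B Y) (fun n => const_map (f n)) (fun n _ => fP n).

Definition mp X A n : {linear X (n - 1) A -> X n A} := sval (cid (ginv_ex (cd X n A))).

Lemma mpK X A n x : cd X n A (mp X A n (cd X n A x)) = cd X n A x.
Proof. exact: (svalP (cid (ginv_ex (cd X n A)))). Qed.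

(* The projection onto a complement of the boundaries in the cycles. *)
Definition harm X A n : {linear X (n - 1) A -> X (n - 1) A} :=
  idfun \- (lcomp (cd X n A) (mp X A n) \+ lcomp (mp X A (n - 1)) (cd X (n - 1) A)).

Lemma harmE X A n x : harm X A n x =
  x - (cd X n A (mp X A n x) + mp X A (n - 1) (cd X (n - 1) A x)).
Proof. by []. Qed.

Lemma cd_harm X A n x : cd X (n - 1) A (harm X A n x) = 0.
Proof. by rewrite harmE linearB linearD cdd add0r mpK subrr. Qed.

Lemma harm_cd X A n x : harm X A n (cd X n A x) = 0.
Proof. by rewrite harmE mpK cdd linear0 addr0 subrr. Qed.

Lemma harm_bdry X A n x : cd X (n - 1) A x = 0 -> bdry X n A (x - harm X A n x).
Proof.
move=> dx; rewrite harmE dx linear0 addr0 opprB addrC subrK; exact: bdry_d.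
Qed.

(** Write m for [mp], so that the identity is [harm] + d m + m d. The homotopy is f m + m f [harm]:
    the values of [harm] are cycles, their images under f are boundaries, and d m is the identity on
    boundaries. *)
Lemma null_linear A B X Y (f : forall n, {linear X n A -> Y n B}) :
  (forall n x, f (n - 1) (cd X n A x) = cd Y n B (f n x)) ->
  (forall n x, cd X (n - 1) A x = 0 -> bdry Y n B (f _ x)) ->
  exists h : forall n, {linear X (n - 1) A -> Y n B}, forall n x,
    f (n - 1) x = cd Y n B (h n x) + h (n - 1) (cd X (n - 1) A x).
Proof.
move=> fP f0.
exists (fun n => lcomp (f n) (mp X A n) \+
   lcomp (mp Y B n) (lcomp (f (n - 1)) (harm X A n))) => n x.
change (f (n - 1) x = cd Y n B (f n (mp X A n x) + mp Y B n (f (n - 1) (harm X A n x))) +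
  (f (n - 1) (mp X A (n - 1) (cd X (n - 1) A x)) +
    mp Y B (n - 1) (f (n - 1 - 1) (harm X A (n - 1) (cd X (n - 1) A x))))).
rewrite harm_cd !linear0 addr0 linearD -fP.
have [z zE] := f0 _ _ (cd_harm x).
rewrite zE mpK -zE harmE linearB linearD.
rewrite -addrA [_ + f _ (mp _ _ _ _)]addrC addrA; exact/esym/subrKC.
Qed.

(** The cone of [f] is acyclic, hence contracted by some [s]. The components of [s] are the inverse
    [g], a homotopy from g f to the identity and, up to sign, one from f g to the identity. *)
Lemma qi_inverse A B X Y (f : forall n, {linear X n A -> Y n B}) :
  (forall n x, f (n - 1) (cd X n A x) = cd Y n B (f n x)) ->
  (forall n x, cd X (n - 1) A x = 0 -> bdry Y n B (f _ x) -> bdry X n A x) ->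
  (forall n y, cd Y (n - 1) B y = 0 ->
    exists2 x, cd X (n - 1) A x = 0 & bdry Y n B (y - f _ x)) ->
  exists (g : cmap (at_cpx B Y) (at_cpx A X)) (f' : cmap (at_cpx A X) (at_cpx B Y)),
   [/\ forall n C x, f' n C x = f n x,
     htp (cmap_comp g f') (cmap_id _) & htp (cmap_comp f' g) (cmap_id _)].
Proof.
move=> fP fi fs; pose f' := at_map fP; pose F := cone f'.
have aF n x : cd F (n - 1) A x = 0 -> bdry F n A x.
  case: x => [x y] [/= dx dy]; have {}dx : cd X (n - 1 - 1) A x = 0.
    by rewrite -[LHS]opprK dx oppr0.
  have [|z zE] := fi _ _ dx.
    by exists (- y); rewrite linearN; apply/eqP; rewrite -addr_eq0 dy.
  have [|w dw [v vE]] := fs n (y + f _ z).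
    by rewrite linearD -fP -zE -dy; exact: addrC.
  exists (w - z, v).
  have e1 : x = - cd X (n - 1) A (w - z) by rewrite linearB dw sub0r opprK.
  have e2 : y = f (n - 1) (w - z) + cd Y n B v.
    by rewrite -vE linearB; exact: addrBB'.
  by rewrite {1}e1 {1}e2.
have [s sP] := @null_linear A A F F (fun _ => idfun) (fun _ _ => erefl) aF.
pose s1 n x := (s n x).1; pose s2 n x := (s n x).2.
have sl n (c : k) x y : s n (c *: x + y) = c *: s n x + s n y by rewrite linearP.
have lg n : linear (fun y : Y (n - 1) B => s1 n (0, y)).
  move=> c x y; rewrite /s1 -[RHS]/(c *: s n (0, x) + s n (0, y)).1 -sl.
  by congr (s n _).1; congr pair; rewrite /= ?scaler0 ?addr0.
have [g gE] := @int_pred_ex (fun n => {linear Y n B -> X n A}) (fun n => mklin (lg n)).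
have {}gE n y : g (n - 1) y = s1 n (0, y) by rewrite gE.
have lh n : linear (fun x : X (n - 1 - 1) A => s1 n (x, 0)).
  move=> c x y; rewrite /s1 -[RHS]/(c *: s n (x, 0) + s n (y, 0)).1 -sl.
  by congr (s n _).1; congr pair; rewrite /= ?scaler0 ?addr0.
have [h hE] := @int_pred_ex (fun n => {linear X (n - 1) A -> X n A}) (fun n => mklin (lh n)).
have {}hE n x : h (n - 1) x = s1 n (x, 0) by rewrite hE.
have lk n : linear (fun y : Y (n - 1) B => - s2 n (0, y)).
  move=> c x y.
  have e : s n (0, c *: x + y) = c *: s n (0, x) + s n (0, y).
    by rewrite -sl; congr (s n _); congr pair; rewrite /= ?scaler0 ?addr0.
  by rewrite /s2 e scalerN -opprD.
have dF n y : cd F (n - 1) A (0, y) = (0, cd Y (n - 1) B y).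
  by congr pair; rewrite /= ?linear0 ?oppr0 ?add0r.
have gP n y : g (n - 1) (cd Y n B y) = cd X n A (g n y).
  move: n y; apply: int_pred_ind => n y; rewrite !gE.
  have := sP n (0, y); rewrite dF => -[/= e _].
  by apply: addNr_eq0; exact: esym e.
exists (at_map gP), f'; split=> //.
  exists (fun n => const_map (h n)); apply: int_pred_ind => n C x /=.
  rewrite gE !hE; have [/= e _] := sP n (x, 0).
  have {}e : x = - cd X (n - 1) A (s1 n (x, 0)) +
      s1 (n - 1) (- cd X (n - 1 - 1) A x, f (n - 1 - 1) x + cd Y (n - 1) B 0).
    exact: e.
  have e2 : s1 (n - 1) (- cd X (n - 1 - 1) A x, f (n - 1 - 1) x + cd Y (n - 1) B 0) =
     - s1 (n - 1) (cd X (n - 1 - 1) A x, 0) + s1 (n - 1) (0, f (n - 1 - 1) x).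
    have e3 : s (n - 1) (- cd X (n - 1 - 1) A x, f (n - 1 - 1) x + cd Y (n - 1) B 0) =
       - s (n - 1) (cd X (n - 1 - 1) A x, 0) + s (n - 1) (0, f (n - 1 - 1) x).
      rewrite -[- s _ _]scaleN1r -sl; congr (s _ _); congr pair; rewrite /= ?scaleN1r ?addr0 //.
      by rewrite linear0 addr0 oppr0 add0r.
    by rewrite /s1 e3.
  by rewrite e2 in e; exact: addr_aux e.
exists (fun n => const_map (mklin (lk n))) => n C y /=.
rewrite gE; have := sP n (0, y); rewrite dF => -[/= _ e].
have {}e : y = f (n - 1) (s1 n (0, y)) + cd Y n B (s2 n (0, y)) + s2 (n - 1) (0, cd Y (n - 1) B y).
  exact: e.
by rewrite linearN; exact: addr_aux2 e.
Qed.

(** [harm] kills boundaries and moves [x] within its class, so a linear form with value 1 on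
    [harm x] is composed with it. *)
Lemma funct_ex A X n x : cd X (n - 1) A x = 0 -> ~ bdry X n A x ->
  exists xi : {linear X (n - 1) A -> k^o}, xi x = 1 /\ forall z, xi (cd X n A z) = 0.
Proof.
move=> dx nbx; pose v := harm X A n x.
have v0 : v != 0.
  by apply/eqP => v0; apply: nbx; have := harm_bdry dx; rewrite -/v v0 subr0.
have lv : linear (fun c : k^o => c *: v).
  by move=> c a b; rewrite scalerDl scalerA.
have [m mK] := ginv_ex (mklin lv).
exists (lcomp m (harm X A n)); split; last by move=> z; rewrite lcompE harm_cd linear0.
rewrite lcompE -/v; have := mK 1; rewrite /= !scale1r => e.
have /eqP : (m v - 1) *: v = 0 by rewrite scalerBl e scale1r subrr.
by rewrite scaler_eq0 (negPf v0) orbF subr_eq0 => /eqP.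
Qed.
End Constant.
(** * Tensor products *)
Section TensorHomotopy.
Context (k : fieldType) (U : finGroupType -> Prop).
Implicit Types (X Y Z W : cpx k U) (A B C : grp U) (n : int).

Lemma htp_refl X Y (f g : cmap X Y) : cmap_eq f g -> htp f g.
Proof.
move=> fg; exists (fun n => rhom_zero _ _) => n A x.
by rewrite /= linear0 !addr0 fg.
Qed.

Lemma htp_trans X Y (g f h : cmap X Y) : htp f g -> htp g h -> htp f h.
Proof.
case=> a aP [b bP]; have nat n A B (e : epi A B) x :
    (b n A \+ a n A) (res (X (n - 1)) e x) = res (Y n) e ((b n B \+ a n B) x).
  by rewrite /= !rhom_nat linearD.
exists (fun n => RHom (nat n)) => n A x.
rewrite aP bP /= linearD -addrA; congr (_ + _); exact: addrACA.
Qed.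

Lemma htp_bdry X Y (f g : cmap X Y) n A x : htp f g ->
  cd X (n - 1) A x = 0 -> bdry Y n A (f _ A x - g _ A x).
Proof.
by case=> h hP dx; rewrite hP dx linear0 addr0 addrKl; exact: bdry_d.
Qed.

Lemma htp_qi X Y (f : cmap X Y) (g : cmap Y X) :
  htp (cmap_comp g f) (cmap_id _) -> htp (cmap_comp f g) (cmap_id _) ->
  quasi_iso f.
Proof.
move=> gf fg; apply: quasi_isoP => n A x dx.
  move=> /(bdry_map g) b; have /bdryN := htp_bdry gf dx.
  by move=> /(bdryD b); rewrite opprB /= subrKC.
exists (g _ A x); first by rewrite -cmap_d dx linear0.
exact/bdry_sym/(htp_bdry fg).
Qed.

Section Map.
Context X X' Y Y' (f : cmap X X') (g : cmap Y Y').

Definition tens_fun n A : {linear ctens X Y n A -> ctens X' Y' n A} :=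
  dsum_rec (fun t : bideg n => lcomp
    (dsum_in (fun t => @tens_at k U X' Y' n t A) t)
    (tens_map (f (sval t).1 A) (g (sval t).2 A))).

Lemma tens_funE n A (t : bideg n) x y :
  tens_fun n A (tgen (t := t) x y) = tgen (t := t) (f _ A x) (g _ A y).
Proof. by rewrite /tens_fun /tgen dsum_recE lcompE tens_mapE. Qed.

Program Definition ctens_map : cmap (ctens X Y) (ctens X' Y') :=
  @CMap k U (ctens X Y) (ctens X' Y') (fun n => @RHom k U (ctens X Y n) (ctens X' Y' n) (tens_fun n) _) _.
Next Obligation.
move=> n A B e.
apply: (@tens_d_ext k U X Y n B _ (lcomp (tens_fun n A) (res (ctens X Y n) e))
  (lcomp (res (ctens X' Y' n) e) (tens_fun n B))) => t x y.
by rewrite !lcompE res_tgen !tens_funE res_tgen !rhom_nat.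
Qed.
Next Obligation.
move=> n A.
apply: (@tens_d_ext k U X Y n A _ (lcomp (tens_fun (n - 1) A) (cd (ctens X Y) n A))
  (lcomp (cd (ctens X' Y') n A) (tens_fun n A))) => t x y.
rewrite !lcompE tens_funE -[cd (ctens X Y) n A _]/(tens_d X Y n A _).
rewrite -[cd (ctens X' Y') n A _]/(tens_d X' Y' n A _) !tens_dE.
by rewrite linearD linearZ_LR !tens_funE !cmap_d.
Qed.
End Map.

Lemma tens_dE' X Y n A i j (e : i + j == n) (el : i - 1 + j == n - 1)
    (er : i + (j - 1) == n - 1) x y :
  cd (ctens X Y) n A (tgen (t := exist _ (i, j) e : bideg n) x y) =
  tgen (t := exist _ (i - 1, j) el : bideg (n - 1)) (cd X i A x) y +
  (-1) ^ i *: tgen (t := exist _ (i, j - 1) er : bideg (n - 1)) x (cd Y j A y).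
Proof.
rewrite [LHS]tens_dE; congr (_ + _ *: _); exact: (@tgen_irr k U X Y _ A (_, _)).
Qed.

Lemma tgenDl X Y n A (t : bideg n) (x x' : X (sval t).1 A) (y : Y (sval t).2 A) :
  tgen (t := t) (x + x') y = tgen (t := t) x y + tgen (t := t) x' y.
Proof. by rewrite /tgen tpureDl linearD. Qed.

Lemma tgenDr X Y n A (t : bideg n) (x : X (sval t).1 A) (y y' : Y (sval t).2 A) :
  tgen (t := t) x (y + y') = tgen (t := t) x y + tgen (t := t) x y'.
Proof. by rewrite /tgen tpureDr linearD. Qed.

(** The homotopy is h (x) g, without sign because h acts on the left factor. It is given on
    generators of first degree i - 1, hence the reindexing by [int_pred_ex]. *)
Lemma ctens_htpl X X' Y Y' (f f' : cmap X X') (g : cmap Y Y') :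
  htp f f' -> htp (ctens_map f g) (ctens_map f' g).
Proof.
case=> h hP.
pose T n i := forall j (e : i + j == n - 1) A,
  {linear tens (X i A) (Y j A) -> ctens X' Y' n A}.
have e1 n i j : i - 1 + j == n - 1 -> i + j == n.
  by move=> /eqP e; apply/eqP; apply: (addIr (-1)); rewrite -e addrAC.
pose H0 n i : T n (i - 1) := fun j e A =>
  lcomp (dsum_in (fun t => @tens_at k U X' Y' n t A) (exist _ (i, j) (e1 n i j e)))
    (tens_map (h i A) (g j A)).
have HE n : {H : forall i, T n i | forall i, H (i - 1) = H0 n i}.
  exact/cid/int_pred_ex.
pose H n A : {linear ctens X Y (n - 1) A -> ctens X' Y' n A} :=
  dsum_rec (fun t : bideg (n - 1) => sval (HE n) (sval t).1 (sval t).2 (svalP t) A).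
have HP n A i j (e : i - 1 + j == n - 1) x y :
    H n A (tgen (t := exist _ (i - 1, j) e : bideg (n - 1)) x y) =
    tgen (t := exist _ (i, j) (e1 n i j e) : bideg n) (h i A x) (g j A y).
  rewrite /H [LHS]dsum_recE /= (svalP (HE n)) /H0 lcompE tens_mapE.
  exact: (@tgen_irr k U X' Y' _ A (_, _)).
have ind n A (W : lmodType k) (a b : {linear ctens X Y (n - 1) A -> W}) :
    (forall i j (e : i - 1 + j == n - 1) x y,
      a (tgen (t := exist _ (i - 1, j) e : bideg (n - 1)) x y) =
      b (tgen (t := exist _ (i - 1, j) e : bideg (n - 1)) x y)) ->
    forall z, a z = b z.
  move=> ab; apply: tens_d_ext => -[[i j] /= e] x y.
  by move: i e x; apply: int_pred_ind => i e x; exact: ab.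
have nat n A B (e : epi A B) z :
    H n A (res (ctens X Y (n - 1)) e z) = res (ctens X' Y' n) e (H n B z).
  move: z; apply: (ind n B _ (lcomp (H n A) (res _ e)) (lcomp (res _ e) (H n B))).
  move=> i j eij x y; rewrite !lcompE HP.
  by rewrite !res_tgen /= HP !rhom_nat.
exists (fun n => RHom (nat n)) => n A.
apply: (ind n A _ (tens_fun f g (n - 1) A) (tens_fun f' g (n - 1) A \+
  (lcomp (cd (ctens X' Y') n A) (H n A) \+ lcomp (H (n - 1) A) (cd (ctens X Y) (n - 1) A)))).
move=> i j e x y.
have er : i - 1 + (j - 1) == n - 1 - 1 by rewrite addrA (eqP e).
have el : i - 1 - 1 + j == n - 1 - 1 by rewrite addrAC (eqP e).
rewrite -[RHS]/(tens_fun f' g _ A _ + (cd _ n A (H n A _) + H (n - 1) A (cd _ (n - 1) A _))).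
rewrite HP (tens_dE' el er) linearD linearZ_LR !HP !tens_funE /= hP.
have er' : i + (j - 1) == n - 1 by rewrite addrA (eqP (e1 n i j e)).
rewrite (tens_dE' e er') !cmap_d.
rewrite expfzDr ?oppr_eq0 ?oner_eq0 // -[(-1) ^ (-1)]/((-1)^-1) invrN1 mulrN1 scaleNr.
rewrite tgenDl; congr (_ + _); rewrite tgenDl.
rewrite (@tgen_irr k U X' Y' _ A (i - 1, j) e (e1 (n - 1) (i - 1) j el)).
rewrite (@tgen_irr k U X' Y' _ A (i, j - 1) er' (e1 (n - 1) i (j - 1) er)).
rewrite addrACA addrN addr0; congr (_ + _); exact: (@tgen_irr k U X' Y' _ A (_, _)).
Qed.

Lemma ctens_htpr X X' Y Y' (f : cmap X X') (g g' : cmap Y Y') :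
  htp g g' -> htp (ctens_map f g) (ctens_map f g').
Proof.
case=> h hP.
pose T n j := forall i (e : i + j == n - 1) A,
  {linear tens (X i A) (Y j A) -> ctens X' Y' n A}.
have e1 n i j : i + (j - 1) == n - 1 -> i + j == n.
  by move=> /eqP e; apply/eqP; apply: (addIr (-1)); rewrite -e addrA.
(* The Koszul sign for moving a homotopy of degree one past an element of degree i. *)
pose H0 n j : T n (j - 1) := fun i e A => (-1) ^ i \*:
  lcomp (dsum_in (fun t => @tens_at k U X' Y' n t A) (exist _ (i, j) (e1 n i j e)))
    (tens_map (f i A) (h j A)).
have HE n : {H : forall j, T n j | forall j, H (j - 1) = H0 n j}.
  exact/cid/int_pred_ex.
pose H n A : {linear ctens X Y (n - 1) A -> ctens X' Y' n A} :=
  dsum_rec (fun t : bideg (n - 1) => sval (HE n) (sval t).2 (sval t).1 (svalP t) A).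
have HP n A i j (e : i + (j - 1) == n - 1) x y :
    H n A (tgen (t := exist _ (i, j - 1) e : bideg (n - 1)) x y) = (-1) ^ i *:
    tgen (t := exist _ (i, j) (e1 n i j e) : bideg n) (f i A x) (h j A y).
  rewrite /H [LHS]dsum_recE /= (svalP (HE n)) /H0.
  rewrite -[LHS]/(_ *: lcomp _ _ _) lcompE tens_mapE; congr (_ *: _).
  exact: (@tgen_irr k U X' Y' _ A (_, _)).
have ind n A (W : lmodType k) (a b : {linear ctens X Y (n - 1) A -> W}) :
    (forall i j (e : i + (j - 1) == n - 1) x y,
      a (tgen (t := exist _ (i, j - 1) e : bideg (n - 1)) x y) =
      b (tgen (t := exist _ (i, j - 1) e : bideg (n - 1)) x y)) ->
    forall z, a z = b z.
  move=> ab; apply: tens_d_ext => -[[i j] /= e] x y.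
  by move: j e y; apply: int_pred_ind => j e y; exact: ab.
have nat n A B (e : epi A B) z :
    H n A (res (ctens X Y (n - 1)) e z) = res (ctens X' Y' n) e (H n B z).
  move: z; apply: (ind n B _ (lcomp (H n A) (res _ e)) (lcomp (res _ e) (H n B))).
  move=> i j eij x y; rewrite !lcompE HP.
  by rewrite linearZ_LR !res_tgen /= HP !rhom_nat.
exists (fun n => RHom (nat n)) => n A.
apply: (ind n A _ (tens_fun f g (n - 1) A) (tens_fun f g' (n - 1) A \+
  (lcomp (cd (ctens X' Y') n A) (H n A) \+ lcomp (H (n - 1) A) (cd (ctens X Y) (n - 1) A)))).
move=> i j e x y.
have er : i + (j - 1 - 1) == n - 1 - 1 by rewrite addrA (eqP e).
have el : i - 1 + (j - 1) == n - 1 - 1 by rewrite addrAC (eqP e).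
rewrite -[RHS]/(tens_fun f g' _ A _ + (cd _ n A (H n A _) + H (n - 1) A (cd _ (n - 1) A _))).
rewrite HP (tens_dE' el er) linearD 2!linearZ_LR !HP !tens_funE /= hP.
have el' : i - 1 + j == n - 1 by rewrite addrAC (eqP (e1 n i j e)).
rewrite (tens_dE' el' e) !cmap_d.
have s2 : (-1) ^ i * (-1) ^ i = 1 :> k.
  by rewrite -expfzMl mulrNN mul1r exp1rz.
rewrite tgenDr; congr (_ + _); rewrite tgenDr scalerDr !scalerA s2 !scale1r.
rewrite expfzDr ?oppr_eq0 ?oner_eq0 // -[(-1) ^ (-1)]/((-1)^-1) invrN1 mulrN1 scaleNr.
rewrite (@tgen_irr k U X' Y' _ A (i - 1, j) el' (e1 (n - 1) (i - 1) j el)).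
rewrite (@tgen_irr k U X' Y' _ A (i, j - 1) e (e1 (n - 1) i (j - 1) er)).
rewrite addrACA addrN add0r; congr (_ + _); exact: (@tgen_irr k U X' Y' _ A (_, _)).
Qed.

Lemma ctens_map_comp X X' X'' Y Y' Y'' (f : cmap X X') (f' : cmap X' X'')
    (g : cmap Y Y') (g' : cmap Y' Y'') :
  cmap_eq (ctens_map (cmap_comp f' f) (cmap_comp g' g))
    (cmap_comp (ctens_map f' g') (ctens_map f g)).
Proof.
move=> n A; apply: (@tens_d_ext k U X Y n A _ (tens_fun _ _ n A)
  (lcomp (tens_fun f' g' n A) (tens_fun f g n A))) => t x y.
by rewrite lcompE !tens_funE.
Qed.

Lemma ctens_map_id X Y :
  cmap_eq (ctens_map (cmap_id X) (cmap_id Y)) (cmap_id (ctens X Y)).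
Proof.
move=> n A; apply: (@tens_d_ext k U X Y n A _ (tens_fun _ _ n A) idfun) => t x y.
by rewrite !tens_funE.
Qed.

Lemma ctens_htp_equiv X X' Y Y' (f : cmap X X') (f' : cmap X' X)
    (g : cmap Y Y') (g' : cmap Y' Y) :
  htp (cmap_comp f' f) (cmap_id _) -> htp (cmap_comp g' g) (cmap_id _) ->
  htp (cmap_comp (ctens_map f' g') (ctens_map f g)) (cmap_id _).
Proof.
move=> hf hg; apply: htp_trans (htp_refl _) _.
  by move=> n A x; apply/esym; exact: ctens_map_comp.
apply: htp_trans (ctens_htpl _ hf) _; apply: htp_trans (ctens_htpr _ hg) _.
exact/htp_refl/ctens_map_id.
Qed.

End TensorHomotopy.
Section TensorForm.
Context (k : fieldType) (V W : lmodType k) (a : {linear V -> k^o}) (b : {linear W -> k^o}).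

Lemma tens_formP x y : tens_rel x y ->
  leval (fun s : V * W => a s.1 * b s.2 : k^o) x =
  leval (fun s : V * W => a s.1 * b s.2 : k^o) y.
Proof.
case=> [x0 x1 z|z y0 y1|c z z'|c z z'] /=.
- by rewrite (linearD a) mulrDl.
- by rewrite (linearD b) mulrDr.
- by rewrite (linearZ_LR a) -scalerAl.
- by rewrite (linearZ_LR b) -scalerAr.
Qed.

Definition tens_form : {linear tens V W -> k^o} := pres_rec tens_formP.

Lemma tens_formE x y : tens_form (tpure x y) = a x * b y.
Proof. exact: (pres_recE tens_formP). Qed.
End TensorForm.

Section Pointwise.
Context (k : fieldType) (U : finGroupType -> Prop).
Implicit Types (X Y Z W : cpx k U) (A B C : grp U) (n : int).

(** Isomorphism on homology between values at possibly different groups; it covers both restriction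
    maps and the components of chain maps. *)
Definition hiso A B X Y (f : forall n, {linear X n A -> Y n B}) : Prop :=
  (forall n x, cd X (n - 1) A x = 0 -> bdry Y n B (f _ x) -> bdry X n A x) /\
  (forall n y, cd Y (n - 1) B y = 0 ->
    exists2 x, cd X (n - 1) A x = 0 & bdry Y n B (y - f _ x)).

Lemma hiso_ext A B X Y (f g : forall n, {linear X n A -> Y n B}) :
  (forall n x, f n x = g n x) -> hiso f -> hiso g.
Proof.
move=> fg [i q]; split=> n x dx; first by rewrite -fg; exact: i.
by have [z dz b] := q n x dx; exists z; rewrite // -fg.
Qed.

Lemma qi_hiso X Y (f : cmap X Y) :
  quasi_iso f <-> forall A, hiso (fun n => f n A).
Proof.
split=> [qf A|h].
  by split=> n x dx; [exact: (qi_inj qf)|exact: (qi_surj qf)].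
by apply: quasi_isoP => n A; [exact: (h A).1|exact: (h A).2].
Qed.

Definition acyc A X : Prop := forall n x, cd X (n - 1) A x = 0 -> bdry X n A x.

Lemma hiso_acyc A B X Y (f : forall n, {linear X n A -> Y n B}) :
  (forall n x, f (n - 1) (cd X n A x) = cd Y n B (f n x)) -> hiso f ->
  (acyc A X <-> acyc B Y).
Proof.
move=> fP [i q]; split=> aX n x dx; last first.
  by apply: i => //; apply: aX; rewrite -fP dx linear0.
have [z dz [v vE]] := q n x dx; have [w wE] := aX n z dz.
exists (v + f n w); rewrite linearD -vE -fP -wE subrK; exact: erefl.
Qed.

Lemma res_cd X A B (e : epi A B) n x :
  res (X (n - 1)) e (cd X n B x) = cd X n A (res (X n) e x).
Proof. by rewrite rhom_nat. Qed.

Section TensHiso.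
Context A B X Y X' Y' (f : forall n, {linear X n A -> X' n B})
  (g : forall n, {linear Y n A -> Y' n B}).
Hypothesis fP : forall n x, f (n - 1) (cd X n A x) = cd X' n B (f n x).
Hypothesis gP : forall n x, g (n - 1) (cd Y n A x) = cd Y' n B (g n x).

Definition tens_fam n : {linear ctens X Y n A -> ctens X' Y' n B} :=
  tens_fun (at_map fP) (at_map gP) n A.

Lemma tens_famE n (t : bideg n) (x : X (sval t).1 A) (y : Y (sval t).2 A) :
  tens_fam n (tgen (t := t) x y) = tgen (t := t) (f _ x) (g _ y).
Proof. exact: (tens_funE (at_map fP) (at_map gP)). Qed.

(** Over a field both families are homotopy equivalences by [qi_inverse], and tensor products
    preserve homotopy equivalences. *)
Lemma tens_hiso : hiso f -> hiso g -> hiso tens_fam.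
Proof.
move=> [fi fs] [gi gs].
have [f1 [f2 [fE f12 f21]]] := qi_inverse fP fi fs.
have [g1 [g2 [gE g12 g21]]] := qi_inverse gP gi gs.
have q : quasi_iso (ctens_map f2 g2).
  exact: htp_qi (ctens_htp_equiv f12 g12) (ctens_htp_equiv f21 g21).
have [i s] := (qi_hiso _).1 q A.
have E n z : tens_fun f2 g2 n A z = tens_fam n z.
  move: z; apply: (@tens_d_ext k U X Y n A _ (tens_fun f2 g2 n A) (tens_fam n)) => t x y.
  by rewrite tens_famE -(fE _ A) -(gE _ A); exact: tens_funE.
(* The two formulations differ by unfolding [at_cpx]; the conversion is left to the kernel at
   [Qed]. *)
have i' n (z : ctens X Y (n - 1) A) : cd (ctens X Y) (n - 1) A z = 0 ->
    bdry (ctens X' Y') n B (tens_fun f2 g2 (n - 1) A z) -> bdry (ctens X Y) n A z.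
  exact_no_check (i n z).
have s' n (z : ctens X' Y' (n - 1) B) : cd (ctens X' Y') (n - 1) B z = 0 ->
    exists2 w : ctens X Y (n - 1) A, cd (ctens X Y) (n - 1) A w = 0 &
      bdry (ctens X' Y') n B (z - tens_fun f2 g2 (n - 1) A w).
  exact_no_check (s n z).
split=> n z dz; first by rewrite -E; exact: i'.
by have [w dw b] := s' n z dz; exists w; rewrite -?E.
Qed.
End TensHiso.

Lemma hiso_res_ctens X Y A B (e : epi A B) :
  hiso (fun n => res (X n) e) -> hiso (fun n => res (Y n) e) ->
  hiso (fun n => res (ctens X Y n) e).
Proof.
move=> hX hY; apply: hiso_ext (tens_hiso (@res_cd X A B e) (@res_cd Y A B e) hX hY).
move=> n z.
apply: (@tens_d_ext k U X Y n B _ (tens_fam _ _ n) (res (ctens X Y n) e)) => t x y.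
by rewrite tens_famE.
Qed.

Lemma ctens_map_qi X X' Y Y' (f : cmap X X') (g : cmap Y Y') :
  quasi_iso f -> quasi_iso g -> quasi_iso (ctens_map f g).
Proof.
move=> /qi_hiso qf /qi_hiso qg; apply/qi_hiso => A.
apply: hiso_ext (tens_hiso (fun n => @cmap_d k U X X' f n A)
  (fun n => @cmap_d k U Y Y' g n A) (qf A) (qg A)) => n z.
apply: (@tens_d_ext k U X Y n A _ (tens_fam _ _ n) (tens_fun f g n A)) => t x y.
by rewrite tens_famE.
Qed.

End Pointwise.
Lemma In_allpairs (S T R : Type) (f : S -> T -> R) s t x y :
  List.In x s -> List.In y t -> List.In (f x y) [seq f u v | u <- s, v <- t].
Proof.
move=> xs yt; elim: s xs => [//|a s IH] /= [->|xs].
  by apply/List.in_or_app; left; exact: List.in_map.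
by apply/List.in_or_app; right; exact: IH.
Qed.

Section Pointwise.
Context (k : fieldType) (U : finGroupType -> Prop).
Implicit Types (X Y Z W : cpx k U) (A B C : grp U) (n : int).

Lemma acyc_htp A X : acyc A X ->
  htp (cmap_id (at_cpx A X)) (cmap_zero (at_cpx A X) (at_cpx A X)).
Proof.
move=> aX; have [h hP] := @null_linear k U A A X X (fun _ => idfun) (fun _ _ => erefl) aX.
exists (fun n => const_map U (h n)) => n C x.
by rewrite /= add0r; exact: hP.
Qed.

Section TensEnd.
Context A X Y (f : cmap (at_cpx A X) (at_cpx A X)) (g : cmap (at_cpx A Y) (at_cpx A Y)).

Definition tens_end n : {linear ctens X Y n A -> ctens X Y n A} :=
  tens_fun f g n A.

Lemma tens_endE n (t : bideg n) (x : X (sval t).1 A) (y : Y (sval t).2 A) :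
  tens_end n (tgen (t := t) x y) = tgen (t := t) (f _ A x : X _ A) (g _ A y : Y _ A).
Proof. exact: (tens_funE f g). Qed.
End TensEnd.

Lemma tens_end_id A X Y n z :
  tens_end (cmap_id (at_cpx A X)) (cmap_id (at_cpx A Y)) n z = z.
Proof.
apply: (@tens_d_ext k U X Y n A _ (tens_end _ _ n) idfun) => t x y.
by rewrite tens_endE.
Qed.

Lemma tens_end_bdry A X Y (f f' : cmap (at_cpx A X) (at_cpx A X))
    (g g' : cmap (at_cpx A Y) (at_cpx A Y)) n z :
  htp (ctens_map f g) (ctens_map f' g') -> cd (ctens X Y) (n - 1) A z = 0 ->
  bdry (ctens X Y) n A (tens_end f g (n - 1) z - tens_end f' g' (n - 1) z).
Proof.
move=> h; move: n z.
have h' := fun n z => @htp_bdry k U _ _ _ _ n A z h.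
exact_no_check h'.
Qed.

Lemma acyc_ctensl A X Y : acyc A X -> acyc A (ctens X Y).
Proof.
move=> /acyc_htp /(ctens_htpl (cmap_id (at_cpx A Y))) h n z dz.
have := tens_end_bdry h dz; rewrite tens_end_id.
suff -> : tens_end (cmap_zero (at_cpx A X) (at_cpx A X)) (cmap_id (at_cpx A Y)) (n - 1) z = 0.
  by rewrite subr0.
apply: (@tens_d_ext k U X Y _ A _ (tens_end _ _ (n - 1)) \0) => t x y.
by rewrite tens_endE tgen0l.
Qed.

Lemma acyc_ctensr A X Y : acyc A Y -> acyc A (ctens X Y).
Proof.
move=> /acyc_htp /(ctens_htpr (cmap_id (at_cpx A X))) h n z dz.
have := tens_end_bdry h dz; rewrite tens_end_id.
suff -> : tens_end (cmap_id (at_cpx A X)) (cmap_zero (at_cpx A Y) (at_cpx A Y)) (n - 1) z = 0.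
  by rewrite subr0.
apply: (@tens_d_ext k U X Y _ A _ (tens_end _ _ (n - 1)) \0) => t x y.
by rewrite tens_endE tgen0r.
Qed.

Lemma functional_ex A X n x : cd X (n - 1) A x = 0 -> ~ bdry X n A x ->
  exists xi : forall i, {linear X i A -> k^o}, xi (n - 1) x = 1 /\
    forall i z, xi (i - 1) (cd X i A z) = 0.
Proof.
move=> dx /(funct_ex dx)[xi [x1 x0]].
exists (fun i => if pselect (n - 1 = i) is left e
  then eq_rect (n - 1) (fun i => {linear X i A -> k^o}) xi i e else \0); split.
  by case: pselect => // e; rewrite (Prop_irrelevance e erefl).
move=> i z; case: pselect => // e.
have ni : n = i by exact: (addIr (-1)) e.
case: i / ni e z => e z; by rewrite (Prop_irrelevance e erefl).
Qed.

(** Linear forms detecting two nonzero homology classes multiply to a form that vanishes on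
    boundaries and is 1 on the tensor product of the representatives. This is the source of
    primality. *)
Lemma acyc_ctens A X Y : acyc A (ctens X Y) -> acyc A X \/ acyc A Y.
Proof.
move=> aXY; apply: contrapT => /not_orP[/existsNP[n /existsNP[x /not_implyP[dx nx]]]].
move=> /existsNP[m /existsNP[y /not_implyP[dy ny]]].
have [xi [x1 x0]] := functional_ex dx nx.
have [eta [y1 y0]] := functional_ex dy ny.
pose Xi l : {linear ctens X Y l A -> k^o} :=
  dsum_rec (fun t : bideg l => tens_form (xi (sval t).1) (eta (sval t).2)).
have XiE l (t : bideg l) x' y' : Xi l (tgen (t := t) x' y') = xi _ x' * eta _ y'.
  by rewrite /Xi [LHS]dsum_recE tens_formE.
have Xi0 l z : Xi (l - 1) (cd (ctens X Y) l A z) = 0.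
  move: z; apply: (@tens_d_ext k U X Y l A _ (lcomp (Xi (l - 1)) (cd (ctens X Y) l A)) \0) => t x' y'.
  rewrite lcompE -[cd (ctens X Y) l A _]/(tens_d X Y l A _) tens_dE linearD linearZ_LR !XiE.
  by rewrite x0 y0 mul0r mulr0 scaler0 addr0.
have e : n - 1 + (m - 1) == (n - 1 + m) - 1 by rewrite addrA.
have [|z zE] := aXY _ (tgen (t := exist _ (n - 1, m - 1) e : bideg (n - 1 + m - 1)) x y).
  rewrite [LHS]tens_dE.
  by rewrite [cd _ _ _ x]dx [cd _ _ _ y]dy tgen0l tgen0r scaler0 addr0.
have := XiE _ (exist _ (n - 1, m - 1) e : bideg (n - 1 + m - 1)) x y.
by rewrite x1 y1 mulr1 zE Xi0 => /esym/eqP; rewrite oner_eq0.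
Qed.

Lemma acyc_ctensP A X Y : acyc A (ctens X Y) <-> acyc A X \/ acyc A Y.
Proof.
split; first exact: acyc_ctens.
by case; [exact: acyc_ctensl|exact: acyc_ctensr].
Qed.

Inductive lspan (V : lmodType k) (S : V -> Prop) : V -> Prop :=
| lspan0 : lspan S 0
| lspan_lin c x y : S x -> lspan S y -> lspan S (c *: x + y).

Lemma lspan_in (V : lmodType k) (S : V -> Prop) x : S x -> lspan S x.
Proof.
by move=> Sx; rewrite -[x]addr0 -[x]scale1r; apply: lspan_lin => //; exact: lspan0.
Qed.

Lemma lspan_closed (V : lmodType k) (S : V -> Prop) : lin_closed (lspan S).
Proof.
move=> c x y; elim=> [|d x' z Sx' _ IH] Sy; first by rewrite scaler0 add0r.
by rewrite scalerDr scalerA -addrA; apply: lspan_lin => //; exact: IH.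
Qed.

Lemma lspan_map (V W : lmodType k) (f : {linear V -> W}) (S : V -> Prop)
    (T : W -> Prop) x :
  (forall x, S x -> lspan T (f x)) -> lspan S x -> lspan T (f x).
Proof.
move=> ST; elim=> [|c y z Sy _ IH]; first by rewrite linear0; exact: lspan0.
by rewrite linearP; apply: lspan_closed => //; exact: ST.
Qed.

(* Total homology of finite dimension. *)
Definition fin A X : Prop :=
  exists s : seq {n : int & X (n - 1) A}, forall n x, cd X (n - 1) A x = 0 ->
    exists2 y, lspan (fun y => List.In (existT (fun n => X (n - 1) A : Type) n y) s) y &
      bdry X n A (x - y).

Lemma harm_ext A X : exists p : forall n, {linear X n A -> X n A},
  forall n, p (n - 1) = harm X A n.
Proof. exact: (@int_pred_ex (fun n => {linear X n A -> X n A})). Qed.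

(** [q] is the square of the operator [p] given by [harm]: the first [p] yields a cycle, which lies
    in the span of [s] up to a boundary, and the second kills that boundary. *)
Lemma fin_end A Z : fin A Z -> exists (q : cmap (at_cpx A Z) (at_cpx A Z))
    (s : seq {n : int & Z (n - 1) A}), htp q (cmap_id _) /\ forall n x,
      lspan (fun y => List.In (existT (fun n => Z (n - 1) A : Type) n y) s) (q (n - 1) A x).
Proof.
case=> s sP; have [p pE] := harm_ext A Z.
have pd n z : p (n - 1) (cd Z n A z) = 0 by rewrite pE harm_cd.
have dp n z : cd Z n A (p n z) = 0.
  by move: n z; apply: int_pred_ind => n z; rewrite pE cd_harm.
have pP n z : p (n - 1) (cd Z n A z) = cd Z n A (p n z) by rewrite pd dp.
have hp : htp (at_map pP) (cmap_id (at_cpx A Z)).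
  exists (fun n => const_map U (\- (mp Z A n))) => n C x.
  rewrite /= pE harmE linearN; congr (_ + _); exact: opprD.
exists (cmap_comp (at_map pP) (at_map pP)).
exists (map (fun u => existT (fun n => Z (n - 1) A : Type) (projT1 u) (p _ (projT2 u))) s).
split=> [|].
  case: hp => h hP.
  have nat n B C (e : epi B C) x :
      (lcomp (h n B) (at_map pP (n - 1) B) \+ h n B) (res (at_cpx A Z (n - 1)) e x) =
      res (at_cpx A Z n) e ((lcomp (h n C) (at_map pP (n - 1) C) \+ h n C) x).
    have hn y : h n B y = h n C y by exact: (rhom_nat (h n) e y).
    exact: congr2 (hn (p (n - 1) x)) (hn x).
  exists (fun n => RHom (nat n)) => n C x.
  rewrite -[LHS]/(p (n - 1) (p (n - 1) x)).
  have h1 y : p (n - 1) y = y + (cd Z n A (h n C y) + h (n - 1) C (cd Z (n - 1) A y)).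
    exact: hP.
  rewrite h1 dp linear0 addr0 {1}h1.
  rewrite -[RHS]/(x + (cd Z n A (h n C (p _ x) + h n C x) +
    (h (n - 1) C (p _ (cd Z (n - 1) A x)) + h (n - 1) C (cd Z (n - 1) A x)))).
  rewrite pd linear0 add0r linearD -addrA; congr (_ + _).
  exact: etrans (addrC _ _) (addrA _ _ _).
move=> n x; rewrite -[X in lspan _ X]/(p (n - 1) (p (n - 1) x)).
have [y ys [w wE]] := sP n (p _ x) (dp _ _).
have -> : p (n - 1) (p (n - 1) x) = p (n - 1) y.
  by rewrite -[p _ x](subrK y) wE linearD pd add0r.
apply: lspan_map ys => x' x's; apply: lspan_in.
exact: (List.in_map (fun u => existT (fun n => Z (n - 1) A : Type) (projT1 u) (p _ (projT2 u))) _ _ x's).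
Qed.

(** The tensor product of the two operators from [fin_end] is homotopic to the identity, and its
    values are combinations of tensors of listed elements. *)
Lemma fin_ctens A X Y : fin A X -> fin A Y -> fin A (ctens X Y).
Proof.
have main Z : fin A Z -> exists (q : cmap (at_cpx A Z) (at_cpx A Z))
    (s : seq {n : int & Z n A}), htp q (cmap_id _) /\ forall n x,
      lspan (fun y => List.In (existT (fun n => Z n A : Type) n y) s) (q n A x).
  case/fin_end=> q [s [hq qs]]; exists q.
  exists (map (fun u => existT (fun n => Z n A : Type) (projT1 u - 1) (projT2 u)) s).
  split=> //; apply: int_pred_ind => n x.
  apply: (lspan_map (f := idfun) _ (qs n x)) => y ys; apply: lspan_in.
  exact: (List.in_map (fun u => existT (fun n => Z n A : Type) (projT1 u - 1) (projT2 u)) _ _ ys).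
move=> /main[q [s [hq qs]]] /main[q' [s' [hq' qs']]].
(* A pair of degrees i and j contributes to one index only: the list holds elements of degree n - 1,
   whence n = i + j + 1. *)
pose el n (u : {n : int & X n A}) (v : {n : int & Y n A}) : seq {n : int & ctens X Y (n - 1) A} :=
  if pselect (projT1 u + projT1 v == n - 1) is left e then
   [:: existT (fun n => ctens X Y (n - 1) A : Type) n
     (tgen (t := exist _ (projT1 u, projT1 v) e : bideg (n - 1)) (projT2 u) (projT2 v))]
  else [::].
exists (flatten [seq el (projT1 u + projT1 v + 1) u v | u <- s, v <- s']).
move=> n z dz; exists (tens_end q q' (n - 1) z); last first.
  have b2 := tens_end_bdry (ctens_htpl q' hq) dz.
  have := tens_end_bdry (ctens_htpr (cmap_id _) hq') dz.
  rewrite tens_end_id => b1.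
  by apply: bdry_trans (bdry_sym b1) (bdry_sym b2).
set T := fun y => List.In _ _.
have TN v : lspan T v -> lspan T (- v).
  by move=> Tv; rewrite -[- v]addr0 -scaleN1r; apply: lspan_closed => //; exact: lspan0.
have TD v w : lspan T v -> lspan T w -> lspan T (v + w).
  by move=> Tv Tw; rewrite -[v]scale1r; exact: lspan_closed.
have TZ c v : lspan T v -> lspan T (c *: v).
  by move=> Tv; rewrite -[_ *: _]addr0; apply: lspan_closed => //; exact: lspan0.
have key (t : bideg (n - 1)) a b :
    lspan (fun y => List.In (existT (fun n => X n A : Type) _ y) s) a ->
    lspan (fun y => List.In (existT (fun n => Y n A : Type) _ y) s') b ->
    lspan T (tgen (t := t) a b).
  have Zl c u v : tgen (t := t) (c *: u : X _ A) (v : Y _ A) = c *: tgen (t := t) u v.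
    by rewrite /tgen tpureZl linearZ_LR.
  have Zr c u v : tgen (t := t) (u : X _ A) (c *: v : Y _ A) = c *: tgen (t := t) u v.
    by rewrite /tgen tpureZr linearZ_LR.
  move=> sa sb; elim: sa => [|c u v su _ IH]; first by rewrite tgen0l; exact: lspan0.
  rewrite tgenDl Zl; apply: lspan_closed IH.
  elim: sb => [|d u' v' su' _ IH]; first by rewrite tgen0r; exact: lspan0.
  rewrite tgenDr Zr; apply: lspan_closed IH; apply: lspan_in; rewrite /T.
  apply/List.in_concat.
  eexists; split; first exact: (In_allpairs (fun u v => el (projT1 u + projT1 v + 1) u v) su su').
  rewrite /el /=; have nE : (sval t).1 + (sval t).2 + 1 = n.
    by rewrite (eqP (svalP t)) subrK.
  case: pselect => [e|]; last by rewrite addrK eqxx.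
  left; clear -nE; move: u u' e; case: t nE => -[i j] /= e0 nE u u' e.
  case: n / nE e0 => e0; congr existT; exact: (@tgen_irr k U X Y _ A (_, _)).
move: {dz} z; apply: pres_ind => [[t w]||w Tw|v w Tv Tw|c v Tv].
- rewrite -[pgen _ _]/(dsum_in (fun t => @tens_at k U X Y _ t A) t w).
  move: w; apply: pres_ind => [[x y]||w Tw|v w Tv Tw|c v Tv].
  + rewrite -[dsum_in _ _ _]/(tgen (t := t) x y) tens_endE; apply: key; first exact: qs.
    exact: qs'.
  + by rewrite !linear0; exact: lspan0.
  + by rewrite !linearN; exact: TN.
  + by rewrite !linearD; exact: TD.
  + by rewrite !linearZ_LR; exact: TZ.
- by rewrite linear0; exact: lspan0.
- by rewrite linearN; exact: TN.
- by rewrite linearD; exact: TD.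
- by rewrite linearZ_LR; exact: TZ.
Qed.
End Pointwise.
(** * Induced complexes *)
Section Epi.
Implicit Types G H K : finGroupType.

Lemma epi_ext G H (e e' : epi G H) : e =1 e' -> e = e'.
Proof.
case: e e' => [[f [[fM]]] fs] [[f' [[fM']]] fs'] /= /funext ff.
by case: f' / ff fM' fs' => fM' fs'; rewrite (Prop_irrelevance fM fM') (Prop_irrelevance fs fs').
Qed.

Definition mkepi G H (f : G -> H) (fM : {morph f : x y / (x * y)%g >-> (x * y)%g})
    (fs : forall y, exists x, f x = y) : epi G H :=
  @Epi G H (Multiplicative.Pack (Multiplicative.Class (isMultiplicative.Axioms_ H f fM))) fs.

(** The encoding makes epimorphisms a finite type, over which averages can be taken. *)
Definition epi_code G H (e : epi G H) : {ffun G -> H} := [ffun x => e x].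

Definition epi_decode G H (f : {ffun G -> H}) : option (epi G H) :=
  if pselect (exists e, epi_code e = f) is left h then Some (sval (cid h)) else None.

Lemma epi_codeK G H : pcancel (@epi_code G H) (@epi_decode G H).
Proof.
move=> e; rewrite /epi_decode; case: pselect => [h|[]]; last by exists e.
congr Some; apply: epi_ext => x; have := svalP (cid h).
by move/ffunP/(_ x); rewrite !ffunE.
Qed.

HB.instance Definition _ G H := Finite.copy (epi G H) (pcan_type (@epi_codeK G H)).

Lemma epiM G H (e : epi G H) x y : e (x * y)%g = (e x * e y)%g.
Proof. exact: gmulfM. Qed.

Lemma epi1 G H (e : epi G H) : e 1%g = 1%g.
Proof. by apply: (mulgI (e 1%g)); rewrite -epiM !mulg1. Qed.

Lemma epi_inv_ex G H (e : epi G H) : injective e ->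
  exists e' : epi H G, cancel e e' /\ cancel e' e.
Proof.
move=> ei; have [f fP] := choice (epi_surj e).
have eK : cancel e f by move=> x; apply: ei; rewrite fP.
have fM : {morph f : x y / (x * y)%g >-> (x * y)%g}.
  by move=> x y; apply: ei; rewrite epiM !fP.
by exists (mkepi fM (fun x => ex_intro _ (e x) (eK x))).
Qed.

Lemma epi_card G H (e : epi G H) : (#|H| <= #|G|)%N.
Proof.
have [f fP] := choice (epi_surj e).
exact: (leq_card f (can_inj fP)).
Qed.

Lemma epi_card_inj G H (e : epi G H) : #|G| = #|H| -> injective e.
Proof.
move=> c; have [f fP] := choice (epi_surj e).
have [g fg gf] : bijective f by apply: inj_card_bij (can_inj fP) _; rewrite c.
by move=> x y; rewrite -{1}(gf x) -{1}(gf y) !fP => /(congr1 f); rewrite !gf.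
Qed.

Definition conj_epi G (g : G) : epi G G.
Proof.
refine (@mkepi G G (fun x => x ^ g)%g _ _); first by move=> x y; exact: conjMg.
by move=> y; exists (y ^ g^-1)%g; exact: conjgKV.
Defined.

End Epi.

Section Induced.
Context (k : fieldType) (U : finGroupType -> Prop) (G : grp U).
Implicit Types (X Y Z W : cpx k U) (A B C : grp U) (n : int).

Lemma res_ext (F : rep k U) A B (e e' : epi A B) x : e =1 e' -> res F e x = res F e' x.
Proof. by move=> /epi_ext ->. Qed.

Section Ob.
Context (F : rep k U).

(** A presentation of k[Epi(A, G)] tensored with F(G) over the group algebra of Aut(G), every
    epimorphism from G to itself being an automorphism: the left Kan extension of F(G), evaluated at
    A. *)
Inductive ind_rel A : lterm k (epi A G * F G) -> lterm k (epi A G * F G) -> Prop :=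
| ind_relD f x y : ind_rel (LGen (f, x + y)) (LAdd (LGen (f, x)) (LGen (f, y)))
| ind_relZ f c x : ind_rel (LGen (f, c *: x)) (LScale c (LGen (f, x)))
| ind_relS f (s : epi G G) x :
    ind_rel (LGen (epi_comp s f, x)) (LGen (f, res F s x)).

Definition ind_ob A : lmodType k := pres (@ind_rel A).

Definition ind_gen_fun A (f : epi A G) (x : F G) : ind_ob A := pgen (@ind_rel A) (f, x).

Lemma ind_gen_linear A (f : epi A G) : linear (@ind_gen_fun A f).
Proof.
move=> c x y; rewrite /ind_gen_fun.
transitivity (ppi (@ind_rel A) (LAdd (LScale c (LGen (f, x))) (LGen (f, y)))).
  apply/ppiP; apply: lcong_trans (lcong_rel (ind_relD _ _ _)) _.
  by apply: lcong_add; [exact/lcong_rel/ind_relZ | exact: lcong_refl].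
by rewrite -ppiD -ppiZ.
Qed.

Definition ind_gen A (f : epi A G) : {linear F G -> ind_ob A} := mklin (ind_gen_linear f).

Lemma ind_genS A (f : epi A G) (s : epi G G) x :
  ind_gen (epi_comp s f) x = ind_gen f (res F s x).
Proof. by apply/ppiP/lcong_rel/ind_relS. Qed.

Lemma ind_ext A (W : lmodType k) (a b : {linear ind_ob A -> W}) :
  (forall f x, a (ind_gen f x) = b (ind_gen f x)) -> forall z, a z = b z.
Proof. by move=> ab; apply: pres_ext => -[f x]; exact: ab. Qed.

Section Rec.
Context A (W : lmodType k) (phi : epi A G -> {linear F G -> W}).
Hypothesis phiS : forall f (s : epi G G) x, phi (epi_comp s f) x = phi f (res F s x).

Lemma ind_recP a b : ind_rel a b ->
  leval (fun s : epi A G * F G => phi s.1 s.2) a =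
  leval (fun s : epi A G * F G => phi s.1 s.2) b.
Proof. by case=> [f x y|f c x|f s x] /=; rewrite ?linearD ?linearZ_LR ?phiS. Qed.

Definition ind_rec : {linear ind_ob A -> W} := pres_rec ind_recP.

Lemma ind_recE f x : ind_rec (ind_gen f x) = phi f x.
Proof. exact: (pres_recE ind_recP). Qed.
End Rec.

Lemma ind_res_subproof A B (e : epi A B) (f : epi B G) (s : epi G G) x :
  ind_gen (epi_comp (epi_comp s f) e) x = ind_gen (epi_comp f e) (res F s x).
Proof.
by rewrite -ind_genS (_ : epi_comp (epi_comp s f) e = epi_comp s (epi_comp f e)) //; exact: epi_ext.
Qed.

Definition ind_res A B (e : epi A B) : {linear ind_ob B -> ind_ob A} :=
  ind_rec (ind_res_subproof e).

Lemma ind_resE A B (e : epi A B) f x : ind_res e (ind_gen f x) = ind_gen (epi_comp f e) x.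
Proof. exact: (ind_recE (ind_res_subproof e)). Qed.

Program Definition ind_rep : rep k U := @Rep k U ind_ob ind_res _ _ _.
Next Obligation.
move=> A; apply: (@ind_ext A _ _ idfun) => f x.
by rewrite ind_resE (_ : epi_comp f (epi_id A) = f) //; exact: epi_ext.
Qed.
Next Obligation.
move=> A B C g f; apply: (@ind_ext C _ _ (lcomp (ind_res f) (ind_res g))) => h x.
rewrite lcompE !ind_resE.
by rewrite (_ : epi_comp h (epi_comp g f) = epi_comp (epi_comp h g) f) //; exact: epi_ext.
Qed.
Next Obligation.
move=> A B f g + [h hP]; apply: ind_ext => a x; rewrite !ind_resE.
(* Conjugate maps differ by an inner automorphism of G, which acts trivially on [F G]. *)
have -> : epi_comp a g = epi_comp (conj_epi (a h)) (epi_comp a f).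
  apply: epi_ext => y /=; rewrite hP /conjg !epiM.
  by congr (_ * _)%g; apply: (mulIg (a h)); rewrite -epiM mulVg mulVg epi1.
rewrite ind_genS; congr (ind_gen _ _); apply/esym.
rewrite -[RHS](res_id (A := G)); apply/esym/res_conj.
by exists (a h) => y.
Qed.
End Ob.

Definition ind_hom_at (F H : rep k U) (f : rhom F H) A : {linear ind_ob F A -> ind_ob H A}.
Proof.
refine (@ind_rec F A _ (fun e => lcomp (ind_gen H e) (f G)) _).
by move=> e s x; rewrite !lcompE ind_genS rhom_nat.
Defined.

Lemma ind_hom_atE (F H : rep k U) (f : rhom F H) A e x :
  ind_hom_at f A (ind_gen F e x) = ind_gen H e (f G x).
Proof. by rewrite /ind_hom_at ind_recE lcompE. Qed.

Program Definition ind_hom (F H : rep k U) (f : rhom F H) : rhom (ind_rep F) (ind_rep H) :=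
  @RHom k U (ind_rep F) (ind_rep H) (ind_hom_at f) _.
Next Obligation.
move=> F H f A B e; apply: (@ind_ext F B _ (lcomp (ind_hom_at f A) (ind_res F e)) (lcomp (ind_res H e) (ind_hom_at f B))) => a x.
by rewrite !lcompE ind_resE !ind_hom_atE ind_resE.
Qed.

Program Definition ind_cpx X : cpx k U :=
  @Cpx k U (fun n => ind_rep (X n)) (fun n => ind_hom (cd X n)) _.
Next Obligation.
move=> X n A; apply: (@ind_ext (X n) A _ (lcomp (ind_hom_at (cd X (n - 1)) A) (ind_hom_at (cd X n) A)) \0) => a x.
by rewrite lcompE !ind_hom_atE cdd linear0.
Qed.

Definition igen X n A (e : epi A G) : {linear X n G -> ind_cpx X n A} := ind_gen (X n) e.
Arguments igen : clear implicits.

Lemma igen_d X n A (e : epi A G) x :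
  cd (ind_cpx X) n A (igen X n A e x) = igen X (n - 1) A e (cd X n G x).
Proof. exact: ind_hom_atE. Qed.

Lemma igen_res X n A B (a : epi A B) e x :
  res (ind_cpx X n) a (igen X n B e x) = igen X n A (epi_comp e a) x.
Proof. exact: ind_resE. Qed.

Lemma igenS X n A (e : epi A G) (s : epi G G) x :
  igen X n A (epi_comp s e) x = igen X n A e (res (X n) s x).
Proof. exact: ind_genS. Qed.

Lemma igen_id X n A (e : epi A G) x : igen X n A e x = res (ind_cpx X n) e (igen X n G (epi_id G) x).
Proof.
by rewrite igen_res (_ : epi_comp (epi_id G) e = e) //; exact: epi_ext.
Qed.

Lemma igen_ext X n A (W : lmodType k) (a b : {linear ind_cpx X n A -> W}) :
  (forall e x, a (igen X n A e x) = b (igen X n A e x)) -> forall z, a z = b z.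
Proof. exact: ind_ext. Qed.

Lemma ind_cpx_empty X n A (z : ind_cpx X n A) : (epi A G -> False) -> z = 0.
Proof. by move=> ne; move: z; apply: (@igen_ext X n A _ idfun \0) => e; case: (ne e). Qed.

Definition counit_at X n A : {linear ind_cpx X n A -> X n A}.
Proof.
refine (@ind_rec (X n) A _ (fun e => res (X n) e) _).
by move=> e s x; rewrite res_comp.
Defined.

Lemma counit_atE X n A e x : counit_at X n A (igen X n A e x) = res (X n) e x.
Proof. exact: ind_recE. Qed.

Program Definition counit X : cmap (ind_cpx X) X :=
  @CMap k U (ind_cpx X) X (fun n => @RHom k U (ind_cpx X n) (X n) (counit_at X n) _) _.
Next Obligation.
move=> X n A B e; apply: (@igen_ext X n B _ (lcomp (counit_at X n A) (res _ e)) (lcomp (res _ e) (counit_at X n B))) => a x.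
by rewrite !lcompE igen_res !counit_atE res_comp.
Qed.
Next Obligation.
move=> X n A; apply: (@igen_ext X n A _ (lcomp (counit_at X (n - 1) A) (cd (ind_cpx X) n A)) (lcomp (cd X n A) (counit_at X n A))) => a x.
by rewrite !lcompE igen_d !counit_atE rhom_nat.
Qed.

Lemma counit_bij X n A (e : epi A G) : injective e -> exists f : {linear X n A -> ind_cpx X n A},
  cancel (counit X n A) f /\ cancel f (counit X n A).
Proof.
move=> /epi_inv_ex [e' [ee' e'e]].
exists (lcomp (igen X n A e) (res (X n) e')); split=> x; last first.
  rewrite lcompE [LHS]counit_atE -res_comp (res_ext (e' := epi_id A)) ?res_id //.
move: x; apply: (@igen_ext X n A _ (lcomp (lcomp (igen X n A e) (res (X n) e')) (counit_at X n A)) idfun) => a x.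
rewrite !lcompE counit_atE -res_comp -igenS; congr (igen _ _ _ _ _).
by apply: epi_ext => y /=; rewrite ee'.
Qed.

Hypothesis (k0 : [pchar k]%R =i pred0).

Lemma epi_end_inj (s : epi G G) : injective s.
Proof. exact: epi_card_inj. Qed.

Definition epiV (s : epi G G) : epi G G := sval (cid (epi_inv_ex (@epi_end_inj s))).

Lemma epiVK (s : epi G G) : cancel (epiV s) s.
Proof. exact: (svalP (cid (epi_inv_ex (@epi_end_inj s)))).2. Qed.

(** Averaging over the automorphisms of G makes a linear map compatible with [ind_relS], the
    condition for extending it to the induced complex. *)
Lemma average_ex X Z n m (h : {linear X n G -> Z m G}) :
  exists h' : {linear X n G -> Z m G},
    (forall (s : epi G G) x, h' (res _ s x) = res _ s (h' x)) /\
    forall x, h' x = #|{: epi G G}|%:R^-1 *: \sum_(s : epi G G) res _ (epiV s) (h (res _ s x)).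
Proof.
have l : linear (fun x => #|{: epi G G}|%:R^-1 *: \sum_(s : epi G G) res (Z m) (epiV s) (h (res (X n) s x))).
  move=> c x y; rewrite scalerA mulrC -scalerA -scalerDr; congr (_ *: _).
  rewrite scaler_sumr -big_split /=.
  by apply: eq_bigr => s _; rewrite !linearP.
exists (mklin l); split=> // t x; rewrite /= linearZ_LR; congr (_ *: _).
rewrite linear_sum [RHS](reindex_inj (h := epi_comp t)) /=; last first.
  by move=> a b ab; apply: epi_ext => y; have := congr1 (fun e : epi G G => e y) ab => /= /epi_end_inj.
apply: eq_bigr => s _; rewrite -!res_comp.
congr (res _ _ (h (res _ _ x))).
apply: epi_ext => y; apply: (@epi_end_inj (epi_comp t s)).
by rewrite epiVK /= epiVK.
Qed.

(** [null_linear] gives a linear homotopy at G. Its average is equivariant and still a homotopy,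
    because [g] and the differentials commute with automorphisms and the order of Aut(G) is
    invertible in k; [ind_rec] spreads it to all groups. *)
Lemma ind_null X Z (g : cmap (ind_cpx X) Z) :
  (forall n x, cd X (n - 1) G x = 0 -> bdry Z n G (g _ G (igen X _ G (epi_id G) x))) ->
  htp g (cmap_zero _ _).
Proof.
move=> g0; pose phi n : {linear X n G -> Z n G} := lcomp (g n G) (igen X n G (epi_id G)).
have phiP n x : phi (n - 1) (cd X n G x) = cd Z n G (phi n x).
  by rewrite /phi !lcompE -cmap_d igen_d.
have [h hP] := null_linear phiP g0.
have phiS n (s : epi G G) x : phi n (res _ s x) = res _ s (phi n x).
  rewrite /phi !lcompE -rhom_nat igen_res -igenS; congr (g n G (igen _ _ _ _ x)).
  exact: epi_ext.
have hE n := cid (average_ex (h n)).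
pose h' n := sval (hE n).
have h'S n : forall (s : epi G G) x, h' n (res _ s x) = res _ s (h' n x) := (svalP (hE n)).1.
have h'E n x : h' n x = #|{: epi G G}|%:R^-1 *: \sum_(s : epi G G) res _ (epiV s) (h n (res _ s x)) := (svalP (hE n)).2 x.
have N0 : (#|{: epi G G}|%:R : k) != 0.
  have /charf0P -> := k0; rewrite -lt0n; apply/card_gt0P; by exists (epi_id G).
have h'P n x : phi (n - 1) x = cd Z n G (h' n x) + h' (n - 1) (cd X (n - 1) G x).
  rewrite !h'E linearZ_LR -scalerDr linear_sum -big_split /=.
  rewrite (eq_bigr (fun _ => phi (n - 1) x)) ?sumr_const; last first.
    move=> s _; rewrite (rhom_nat (cd Z n)) -(rhom_nat (cd X (n - 1))) -linearD -hP phiS -res_comp.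
    rewrite (res_ext (e' := epi_id G)) ?res_id // => y; exact: epiVK.
  by rewrite -scaler_nat scalerA mulVf // scale1r.
have HS n A (f : epi A G) (s : epi G G) x :
    lcomp (res (Z n) (epi_comp s f)) (h' n) x = lcomp (res (Z n) f) (h' n) (res _ s x).
  by rewrite !lcompE h'S res_comp.
pose H n A : {linear ind_cpx X (n - 1) A -> Z n A} := ind_rec (HS n A).
have HE n A e x : H n A (igen X _ A e x) = res _ e (h' n x) by exact: ind_recE.
have nat n A B (e : epi A B) x : H n A (res _ e x) = res _ e (H n B x).
  move: x; apply: (@igen_ext X (n - 1) B _ (lcomp (H n A) (res _ e)) (lcomp (res _ e) (H n B))) => a x.
  by rewrite !lcompE igen_res !HE res_comp.
exists (fun n => RHom (nat n)) => n A; rewrite /=.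
apply: (@igen_ext X (n - 1) A _ (g (n - 1) A) (\0 \+ (lcomp (cd Z n A) (H n A) \+ lcomp (H (n - 1) A) (cd (ind_cpx X) (n - 1) A)))) => e x.
rewrite -[RHS]/(0 + (cd Z n A (H n A _) + H (n - 1) A (cd _ (n - 1) A _))) add0r.
rewrite igen_d !HE igen_id rhom_nat -[g _ _ _]/(phi _ x) h'P linearD; congr (_ + _).
by rewrite rhom_nat.
Qed.

(** The composite of [g] with the inclusion into the cone of [s] vanishes on homology, so [ind_null]
    applies. In the null-homotopy obtained, the component in Y is the lift and the component in Y'
    the homotopy. *)
Lemma ind_lift X Y Y' (g : cmap (ind_cpx X) Y') (s : cmap Y Y') : quasi_iso s ->
  exists g' : cmap (ind_cpx X) Y, htp g (cmap_comp s g').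
Proof.
move=> qs; have [|h hP] := @ind_null X (cone s) (cmap_comp (cone_in s) g).
  move=> n x dx; set w := cmap_comp _ _ _ _ _.
  have : cd Y' (n - 1) G (g _ G (igen X _ G (epi_id G) x)) = 0.
    by rewrite -cmap_d igen_d dx !linear0.
  move=> /(qi_surj qs)[z dz [v vE]]; exists (z, v); congr pair; rewrite /= ?dz ?oppr0 //.
  by rewrite -vE; exact/esym/subrKC.
pose h1 n A : {linear ind_cpx X (n - 1) A -> Y (n - 1) A} := lcomp (pair_fst _ _) (h n A).
pose h2 n A : {linear ind_cpx X (n - 1) A -> Y' n A} :=
  lcomp (pair_fst _ _) (lcomp (pair_swap _ _) (h n A)).
have h1n n A B (e : epi A B) x : h1 n A (res _ e x) = res _ e (h1 n B x).
  by rewrite /h1 !lcompE rhom_nat.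
have h2n n A B (e : epi A B) x : h2 n A (res _ e x) = res _ e (h2 n B x).
  by rewrite /h2 !lcompE rhom_nat.
have eq n A x : (0, g (n - 1) A x) = (0 + (- cd Y (n - 1) A (h1 n A x) + h1 (n - 1) A (cd _ (n - 1) A x)),
   0 + (s (n - 1) A (h1 n A x) + cd Y' n A (h2 n A x) + h2 (n - 1) A (cd _ (n - 1) A x))) by exact: hP.
have [g' gE] := @int_pred_ex (fun n => rhom (ind_cpx X n) (Y n)) (fun n => RHom (h1n n)).
have gP n A x : g' (n - 1) A (cd _ n A x) = cd Y n A (g' n A x).
  move: n x; apply: int_pred_ind => n x; rewrite !gE /=.
  have [e _] := eq n A x; apply: addNr_eq0; rewrite -[LHS]add0r; exact: esym e.
exists (CMap gP), (fun n => RHom (h2n n)) => n A x.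
have [_ e] := eq n A x; rewrite e add0r -addrA /= gE //.
Qed.

(** The formal inverses in a word are removed one by one, lifting the chain map through each. *)
Lemma ind_dhom X W (f : dhom (ind_cpx X) W) : exists g, deq f (DMap g).
Proof.
have H Y (a : dhom Y W) : forall g : cmap (ind_cpx X) Y, exists g', deq (DComp a (DMap g)) (DMap g').
  elim: a => {Y W f} [Y W f|Y W s q|Y Z W a IHa b IHb] g.
  - by exists (cmap_comp f g); rewrite deq_mapM.
  - have [g' /htp_deq e] := ind_lift g q; exists g'.
    by rewrite e deq_mapM deq_invl'.
  - have [g1 e1] := IHb g; have [g2 e2] := IHa g1; exists g2.
    by rewrite -deq_compA e1.
by have [g e] := H _ f (cmap_id _); exists g; rewrite -e deq_idr.
Qed.

(** By [ind_null] only the images of finitely many classes at G matter, and each image lies in a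
    finite subsum. *)
Lemma ind_small X : fin G X -> small (ind_cpx X).
Proof.
case=> s sP I Y f; have [g gE] := ind_dhom f.
have [t tP] : exists t, forall n y, List.In (existT (fun n => X (n - 1) G : Type) n y) s ->
    csum_cut Y t _ G (g _ G (igen X _ G (epi_id G) y)) = 0.
  elim: s {sP} => [|[n y] s [t tP]]; first by exists [::].
  have [t' t'P] := csum_support (g _ G (igen X _ G (epi_id G) y)).
  exists (t' ++ t) => m z [e|zs].
    have tq u : u = existT (fun n => X (n - 1) G : Type) n y ->
        csum_cut Y t' _ G (g _ G (igen X _ G (epi_id G) (projT2 u))) = 0 by move=> ->.
    have {}tq : csum_cut Y t' _ G (g _ G (igen X _ G (epi_id G) z)) = 0 := tq _ (esym e).
    rewrite -(csum_cut_sub (s := t')) ?tq ?linear0 // => i it; apply/List.in_or_app; by left.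
  rewrite -(csum_cut_sub (s := t)) ?tP ?linear0 // => i it; apply/List.in_or_app; by right.
exists t; rewrite gE -deq_mapM; apply: htp_deq; apply: ind_null => n x dx.
have [y ys [w wE]] := sP n x dx.
have -> : x = y + cd X n G w by rewrite -wE subrKC.
rewrite !linearD; apply: bdryD.
  have -> : cmap_comp (csum_cut Y t) g (n - 1) G (igen X (n - 1) G (epi_id G) y) = 0.
    elim: ys => [|c u v us _ IH]; first by rewrite !linear0.
    by rewrite !linearP IH /= tP // scaler0 addr0.
  exact: bdry0.
by rewrite -igen_d cmap_d; exact: bdry_d.
Qed.

Lemma ind_deq0 X Z (a : cmap (ind_cpx X) Z) :
  deq (DMap a) (dzero _ Z) -> htp a (cmap_zero _ Z).
Proof.
move=> e; apply: ind_null => n x dx.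
have := deq_bdry (n := n) (A := G) (x := igen X (n - 1) G (epi_id G) x) e.
by rewrite igen_d dx linear0 subr0; exact.
Qed.

End Induced.
#[global] Arguments igen {k U G} X n A e.

(** * Cones: five lemma, acyclicity, finite-dimensional homology *)

Section Cones.
Context (k : fieldType) (U : finGroupType -> Prop).
Implicit Types (X Y Z W : cpx k U) (A B C : grp U) (n : int).

Section Five.
Context A B X Y X' Y' (f : cmap X Y) (f' : cmap X' Y')
  (a : forall n, {linear X n A -> X' n B}) (b : forall n, {linear Y n A -> Y' n B}).
Hypothesis aP : forall n x, a (n - 1) (cd X n A x) = cd X' n B (a n x).
Hypothesis bP : forall n x, b (n - 1) (cd Y n A x) = cd Y' n B (b n x).
Hypothesis fab : forall n x, f' n B (a n x) = b n (f n A x).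

Definition cone_fam n : {linear cone f n A -> cone f' n B} := pair_map (a (n - 1)) (b n).

(** The five lemma, chased on representatives. The square commutes strictly, so [cone_fam] needs no
    correction term. *)
Lemma hiso_cone : hiso a -> hiso b -> hiso cone_fam.
Proof.
move=> [ai aq] [bi bq]; split=> n [x y] [/= dx fxdy].
  move=> [[u v]] [/= auv buv].
  have {}dx : cd X (n - 1 - 1) A x = 0 by rewrite -[LHS]opprK dx oppr0.
  have [|x1 x1E] := ai _ _ dx; first by exists (- u); rewrite auv linearN.
  have [|w dw [t tE]] := aq n (u + a _ x1).
    by rewrite linearD -aP -x1E auv subrr.
  have d1 : cd Y (n - 1) A (f _ A x1) = f _ A x by rewrite -cmap_d -x1E.
  have d2 : cd Y (n - 1) A (f _ A w) = 0 by rewrite -cmap_d dw linear0.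
  have d3 : cd Y' n B (f' _ B t) = f' _ B u + b _ (f _ A x1) - b _ (f _ A w).
    by rewrite -cmap_d -tE linearB linearD !fab.
  have [||s sE] := bi n (y + f _ A x1 - f _ A w).
  - rewrite (linearB (cd Y (n - 1) A)) (linearD (cd Y (n - 1) A)) d1 d2 subr0 -fxdy.
    exact: addrC.
  - exists (f' n B t + v); rewrite (linearD (cd Y' n B)) d3 linearB linearD buv.
    move: (f' _ B u) (b _ (f _ A x1)) (b _ (f _ A w)) (cd Y' n B v) => p q r z.
    rewrite -!addrA; congr (_ + _); exact: etrans (addrC _ _) (esym (addrA _ _ _)).
  have e1 : x = - cd X (n - 1) A (w - x1) by rewrite linearB dw sub0r opprK.
  have e2 : y = f (n - 1) A (w - x1) + cd Y n A s.
    by rewrite -sE linearB; exact: addrBB'.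
  by exists (w - x1, s); rewrite {1}e1 {1}e2.
have {}dx : cd X' (n - 1 - 1) B x = 0 by rewrite -[LHS]opprK dx oppr0.
have [x0 dx0 [t tE]] := aq _ _ dx.
have d1 : f' (n - 1 - 1) B x = - cd Y' (n - 1) B y.
  by apply/eqP; rewrite -addr_eq0 fxdy.
have d2 : cd Y' (n - 1) B (f' _ B t) = f' _ B x - b _ (f _ A x0).
  by rewrite -cmap_d -tE linearB fab.
have [||y0 y0E] := bi _ (f _ A x0).
- by rewrite -cmap_d dx0 linear0.
- exists (- y - f' _ B t); rewrite (linearB (cd Y' (n - 1) B)) linearN d2 d1.
  rewrite opprB; exact/esym/subrKC.
have [|w dw [s sE]] := bq n (y + f' _ B t + b _ y0).
  rewrite 2!(linearD (cd Y' (n - 1) B)) d2 -bP -y0E d1.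
  by move: (cd Y' _ B y) (b _ (f _ A x0)) => p q; rewrite -(addrA p) subrK addrN.
exists (x0, w - y0); first by congr pair; rewrite /= ?dx0 ?oppr0 // linearB dw sub0r -y0E addrN.
exists (- t, s); congr pair; rewrite /= ?linearN ?opprK // -sE linearB.
move: (f' _ B t) (b _ y0) (b _ w) => p q r; rewrite opprB.
by rewrite -!addrA [RHS]addrCA addKr.
Qed.
End Five.

Lemma acyc_cone A X Y (f : cmap X Y) : acyc A X -> acyc A Y -> acyc A (cone f).
Proof.
move=> aX aY n [x y] [/= dx e].
have {}dx : cd X (n - 1 - 1) A x = 0 by rewrite -[LHS]opprK dx oppr0.
have [u uE] := aX _ _ dx.
have [|v vE] := aY n (y + f _ A u).
  by rewrite (linearD (cd Y (n - 1) A)) -cmap_d -uE -e; exact: addrC.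
have e1 : x = - cd X (n - 1) A (- u) by rewrite linearN opprK.
have e2 : y = f (n - 1) A (- u) + cd Y n A v.
  by rewrite -vE linearN (addrC y) addKr.
by exists (- u, v); rewrite {1}e1 {1}e2.
Qed.

(** Gaussian elimination along the list: a vector of [S] outside the span of the tail serves as
    pivot, and the others are reduced to the tail. The first clause keeps track of degrees without
    homology. *)
Lemma lspan_sub (V : lmodType k) (s : seq V) (S : V -> Prop) :
  lin_closed S -> S 0 -> (forall x, S x -> lspan (@List.In _ ^~ s) x) ->
  exists t : seq V, [/\ s = [::] -> t = [::], forall x, List.In x t -> S x &
    forall x, S x -> lspan (@List.In _ ^~ t) x].
Proof.
elim: s S => [|v s IH] S cS S0 Ss; first by exists [::]; split.
have lspanE x : lspan (@List.In _ ^~ (v :: s)) x -> exists c y, x = c *: v + y /\ lspan (@List.In _ ^~ s) y.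
  elim=> [|c y z yvs _ [d [w [-> ws]]]].
    by exists 0, 0; rewrite scale0r addr0; split=> //; exact: lspan0.
  case: yvs => [<-|ys].
    by exists (c + d), w; rewrite addrA -scalerDl.
  exists d, (c *: y + w); rewrite addrCA; split=> //.
  by apply: lspan_lin.
pose S' x := S x /\ lspan (@List.In _ ^~ s) x.
have [|||t [_ tS' S't]] := IH S'.
- by move=> c x y [Sx sx] [Sy sy]; split; [exact: cS|exact: lspan_closed].
- by split=> //; exact: lspan0.
- by move=> x [].
case: (pselect (exists x, S x /\ ~ lspan (@List.In _ ^~ s) x)) => [[x0 [Sx0 nx0]]|ne].
  have [c [w [x0E ws]]] := lspanE _ (Ss _ Sx0).
  have c0 : c != 0.
    by apply/eqP => c0; apply: nx0; rewrite x0E c0 scale0r add0r.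
  exists (x0 :: t); split=> // [x [<- //|/tS'[]//]|x Sx].
  have [a [u [xE us]]] := lspanE _ (Ss _ Sx).
  rewrite -[x](subrKC ((a / c) *: x0)); apply: lspan_lin; first by left.
  have /S't h : S' (x - (a / c) *: x0).
    split; first by rewrite addrC -scaleNr; exact: cS.
    rewrite xE x0E scalerDr scalerA divfK // opprD addrACA subrr add0r addrC -scaleNr.
    exact: lspan_closed.
  by elim: h => [|d y z yt _ IHz]; [exact: lspan0|apply: lspan_lin => //; right].
exists t; split=> // [x /tS'[]//|x Sx]; apply: S't; split=> //.
by apply: contrapT => nx; apply: ne; exists x.
Qed.

(** Splits the total list by degree, [D] bounding the degrees that occur; generators for a cone or a
    shift are chosen one degree at a time. *)
Lemma fin_degreewise A X : fin A X <-> exists D : seq int, forall n,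
  exists s : seq (X (n - 1) A), (n \notin D -> s = [::]) /\
    forall x, cd X (n - 1) A x = 0 ->
      exists2 y, lspan (@List.In _ ^~ s) y & bdry X n A (x - y).
Proof.
split=> [[s sP]|[D DP]].
  exists (map (fun u => projT1 u) s) => n.
  have [t tE] : exists t : seq (X (n - 1) A), (n \notin map (fun u => projT1 u) s -> t = [::]) /\
      forall y, List.In (existT (fun n => X (n - 1) A : Type) n y) s -> List.In y t.
    elim: s {sP} => [|u s [t [t0 tE]]]; first by exists [::].
    case: (pselect (exists y, u = existT (fun n => X (n - 1) A : Type) n y)) => [[y ->]|ne].
      exists (y :: t); rewrite /= mem_head; split=> // z [e|/tE]; last by right.
      by left; apply: Eqdep_dec.inj_pair2_eq_dec e => a b; exact: (eq_comparable a b).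
    exists t; split=> [|y [e|/tE //]]; last by case: ne; exists y.
    by rewrite /= inE negb_or => /andP[_]; exact: t0.
  case: tE => t0 tE; exists t; split=> // x /sP[y ys xy]; exists y => //.
  by elim: ys => [|c a b /tE it _ IH]; [exact: lspan0|exact: lspan_lin].
have DP' n := cid (DP n).
pose l n := map (fun y => existT (fun n => X (n - 1) A : Type) n y) (sval (DP' n)).
exists (flatten (map l D)) => n x dx.
have [s0 sP] := svalP (DP' n); have [y ys xy] := sP x dx; exists y => //.
elim: ys => [|c a b ia _ IH]; [exact: lspan0|apply: lspan_lin => //].
apply/List.in_concat; exists (l n); split; last exact: (List.in_map (fun y => existT (fun n => X (n - 1) A : Type) n y)).
apply: List.in_map; have : n \in D by apply: contraT => /s0 e; move: ia; rewrite e.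
elim: D {DP DP' l s0 sP ia xy dx IH} => // m D IH; rewrite inE => /orP[/eqP ->|/IH]; by [left|right].
Qed.

Lemma fin_cone A X Y (f : cmap X Y) : fin A X -> fin A Y -> fin A (cone f).
Proof.
move=> /fin_degreewise[DX XP] /fin_degreewise[DY YP]; apply/fin_degreewise.
exists (map (fun n => n + 1) DX ++ DY) => n.
have [sX [sX0 sXP]] := XP (n - 1); have [sY [sY0 sYP]] := YP n.
(* Representatives, within the chosen span, of classes of X that die in the homology of Y: what the
   homology of the cone contributes on the side of X. *)
pose S x := [/\ lspan (@List.In _ ^~ sX) x, cd X (n - 1 - 1) A x = 0 &
  exists y, f _ A x + cd Y (n - 1) A y = 0].
have cS : lin_closed S.
  move=> c x y [sx dx [u uE]] [sy dy [v vE]]; split; first exact: lspan_closed.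
    by rewrite linearP dx dy scaler0 addr0.
  by exists (c *: u + v); rewrite !linearP addrACA -scalerDr uE vE scaler0 addr0.
have S0 : S 0 by split; [exact: lspan0|exact: linear0|exists 0; rewrite !linear0 addr0].
have [|t [t0 tS St]] := @lspan_sub _ sX S cS S0; first by move=> x [].
have [g gP] : exists g : X (n - 1 - 1) A -> Y (n - 1) A, forall x, List.In x t -> f _ A x + cd Y (n - 1) A (g x) = 0.
  have /choice[g gP] : forall x, exists y, List.In x t -> f _ A x + cd Y (n - 1) A y = 0.
    move=> x; case: (pselect (List.In x t)) => [/tS[_ _ [y yE]]|nx]; first by exists y.
    by exists 0.
  by exists g.
(* A lift of each generator of that kernel, followed by generators of the homology of Y. *)
exists (map (fun x => (x, g x)) t ++ map (fun y => (0, y)) sY); split.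
  rewrite mem_cat negb_or => /andP[nX nY]; rewrite sY0 // t0 // sX0 //.
  by apply: contra nX => nX; apply/mapP; exists (n - 1) => //; rewrite subrK.
move=> [x y] [/= dx e].
have {}dx : cd X (n - 1 - 1) A x = 0 by rewrite -[LHS]opprK dx oppr0.
have [x' sx' [u uE]] := sXP _ dx.
have fu : cd Y (n - 1) A (f _ A u) = f _ A x - f _ A x' by rewrite -cmap_d -uE linearB.
have Sx' : S x'.
  split=> //; first by rewrite -[x'](subKr x) uE linearB cdd dx subr0.
  by exists (y + f _ A u); rewrite (linearD (cd Y (n - 1) A)) fu [LHS]addrCA subrKC -e; exact: addrC.
have [y' ly' y'E] : exists2 y', lspan (@List.In _ ^~ (map (fun x => (x, g x)) t)) (x', y') &
    f _ A x' + cd Y (n - 1) A y' = 0.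
  elim: (St _ Sx') => [|c a b at_ _ [b' lb' b'E]].
    by exists 0; [exact: lspan0|rewrite !linear0 addr0].
  exists (c *: g a + b'); last by rewrite !linearP addrACA -scalerDr gP // b'E scaler0 addr0.
  rewrite -[(_, _)]/(c *: ((a, g a) : X (n - 1 - 1) A * Y (n - 1) A)%type + (b, b')).
  by apply: lspan_lin lb'; exact: (List.in_map (fun x => (x, g x))).
have [|w lw [v vE]] := sYP (y + f _ A u - y').
  rewrite (linearB (cd Y (n - 1) A)) (linearD (cd Y (n - 1) A)) fu.
  have -> : cd Y (n - 1) A y' = - f _ A x' by rewrite (addr0_eq y'E).
  have -> : cd Y (n - 1) A y = - f _ A x by rewrite (addr0_eq e).
  by rewrite opprK addKr addNr.
have sub S1 S2 z : (forall a, List.In a S1 -> List.In a S2) -> lspan (@List.In _ ^~ S1) z -> lspan (V := (X (n - 1 - 1) A * Y (n - 1) A)%type) (@List.In _ ^~ S2) z.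
  by move=> s12; elim=> [|c a b /s12 ia _ IH]; [exact: lspan0|exact: lspan_lin].
exists (x', y' + w).
  rewrite (_ : (x', y' + w) = 1 *: ((x', y') : X (n - 1 - 1) A * Y (n - 1) A)%type + (0, w)); last first.
    by rewrite scale1r; congr pair; rewrite /= addr0.
  apply: lspan_closed; first by apply: sub ly' => a ia; apply/List.in_or_app; left.
  elim: lw => [|c a b ia _ IH]; first exact: lspan0.
  rewrite (_ : (0, c *: a + b) = c *: ((0, a) : X (n - 1 - 1) A * Y (n - 1) A)%type + (0, b)).
    apply: lspan_lin IH; apply/List.in_or_app; right.
    exact: (List.in_map (fun y => (0, y))).
  by congr pair; rewrite /= scaler0 addr0.
have e1 : x - x' = - cd X (n - 1) A (- u) by rewrite linearN opprK.
have e2 : y - (y' + w) = f (n - 1) A (- u) + cd Y n A v.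
  by rewrite -vE linearN; move: (f _ A u) => q; rewrite opprD !addrA [- q + y]addrC subrK.
by exists (- u, v); congr pair.
Qed.
End Cones.
Section FinInduced.
Context (k : fieldType) (U : finGroupType -> Prop) (G : grp U).
Hypothesis (k0 : [pchar k]%R =i pred0).
Implicit Types (X Y Z W : cpx k U) (A B C : grp U) (n : int).

Lemma bdry_sum X n A (I : finType) (F : I -> X (n - 1) A) :
  (forall i, bdry X n A (F i)) -> bdry X n A (\sum_i F i).
Proof. by move=> bF; apply: big_ind => [|x y|i _]; [exact: bdry0|exact: bdryD|]. Qed.

Lemma bdryZ X n A c x : bdry X n A x -> bdry X n A (c *: x).
Proof. by case=> y ->; exists (c *: y); rewrite linearZ_LR. Qed.

Lemma lspan_sum (V : lmodType k) (S : V -> Prop) (I : finType) (F : I -> V) :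
  (forall i, lspan S (F i)) -> lspan S (\sum_i F i).
Proof.
move=> sF; apply: big_ind => [|x y sx sy|//]; first exact: lspan0.
by rewrite -[x]scale1r; exact: lspan_closed.
Qed.

Lemma lspanZ (V : lmodType k) (S : V -> Prop) c x : lspan S x -> lspan S (c *: x).
Proof. by move=> sx; rewrite -[_ *: _]addr0; apply: lspan_closed => //; exact: lspan0. Qed.

(** The finite-rank operator at G is averaged and extended to the induced complex, where [ind_null]
    shows it homotopic to the identity. Its values at A are spanned by finitely many generators
    because [epi A G] is finite. *)
Lemma fin_ind X A : fin G X -> fin A (ind_cpx G X).
Proof.
case/fin_end=> q [s [hq qs]].
pose q0 n : {linear X n G -> X n G} := q n G.
have q0P n x : q0 (n - 1) (cd X n G x) = cd X n G (q0 n x) by exact: (cmap_d q).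
have q0b n x : cd X (n - 1) G x = 0 -> bdry X n G (x - q0 _ x).
  move=> dx; apply/bdry_sym; exact: (@htp_bdry k U (at_cpx G X) (at_cpx G X) q (cmap_id _) n G x hq dx).
have hE n := cid (average_ex (q0 n)).
pose q1 n := sval (hE n).
have q1S n : forall (s : epi G G) x, q1 n (res _ s x) = res _ s (q1 n x) := (svalP (hE n)).1.
have q1E n x : q1 n x = #|{: epi G G}|%:R^-1 *: \sum_(s : epi G G) res _ (epiV s) (q0 n (res _ s x)) := (svalP (hE n)).2 x.
have N0 : (#|{: epi G G}|%:R : k) != 0.
  have /charf0P -> := k0; rewrite -lt0n; apply/card_gt0P; by exists (epi_id G).
have q1P n x : q1 (n - 1) (cd X n G x) = cd X n G (q1 n x).
  rewrite !q1E [RHS]linearZ_LR; congr (_ *: _); rewrite linear_sum; apply: eq_bigr => t _.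
  by rewrite -(rhom_nat (cd X n)) q0P -(rhom_nat (cd X n)).
have q1b n x : cd X (n - 1) G x = 0 -> bdry X n G (x - q1 _ x).
  move=> dx; rewrite q1E.
  have -> : x - #|{: epi G G}|%:R^-1 *: \sum_(s : epi G G) res _ (epiV s) (q0 _ (res _ s x)) =
      #|{: epi G G}|%:R^-1 *: \sum_(s : epi G G) (x - res _ (epiV s) (q0 _ (res _ s x))).
    by rewrite sumrB sumr_const scalerBr -scaler_nat scalerA mulVf // scale1r.
  apply/bdryZ/bdry_sum => t.
  have {1}-> : x = res _ (epiV t) (res _ t x).
    by rewrite -res_comp (res_ext (e' := epi_id G)) ?res_id // => y; exact: epiVK.
  rewrite -linearB; apply/bdry_res/q0b; by rewrite (rhom_nat (cd X (n - 1))) dx linear0.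
have q2S n B : forall (e : epi B G) (s : epi G G) x,
    lcomp (igen X n B (epi_comp s e)) (q1 n) x = lcomp (igen X n B e) (q1 n) (res _ s x).
  by move=> e t x; rewrite !lcompE igenS q1S.
pose q2 n B : {linear ind_cpx G X n B -> ind_cpx G X n B} := ind_rec (q2S n B).
have q2E n B e x : q2 n B (igen X n B e x) = igen X n B e (q1 n x) by exact: ind_recE.
have q2n n B C (e : epi B C) x : q2 n B (res _ e x) = res _ e (q2 n C x).
  move: x; apply: (@igen_ext k U G X n C _ (lcomp (q2 n B) (res _ e)) (lcomp (res _ e) (q2 n C))) => a x.
  by rewrite !lcompE igen_res !q2E igen_res.
have q2d n B x : RHom (q2n (n - 1)) B (cd (ind_cpx G X) n B x) = cd (ind_cpx G X) n B (RHom (q2n n) B x).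
  move: x; apply: (@igen_ext k U G X n B _ (lcomp (q2 (n - 1) B) (cd _ n B)) (lcomp (cd _ n B) (q2 n B))) => a x.
  by rewrite !lcompE igen_d !q2E igen_d q1P.
pose g := cmap_add (cmap_id (ind_cpx G X)) (@CMap k U (ind_cpx G X) (ind_cpx G X) (fun n => rhom_opp (RHom (q2n n)))
  (fun n A x => etrans (congr1 -%R (q2d n A x)) (esym (linearN _ _)))).
have gE n B z : g n B z = z - q2 n B z by [].
have /htp_bdry g0 : htp g (cmap_zero _ _).
  apply: ind_null => // n x dx; rewrite gE q2E -linearB.
  have [w ->] := q1b _ _ dx; rewrite -igen_d; exact: bdry_d.
exists (flatten [seq [seq existT (fun n => ind_cpx G X (n - 1) A : Type) (projT1 u)
   (igen X _ A et.1 (res (X (projT1 u - 1)) (epiV et.2) (projT2 u))) | u <- s] | et <- enum {: epi A G * epi G G}]).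
move=> n z dz; exists (q2 _ A z); last by have := g0 n A z dz; rewrite gE subr0.
have In_enum (I : finType) (x : I) : List.In x (enum I).
  have : x \in enum I by rewrite mem_enum.
  by elim: (enum I) => //= y t IH; rewrite inE => /orP[/eqP ->|/IH]; [left|right].
move: {dz} z; apply: pres_ind => [[e x]||w Tw|v w Tv Tw|c v Tv].
- rewrite -[pgen _ _]/(igen X (n - 1) A e x) q2E q1E linearZ_LR linear_sum.
  apply/lspanZ/lspan_sum => t.
  apply: (lspan_map (f := lcomp (igen X (n - 1) A e) (res _ (epiV t))) _ (qs n (res _ t x))) => y ys.
  apply: lspan_in; apply/List.in_concat.
  exists [seq existT (fun n => ind_cpx G X (n - 1) A : Type) (projT1 u)
   (igen X _ A e (res (X (projT1 u - 1)) (epiV t) (projT2 u))) | u <- s]; split.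
    exact: (List.in_map (fun et : epi A G * epi G G => [seq existT (fun n => ind_cpx G X (n - 1) A : Type) (projT1 u)
     (igen X _ A et.1 (res (X (projT1 u - 1)) (epiV et.2) (projT2 u))) | u <- s]) _ (e, t)).
  exact: (List.in_map (fun u => existT (fun n => ind_cpx G X (n - 1) A : Type) (projT1 u)
     (igen X _ A e (res (X (projT1 u - 1)) (epiV t) (projT2 u)))) _ _ ys).
- by rewrite linear0; exact: lspan0.
- by rewrite linearN -scaleN1r; exact: lspanZ.
- by rewrite linearD -[q2 _ _ v]scale1r; exact: lspan_closed.
- by rewrite linearZ_LR; exact: lspanZ.
Qed.
End FinInduced.
(** * Truncations and compact objects *)
(* An increasing exhaustion of [U] by full subcategories of "n-torsion" groups,
   those on which the projection [tproj n] is injective; [trunc n] is the left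
   adjoint of the inclusion, and each subcategory has finitely many types. *)
Record truncation (U : finGroupType -> Prop) := Truncation {
  epi_conj_eq : forall (A B : grp U) (f g : epi A B), epi_conj f g -> f =1 g;
  trunc : nat -> grp U -> grp U;
  tproj : forall n (A : grp U), epi A (trunc n A);
  tmap : forall n (A B : grp U), epi A B -> epi (trunc n A) (trunc n B);
  tmapE : forall n (A B : grp U) (e : epi A B) x,
    tmap n e (tproj n A x) = tproj n B (e x);
  tproj_trunc : forall n A, injective (tproj n (trunc n A));
  tproj_mono : forall m n (A : grp U), (m <= n)%N ->
    injective (tproj m A) -> injective (tproj n A);
  tproj_large : forall A : grp U, exists n, injective (tproj n A);
  ttypes : nat -> seq (grp U);
  ttypes_tors : forall n G, List.In G (ttypes n) -> injective (tproj n G);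
  ttypesP : forall n (A : grp U), injective (tproj n A) ->
    exists G : grp U, List.In G (ttypes n) /\ exists e : epi A G, injective e
}.

Section Truncated.
Context (k : fieldType) (U : finGroupType -> Prop) (T : truncation U).
Hypothesis (k0 : [pchar k]%R =i pred0).
Implicit Types (X Y Z W : cpx k U) (A B C G : grp U) (n m : int) (N M : nat).

Definition tors N A := injective (tproj T N A).

Lemma tmap_id N A x : tmap T N (epi_id A) x = x.
Proof. by have [y <-] := epi_surj (tproj T N A) x; rewrite tmapE. Qed.

Lemma tmap_comp N A B C (g : epi B C) (f : epi A B) x :
  tmap T N (epi_comp g f) x = epi_comp (tmap T N g) (tmap T N f) x.
Proof.
by have [y <-] := epi_surj (tproj T N A) x; rewrite tmapE /= !tmapE.
Qed.

Lemma tmap_conj N A B (f g : epi A B) : epi_conj f g -> epi_conj (tmap T N f) (tmap T N g).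
Proof.
case=> h hP; exists (tproj T N B h) => x.
have [y <-] := epi_surj (tproj T N A) x; rewrite !tmapE hP /conjg !epiM.
congr (_ * _)%g; apply: (mulIg (tproj T N B h)).
by rewrite -epiM !mulVg epi1.
Qed.

Lemma tors_lift N A G (f : epi A G) : tors N G ->
  exists f' : epi (trunc T N A) G, forall x, f' (tproj T N A x) = f x.
Proof.
case/epi_inv_ex=> i [ip pi]; exists (epi_comp i (tmap T N f)) => x.
by rewrite /= tmapE ip.
Qed.

Program Definition trunc_rep N (F : rep k U) : rep k U :=
  @Rep k U (fun A => F (trunc T N A)) (fun A B e => res F (tmap T N e)) _ _ _.
Next Obligation.
by move=> N F A x; rewrite (res_ext (e' := epi_id _)) ?res_id // => y; exact: tmap_id.
Qed.
Next Obligation.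
by move=> N F A B C g f x; rewrite -res_comp; apply: res_ext => y; exact: tmap_comp.
Qed.
Next Obligation. by move=> N F A B f g x fg; apply/res_conj/tmap_conj. Qed.

Program Definition trunc_hom N (F H : rep k U) (f : rhom F H) :
  rhom (trunc_rep N F) (trunc_rep N H) :=
  @RHom k U (trunc_rep N F) (trunc_rep N H) (fun A => f (trunc T N A)) _.
Next Obligation. by move=> N F H f A B e x; exact: (rhom_nat f (tmap T N e)). Qed.

Program Definition trunc_cpx N X : cpx k U :=
  @Cpx k U (fun n => trunc_rep N (X n)) (fun n => trunc_hom N (cd X n)) _.
Next Obligation. by move=> N X n A x; exact: cdd. Qed.

Program Definition trunc_in N X : cmap (trunc_cpx N X) X :=
  @CMap k U (trunc_cpx N X) X (fun n => @RHom k U (trunc_cpx N X n) (X n)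
    (fun A => res (X n) (tproj T N A)) _) _.
Next Obligation.
move=> N X n A B e x.
rewrite -[LHS]/(res (X n) (tproj T N A) (res (X n) (tmap T N e) x)) -!res_comp.
by apply: res_ext => y; exact: tmapE.
Qed.
Next Obligation. by move=> N X n A x; rewrite /= rhom_nat. Qed.

Definition tr N X : Prop := forall A, hiso (fun n => res (X n) (tproj T N A)).

Lemma trP N X : tr N X <-> quasi_iso (trunc_in N X).
Proof. by split=> [h|/qi_hiso h]; [apply/qi_hiso => A; exact: (h A)|move=> A; exact: (h A)]. Qed.

Lemma hiso_bij A B X Y (f : forall n, {linear X n A -> Y n B}) (g : forall n, {linear Y n B -> X n A}) :
  (forall n x, g (n - 1) (cd Y n B x) = cd X n A (g n x)) ->
  (forall n, cancel (f n) (g n)) -> (forall n, cancel (g n) (f n)) -> hiso f.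
Proof.
move=> gP fg gf; split=> n x dx.
  by case=> y e; exists (g n y); rewrite -gP -e fg.
by exists (g _ x); rewrite ?gf ?subrr; [rewrite -gP dx linear0|exact: bdry0].
Qed.

Lemma hiso_res_inj X A B (e : epi A B) : injective e -> hiso (fun n => res (X n) e).
Proof.
case/epi_inv_ex=> e' [ee' e'e].
apply: (@hiso_bij _ _ _ _ _ (fun n => res (X n) e')) => n x; first by rewrite rhom_nat.
  by rewrite -res_comp (res_ext (e' := epi_id _)) ?res_id.
by rewrite -res_comp (res_ext (e' := epi_id _)) ?res_id.
Qed.

Lemma hiso_comp A B C X Y Z (f : forall n, {linear X n A -> Y n B}) (g : forall n, {linear Y n B -> Z n C}) :
  (forall n x, f (n - 1) (cd X n A x) = cd Y n B (f n x)) ->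
  (forall n x, g (n - 1) (cd Y n B x) = cd Z n C (g n x)) ->
  hiso f -> hiso g -> hiso (fun n => lcomp (g n) (f n)).
Proof.
move=> fP gP [fi fq] [gi gq]; split=> n x dx.
  by move=> b; apply: fi => //; apply: gi b; rewrite -fP dx linear0.
have [y dy [u uE]] := gq _ _ dx; have [z dz [v vE]] := fq _ _ dy.
exists z => //; exists (u + g n v).
by rewrite linearD -uE -gP -vE linearB addrA subrK.
Qed.

Lemma hiso_cancel A B C X Y Z (f : forall n, {linear X n A -> Y n B}) (g : forall n, {linear Y n B -> Z n C}) :
  (forall n x, f (n - 1) (cd X n A x) = cd Y n B (f n x)) ->
  (forall n x, g (n - 1) (cd Y n B x) = cd Z n C (g n x)) ->
  hiso f -> hiso (fun n => lcomp (g n) (f n)) -> hiso g.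
Proof.
move=> fP gP [fi fq] [gi gq]; split=> n x dx.
  move=> b; have [y dy [u uE]] := fq _ _ dx.
  have [|v vE] := gi n y dy.
    case: b => w wE; exists (w - g n u); rewrite lcompE linearB -wE -gP -uE linearB subKr.
    exact: erefl.
  by exists (u + f n v); rewrite linearD -uE -fP -vE subrK.
by have [y dy b] := gq _ _ dx; exists (f _ y) => //; rewrite -fP dy linear0.
Qed.

Lemma tr_acyc N X A : tr N X -> (acyc (trunc T N A) X <-> acyc A X).
Proof. by move=> /(_ A); apply: hiso_acyc => n x; rewrite rhom_nat. Qed.

Lemma acyc_inj X A B (e : epi A B) : injective e -> (acyc B X <-> acyc A X).
Proof.
move=> /(hiso_res_inj X); apply: hiso_acyc => n x; by rewrite rhom_nat.
Qed.

(** For N <= M the groups Q_N Q_M A and Q_N A agree, so X(Q_M A) and X(A) are computed by the same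
    value of X; two out of three concludes. *)
Lemma tr_mono N M X : (N <= M)%N -> tr N X -> tr M X.
Proof.
move=> NM tX A; have tQ : tors M (trunc T N A).
  exact: tproj_mono NM (@tproj_trunc U T N A).
have [g gE] : exists g : epi (trunc T M A) (trunc T N A), forall x, g (tproj T M A x) = tproj T N A x.
  exact: tors_lift.
have gi : injective (tmap T N (tproj T M A)).
  have K x : tmap T N g (tmap T N (tproj T M A) x) = tproj T N _ x.
    by have [y <-] := epi_surj (tproj T N A) x; rewrite !tmapE gE.
  by move=> x y e; apply: (@tproj_trunc U T N A); rewrite -!K e.
apply: (hiso_cancel _ _ (tX (trunc T M A))) => [n x|n x|]; try by rewrite rhom_nat.
apply: (@hiso_ext k U (trunc T N (trunc T M A)) A X X (fun n => lcomp (res (X n) (tproj T N A)) (res (X n) (tmap T N (tproj T M A))))).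
  move=> n x; rewrite !lcompE -!res_comp; apply: res_ext => y; exact: tmapE.
by apply: hiso_comp => [n x|n x||]; rewrite ?rhom_nat //; exact: hiso_res_inj.
Qed.

Lemma tr_cone N X Y (f : cmap X Y) : tr N X -> tr N Y -> tr N (cone f).
Proof.
move=> tX tY A; apply: (hiso_cone _ _ _ (tX A) (tY A)) => n x; by rewrite rhom_nat.
Qed.

Lemma tr_ctens N X Y : tr N X -> tr N Y -> tr N (ctens X Y).
Proof. by move=> tX tY A; exact: hiso_res_ctens. Qed.

(** Epimorphisms from A to an N-torsion group factor uniquely through Q_N A, so both sides have the
    same generators. *)
Lemma tr_ind N G X : tors N G -> tr N (ind_cpx G X).
Proof.
move=> tG A.
have lE (f : epi A G) := cid (tors_lift f tG).
pose l f := sval (lE f).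
have lP f x : l f (tproj T N A x) = f x := svalP (lE f) x.
have lS n (f : epi A G) (s : epi G G) x :
    igen X n (trunc T N A) (l (epi_comp s f)) x = igen X n _ (l f) (res _ s x).
  rewrite -igenS; congr (igen X n _ _ x); apply: epi_ext => z.
  by have [y <-] := epi_surj (tproj T N A) z; rewrite /= !lP.
pose g n : {linear ind_cpx G X n A -> ind_cpx G X n (trunc T N A)} :=
  ind_rec (phi := fun f => igen X n _ (l f)) (lS n).
have gE n f x : g n (igen X n A f x) = igen X n _ (l f) x by exact: ind_recE.
apply: (@hiso_bij _ _ _ _ _ g) => n x.
- move: x; apply: (@igen_ext k U G X n A _ (lcomp (g (n - 1)) (cd _ n A)) (lcomp (cd _ n _) (g n))) => e x.
  by rewrite !lcompE igen_d !gE igen_d.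
- move: x; apply: (@igen_ext k U G X n _ _ (lcomp (g n) (res _ (tproj T N A))) idfun) => e x.
  rewrite lcompE igen_res gE; congr (igen X n _ _ x); apply: epi_ext => z.
  by have [y <-] := epi_surj (tproj T N A) z; rewrite /= lP.
- move: x; apply: (@igen_ext k U G X n _ _ (lcomp (res _ (tproj T N A)) (g n)) idfun) => e x.
  rewrite lcompE gE igen_res; congr (igen X n _ _ x); apply: epi_ext => z; exact: lP.
Qed.

Lemma acyc_counit_cone X A G (e : epi A G) : injective e -> acyc A (cone (counit G X)).
Proof.
move=> ei; have gE n := cid (counit_bij X n ei).
pose g n := sval (gE n).
have eg n : cancel (counit G X n A) (g n) := (svalP (gE n)).1.
have ge n : cancel (g n) (counit G X n A) := (svalP (gE n)).2.
move=> n [x y] [/= dx fx].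
have e2 : y = counit G X (n - 1) A (g _ y) by rewrite ge.
have e3 : x = - cd (ind_cpx G X) (n - 1) A (g _ y).
  apply: (can_inj (eg _)).
  by rewrite linearN cmap_d ge; apply/eqP; rewrite -addr_eq0; apply/eqP; exact: fx.
exists (g _ y, 0); congr pair; first exact: e3.
by rewrite /= linear0 addr0; exact: e2.
Qed.

Lemma acyc_counit_cone0 X A G : (epi A G -> False) -> acyc A X ->
  acyc A (cone (counit G X)).
Proof.
move=> ne aX; apply: acyc_cone => // n x _.
by rewrite (ind_cpx_empty x ne); exact: bdry0.
Qed.

Fixpoint ordered (l : list (grp U)) : Prop :=
  if l is G :: l' then (forall H, List.In H l' -> (#|G| <= #|H|)%N) /\ ordered l' else True.

Lemma ordered_ex (s : list (grp U)) : exists l, ordered l /\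
  forall G, List.In G l <-> List.In G s.
Proof.
elim: s => [|G s [l [ls lP]]]; first by exists nil.
suff [l' [ls' lP']] : exists l', ordered l' /\ forall H, List.In H l' <-> G = H \/ List.In H l.
  by exists l'; split=> // H; rewrite lP' lP.
elim: l ls {lP} => [_|K l IH [Kl ls]].
  by exists (cons G nil); split=> [|H] /=; [split|split; [case; [left|]|case; [left|]]].
case: (leqP #|G| #|K|) => GK.
  exists (cons G (cons K l)); split=> //=; split=> // H [<- //|/Kl]; exact: leq_trans.
have [l' [ls' lP']] := IH ls.
exists (cons K l'); split; last by move=> H /=; rewrite lP'; tauto.
by split=> // H /lP'[<-|/Kl//]; exact: ltnW.
Qed.

(** Passing to the cone of a counit kills the homology at one type G. Types are taken in increasing
    order of cardinality: a group treated earlier and not isomorphic to G has no epimorphism onto G,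
    so the cone stays acyclic there. *)
Lemma tr_small N X : tr N X -> (forall A, fin A X) -> small X.
Proof.
(* The invariant of the induction: an N-torsion group is either still listed up to isomorphism, or X
   is acyclic at it and it is no larger than any listed group. *)
have : exists l : list (grp U), [/\ ordered l, forall G, List.In G l -> tors N G &
    forall A, tors N A -> (exists G, List.In G l /\ exists e : epi A G, injective e)
      \/ (acyc A X /\ forall G, List.In G l -> (#|A| <= #|G|)%N)].
  have [l [ls lP]] := ordered_ex (ttypes T N); exists l; split=> // [G /lP|A tA].
    exact: ttypes_tors.
  by left; have [G [Gl eG]] := ttypesP tA; exists G; split=> //; exact/lP.
case=> l; elim: l X => [|G l IH] X [ls lT lA] tX fX.
  (* With no type left, X is acyclic at torsion groups, hence everywhere by truncation. *)
  apply: acyclic_small => n A; apply: (tr_acyc A tX).1.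
  by have [[G []]|[]] := lA _ (@tproj_trunc U T N A).
case: ls => Gl ls; have tG : tors N G by apply: lT; left.
apply: (@small_cone_inv k U (ind_cpx G X) X (counit G X)).
- exact: ind_small.
- by move=> Z a; exact: ind_deq0.
apply: IH.
- split=> // [H Hl|A tA]; first by apply: lT; right.
  case: (pselect (exists e : epi A G, injective e)) => [[e ei]|nAG].
    right; split; first exact: acyc_counit_cone ei.
    move=> H /Gl; apply: leq_trans; exact: leq_card ei.
  case: (lA A tA) => [[H [[<- eH|Hl eH]]]|[aA Al]]; first by case: nAG.
    by left; exists H.
  right; split; last by move=> H Hl; apply: Al; right.
  apply: acyc_counit_cone0 => // e; apply: nAG; exists e; apply: epi_card_inj.
  by apply/eqP; rewrite eqn_leq (epi_card e) Al //; left.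
- by apply: tr_cone => //; exact: tr_ind.
- by move=> A; apply: fin_cone => //; exact: fin_ind.
Qed.
End Truncated.

(** * Products of complexes, and why compact objects are truncated *)

Definition dprod (k : fieldType) (I : Type) (V : I -> lmodType k) : Type := forall i, V i.

Section DProd.
Context (k : fieldType) (I : Type) (V : I -> lmodType k).

HB.instance Definition _ := gen_eqMixin (dprod V).
HB.instance Definition _ := gen_choiceMixin (dprod V).

Definition dprod_add (x y : dprod V) : dprod V := fun i => x i + y i.
Definition dprod_opp (x : dprod V) : dprod V := fun i => - x i.
Definition dprod_zero : dprod V := fun i => 0.
Definition dprod_scale (c : k) (x : dprod V) : dprod V := fun i => c *: x i.

Lemma dprodP (x y : dprod V) : (forall i, x i = y i) -> x = y.
Proof. exact: functional_extensionality_dep. Qed.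

Lemma dprod_addA : associative dprod_add.
Proof. by move=> x y z; apply: dprodP => i; exact: addrA. Qed.
Lemma dprod_addC : commutative dprod_add.
Proof. by move=> x y; apply: dprodP => i; exact: addrC. Qed.
Lemma dprod_add0 : left_id dprod_zero dprod_add.
Proof. by move=> x; apply: dprodP => i; exact: add0r. Qed.
Lemma dprod_addN : left_inverse dprod_zero dprod_opp dprod_add.
Proof. by move=> x; apply: dprodP => i; exact: addNr. Qed.

HB.instance Definition _ :=
  GRing.isZmodule.Build (dprod V) dprod_addA dprod_addC dprod_add0 dprod_addN.

Lemma dprod_scaleA c d x : dprod_scale c (dprod_scale d x) = dprod_scale (c * d) x.
Proof. by apply: dprodP => i; exact: scalerA. Qed.
Lemma dprod_scale1 : left_id 1 dprod_scale.
Proof. by move=> x; apply: dprodP => i; exact: scale1r. Qed.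
Lemma dprod_scaleDr : right_distributive dprod_scale +%R.
Proof. by move=> c x y; apply: dprodP => i; exact: scalerDr. Qed.
Lemma dprod_scaleDl x : {morph dprod_scale^~ x : c d / c + d}.
Proof. by move=> c d; apply: dprodP => i; exact: scalerDl. Qed.

HB.instance Definition _ :=
  GRing.Zmodule_isLmodule.Build k (dprod V) dprod_scaleA dprod_scale1 dprod_scaleDr dprod_scaleDl.

End DProd.

Section DProdMap.
Context (k : fieldType) (I : Type).

Lemma dprod_map_linear (V W : I -> lmodType k) (f : forall i, {linear V i -> W i}) :
  linear ((fun x i => f i (x i)) : dprod V -> dprod W).
Proof. by move=> c x y; apply: dprodP => i; exact: linearP. Qed.

Lemma dprod_tuple_linear (V : lmodType k) (W : I -> lmodType k) (f : forall i, {linear V -> W i}) :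
  linear ((fun x i => f i x) : V -> dprod W).
Proof. by move=> c x y; apply: dprodP => i; exact: linearP. Qed.

Lemma dprod_proj_linear (V : I -> lmodType k) i :
  linear ((fun x => x i) : dprod V -> V i).
Proof. by []. Qed.
End DProdMap.

Section CProd.
Context (k : fieldType) (U : finGroupType -> Prop) (I : Type) (Y : I -> cpx k U).
Implicit Types (X Z W : cpx k U) (A B C : grp U) (n : int).

Program Definition rep_dprod (F : I -> rep k U) : rep k U :=
  @Rep k U (fun A => dprod (fun i => F i A))
    (fun A B e => mklin (dprod_map_linear (fun i => res (F i) e))) _ _ _.
Next Obligation. by move=> F A x; apply: dprodP => i; exact: res_id. Qed.
Next Obligation. by move=> F A B C g f x; apply: dprodP => i; exact: res_comp. Qed.
Next Obligation. by move=> F A B f g x fg; apply: dprodP => i; exact: res_conj. Qed.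

Program Definition cprod : cpx k U :=
  @Cpx k U (fun n => rep_dprod (fun i => Y i n))
    (fun n => @RHom k U (rep_dprod (fun i => Y i n)) (rep_dprod (fun i => Y i (n - 1)))
      (fun A => mklin (dprod_map_linear (fun i => cd (Y i) n A))) _) _.
Next Obligation. by move=> n A B e x; apply: dprodP => i; exact: rhom_nat. Qed.
Next Obligation. by move=> n A x; apply: dprodP => i; exact: cdd. Qed.

Program Definition cprod_proj i : cmap cprod (Y i) :=
  @CMap k U cprod (Y i) (fun n => @RHom k U (cprod n) (Y i n)
    (fun A => mklin (@dprod_proj_linear k I (fun i => Y i n A) i)) _) _.
Next Obligation. by []. Qed.
Next Obligation. by []. Qed.

Program Definition cprod_tuple X (f : forall i, cmap X (Y i)) : cmap X cprod :=
  @CMap k U X cprod (fun n => @RHom k U (X n) (cprod n)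
    (fun A => mklin (dprod_tuple_linear (fun i => f i n A))) _) _.
Next Obligation. by move=> X f n A B e x; apply: dprodP => i; exact: rhom_nat. Qed.
Next Obligation. by move=> X f n A x; apply: dprodP => i; exact: cmap_d. Qed.

Definition csum_cprod : cmap (csum Y) cprod := cprod_tuple (csum_proj Y).

End CProd.

(** At a given group the factors from some N on are acyclic, so a cycle of the product is homologous
    to the part formed by its first N components. *)
Lemma csum_cprod_qi (k : fieldType) (U : finGroupType -> Prop) (Y : nat -> cpx k U) :
  (forall A, exists N, forall i, (N <= i)%N -> acyc A (Y i)) -> quasi_iso (csum_cprod Y).
Proof.
move=> aY; apply: quasi_isoP => n A.
  move=> z dz [y yE].
  have [s0 zs0] := csum_support z; have [s us ss] := nodup_seq s0.
  have zs : csum_cut Y s (n - 1) A z = 0.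
    by rewrite -(csum_cut_sub z ss) zs0 linear0.
  have <- : csum_part Y s (n - 1) A z = z.
    by have := csum_part_cut us z; rewrite /= zs addr0.
  elim: s {us ss zs} => [|i s IH]; first exact: bdry0.
  rewrite csum_part_cons; apply: bdryD => //; apply: bdry_map.
  by exists (y i); exact: (congr1 (fun w => w i) yE).
move=> y dy; have [N NP] := aY A.
have bE i : exists w, (N <= i)%N -> y i = cd (Y i) n A w.
  case: (leqP N i) => Ni; last by exists 0.
  have [|w wE] := NP i Ni n (y i); first exact: (congr1 (fun w => w i) dy).
  by exists w.
exists (\sum_(i < N) csum_in Y i (n - 1) A (y i)).
  rewrite linear_sum big1 // => i _; rewrite -cmap_d.
  have -> : cd (Y i) (n - 1) A (y i) = 0 by exact: (congr1 (fun w => w (i : nat)) dy).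
  exact: linear0.
pose w i := sval (cid (bE i)).
have wP i : (N <= i)%N -> y i = cd (Y i) n A (w i) := svalP (cid (bE i)).
exists (fun i => if (N <= i)%N then w i else 0); apply: dprodP => i.
rewrite -[LHS]/(y i - csum_proj Y i (n - 1) A _) linear_sum.
rewrite -[RHS]/(cd (Y i) n A (if (N <= i)%N then w i else 0)).
case: (leqP N i) => Ni.
  rewrite -(wP i Ni) big1 ?subr0 // => j _.
  by rewrite csum_proj_ne // => ji; move: (ltn_ord j); rewrite ji ltnNge Ni.
rewrite linear0 (bigD1 (Ordinal Ni)) //= big1 => [|j ji].
  by rewrite [X in _ - (X + _)](csum_projE (Y := Y)) addr0 subrr.
rewrite [LHS](csum_proj_ne (Y := Y)) // => e; move: ji; rewrite -val_eqE /= e eqxx //.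
Qed.

Lemma acyclic_cone_qi (k : fieldType) (U : finGroupType -> Prop) (X Y : cpx k U) (f : cmap X Y) :
  (forall A, acyc A (cone f)) -> quasi_iso f.
Proof.
move=> af; apply: quasi_isoP.
  apply: int_pred_ind => n A x dx [w wE].
  have [|[u v] [/= uE vE]] := af A n (x, - w).
    by congr pair; rewrite /= ?dx ?oppr0 // linearN -wE addrN.
  by exists (- u); rewrite linearN.
move=> n A y dy; have [|[u v] [/= uE vE]] := af A n (0, y).
  by congr pair; rewrite /= ?linear0 ?oppr0 ?add0r.
exists u; first by rewrite -[LHS]opprK -uE oppr0.
by exists v; rewrite vE addrKl.
Qed.

Section CompactTr.
Context (k : fieldType) (U : finGroupType -> Prop) (T : truncation U).
Implicit Types (X Y Z W : cpx k U) (A B C G : grp U) (n m : int) (N M : nat).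

Definition trunc_cone N X := cone (trunc_in T N X).

Program Definition trunc_cone_map N X Y (f : cmap X Y) : cmap (trunc_cone N X) (trunc_cone N Y) :=
  @CMap k U (trunc_cone N X) (trunc_cone N Y) (fun n =>
    @RHom k U (trunc_cone N X n) (trunc_cone N Y n)
      (fun A => pair_map (f (n - 1) (trunc T N A)) (f n A)) _) _.
Next Obligation.
move=> N X Y f n A B e x; congr pair; first exact: (rhom_nat (f (n - 1)) (tmap T N e)).
exact: (rhom_nat (f n) e).
Qed.
Next Obligation.
move=> N X Y f n A x; congr pair; rewrite /= ?linearN ?cmap_d //.
by rewrite linearD cmap_d rhom_nat.
Qed.

Lemma trunc_cone_map_qi N X Y (f : cmap X Y) : quasi_iso f -> quasi_iso (trunc_cone_map N f).
Proof.
move=> /qi_hiso qf; apply/qi_hiso => A.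
apply: (@hiso_cone k U A A (trunc_cpx T N X) X (trunc_cpx T N Y) Y (trunc_in T N X) (trunc_in T N Y)
  (fun n => f n (trunc T N A)) (fun n => f n A)) => [n x|n x|n x||].
- exact: (@cmap_d k U X Y f n (trunc T N A) x).
- exact: (@cmap_d k U X Y f n A x).
- exact: esym (rhom_nat (f n) (tproj T N A) x).
- exact: (qf (trunc T N A)).
- exact: (qf A).
Qed.

Lemma trunc_cone_functorial N : functorial (@trunc_cone_map N).
Proof.
split=> [X n A [x y] //|//|X Y f g fg n A [x y]].
by congr pair; exact: fg.
Qed.

(** The cones C_N of the truncation maps are acyclic at any given group for N large, so their sum is
    their product in D(U) and the canonical maps X -> C_N assemble to a map into the sum. Smallness
    makes one of them zero, which forces that C_N to be acyclic. *)
Lemma small_tr X : small X -> exists N, tr T N X.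
Proof.
move=> sX; pose C N := trunc_cone N X.
have aC A : exists N, forall i, (N <= i)%N -> acyc A (C i).
  have [N NP] := tproj_large T A; exists N => i Ni.
  have ti := tproj_mono Ni NP; have [h1 h2] := hiso_res_inj X ti.
  move=> n [x y] [/= dx e].
  have {}dx : cd X (n - 1 - 1) (trunc T i A) x = 0 by rewrite -[LHS]opprK dx oppr0.
  have [|u uE] := h1 _ _ dx.
    by exists (- y); rewrite linearN; apply/eqP; rewrite -addr_eq0; apply/eqP; exact: e.
  have [|w dw [v vE]] := h2 n (y + res _ (tproj T i A) u).
    by rewrite (linearD (cd X (n - 1) A)) (rhom_nat (cd X (n - 1))) -uE -e; exact: addrC.
  exists (w - u, v); congr pair.
    by rewrite /= linearB dw sub0r opprK.
  by rewrite /= -vE linearB; exact: addrBB'.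
have qC := csum_cprod_qi aC.
pose j N : cmap X (C N) := cone_in (trunc_in T N X).
have [s es] := sX _ C (DComp (DInv qC) (DMap (cprod_tuple j))).
have [N Ns] : exists N, ~ List.In N s.
  exists (foldr maxn 0%N s).+1 => Ns.
  suff H i : List.In i s -> (i <= foldr maxn 0 s)%N by have := H _ Ns; rewrite ltnn.
  by elim: s {es Ns} => //= a s IH [<-|/IH h]; rewrite leq_max ?leqnn ?h ?orbT.
have jN : deq (DMap (j N)) (dzero _ _).
  have -> : deq (DMap (j N)) (DComp (DMap (cprod_proj C N)) (DMap (cprod_tuple j))).
    by apply: deq_sym; apply: deq_mapE => n A x.
  rewrite -(deq_invr' qC (DMap (cprod_tuple j))) deq_compA.
  have -> : deq (DComp (DMap (cprod_proj C N)) (DMap (csum_cprod C)))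
      (DComp (DMap (csum_proj C N)) (DMap (csum_cut C s))).
    rewrite (deq_mapE (h := csum_proj C N)) //; apply: deq_sym; apply: deq_mapE.
    apply: csum_cmap_ext => i n A x.
    rewrite -[LHS]/(csum_proj C N n A (csum_cut C s n A (csum_in C i n A x))).
    rewrite -[RHS]/(csum_proj C N n A (csum_in C i n A x)).
    case: (pselect (List.In i s)) => is_.
      rewrite (csum_cut_in _ is_) linear0 csum_proj_ne // => iN; apply: Ns; by rewrite -iN.
    by rewrite (csum_cut_out _ is_).
  by rewrite -deq_compA es dzero_compr.
exists N; apply/trP/acyclic_cone_qi => A n [x y] dxy.
(* Applying the functor [trunc_cone] to the zero morphism [j N] gives a map from C_N to the
   truncation cone of C_N that is zero on homology. The boundary this provides is rearranged into
   one in C_N itself. *)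
have /deq_bdry b := dfun_deq (@trunc_cone_map_qi N) (trunc_cone_functorial N) jN.
have {b} := b n A (x, y) dxy.
rewrite (_ : trunc_cone_map _ (cmap_zero _ _) _ _ _ = 0) // subr0.
case=> [[[q1 q2] [r s']]] [/= e1 e2 e3 e4].
have {}e2 : x = - (res (X (n - 1 - 1)) (tproj T N (trunc T N A)) q1 + cd X (n - 1) (trunc T N A) q2) by exact: e2.
have {}e3 : res (X (n - 1 - 1)) (tmap T N (tproj T N A)) q1 - cd X (n - 1) (trunc T N A) r = 0 by exact: esym e3.
have {}e4 : y = res (X (n - 1)) (tproj T N A) q2 + (res (X (n - 1)) (tproj T N A) r + cd X n A s') by exact: e4.
(* The two evident maps from Q_N A to Q_N Q_N A coincide. *)
have e5 : res (X (n - 1 - 1)) (tproj T N (trunc T N A)) q1 = cd X (n - 1) (trunc T N A) r.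
  apply/eqP; rewrite -subr_eq0 -e3; apply/eqP; congr (_ - _); apply: res_ext => z.
  by have [z' <-] := epi_surj (tproj T N A) z; rewrite tmapE.
exists (q2 + r, s'); congr pair.
  have e6 : cd X (n - 1) (trunc T N A) (q2 + r) =
      cd X (n - 1) (trunc T N A) r + cd X (n - 1) (trunc T N A) q2.
    by rewrite linearD; exact: addrC.
  by rewrite e2 e5 -e6.
have e6 : res (X (n - 1)) (tproj T N A) (q2 + r) + cd X n A s' = y.
  by rewrite e4 linearD -addrA.
by rewrite -e6.
Qed.
End CompactTr.
Lemma lspanD (k : fieldType) (V : lmodType k) (S : V -> Prop) x y :
  lspan S x -> lspan S y -> lspan S (x + y).
Proof. by move=> sx sy; rewrite -[x]scale1r; exact: lspan_closed. Qed.

(** * Presheaves placed in a single degree *)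

Section Sphere.
Context (k : fieldType) (U : finGroupType -> Prop).
Implicit Types (X Y Z W : cpx k U) (A B C G : grp U) (n m : int) (F H : rep k U).

(** Summing over the proofs of n = m gives one copy of F in degree m and zero elsewhere, without
    case distinctions in types. *)
Program Definition sphere m F : cpx k U :=
  @Cpx k U (fun n => rep_dsum (fun _ : n = m => F)) (fun n => rhom_zero _ _) _.
Next Obligation. by []. Qed.

Definition sph m F n A (e : n = m) : {linear F A -> sphere m F n A} :=
  dsum_in (fun _ : n = m => F A) e.
Arguments sph m F n A e : clear implicits.

Lemma sph_ext m F n A (W : lmodType k) (f g : {linear sphere m F n A -> W}) :
  (forall e x, f (sph m F n A e x) = g (sph m F n A e x)) -> forall z, f z = g z.
Proof. exact: dsum_ext. Qed.

Lemma sphere_d m F n A z : cd (sphere m F) n A z = 0.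
Proof. by []. Qed.

Lemma sph_res m F n A B (a : epi A B) e x :
  res (sphere m F n) a (sph m F n B e x) = sph m F n A e (res F a x).
Proof. by rewrite [LHS]dsum_recE lcompE. Qed.

Definition sph_rec m F n A (W : lmodType k) (f : n = m -> {linear F A -> W}) :
  {linear sphere m F n A -> W} := dsum_rec f.

Lemma sph_recE m F n A (W : lmodType k) (f : n = m -> {linear F A -> W}) e x :
  sph_rec f (sph m F n A e x) = f e x.
Proof. exact: dsum_recE. Qed.

Lemma bdry_sphere m F n A z : bdry (sphere m F) n A z <-> z = 0.
Proof. by split=> [[w ->]//|->]; exact: bdry0. Qed.

Lemma sph_inj m F n A e x : sph m F n A e x = 0 -> x = 0.
Proof.
move=> h; have := congr1 (sph_rec (fun _ => idfun)) h.
by rewrite sph_recE linear0.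
Qed.

Lemma sphere_acyc m F A : acyc A (sphere m F) <-> forall x : F A, x = 0.
Proof.
split=> [a x|h n z _].
  have [e [n E]] : exists e, exists n, n - 1 = m /\ e = tt by exists tt, (m + 1); rewrite addrK.
  case: E => E _; apply: (@sph_inj m F _ A E); apply/bdry_sphere.
  exact: a.
apply/bdry_sphere; move: z; apply: (@sph_ext m F _ A _ idfun \0) => e x.
by rewrite (h x) linear0.
Qed.

Definition sphere_map_at m F H (f : rhom F H) n A : {linear sphere m F n A -> sphere m H n A} :=
  sph_rec (fun e => lcomp (sph m H n A e) (f A)).

Lemma sphere_map_atE m F H (f : rhom F H) n A e x :
  sphere_map_at m f n A (sph m F n A e x) = sph m H n A e (f A x).
Proof. by rewrite /sphere_map_at sph_recE lcompE. Qed.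

Program Definition sphere_map m F H (f : rhom F H) : cmap (sphere m F) (sphere m H) :=
  @CMap k U (sphere m F) (sphere m H) (fun n => @RHom k U (sphere m F n) (sphere m H n)
    (sphere_map_at m f n) _) _.
Next Obligation.
move=> m F H f n A B a.
apply: (@sph_ext m F n B _ (lcomp (sphere_map_at m f n A) (res (sphere m F n) a)) (lcomp (res (sphere m H n) a) (sphere_map_at m f n B))) => e x.
by rewrite lcompE sph_res sphere_map_atE lcompE sphere_map_atE sph_res rhom_nat.
Qed.
Next Obligation. by move=> m F H f n A x; rewrite sphere_d linear0. Qed.

Lemma sphere_mapE m F H (f : rhom F H) n A e x :
  sphere_map m f n A (sph m F n A e x) = sph m H n A e (f A x).
Proof. exact: sphere_map_atE. Qed.

Lemma int_succ_eq n m : n - 1 = m -> n = m + 1.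
Proof. by move=> <-; rewrite subrK. Qed.

Lemma int_pred_eq n m : n = m + 1 -> n - 1 = m.
Proof. by move=> ->; rewrite addrK. Qed.

Definition sphere_shift_at m F n A : {linear sphere (m + 1) F n A -> shift (sphere m F) n A} :=
  sph_rec (fun e => sph m F (n - 1) A (int_pred_eq e)).

Lemma sphere_shift_atE m F n A e e' x :
  sphere_shift_at m F n A (sph (m + 1) F n A e x) = sph m F (n - 1) A e' x.
Proof.
rewrite /sphere_shift_at sph_recE; congr (sph _ _ _ _ _ _); exact: Prop_irrelevance.
Qed.

Program Definition sphere_shift m F : cmap (sphere (m + 1) F) (shift (sphere m F)) :=
  @CMap k U (sphere (m + 1) F) (shift (sphere m F)) (fun n => @RHom k U (sphere (m + 1) F n) (shift (sphere m F) n)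
    (sphere_shift_at m F n) _) _.
Next Obligation.
move=> m F n A B a.
apply: (@sph_ext (m + 1) F n B _ (lcomp (sphere_shift_at m F n A) (res (sphere (m + 1) F n) a)) (lcomp (res (sphere m F (n - 1)) a) (sphere_shift_at m F n B))) => e x.
by rewrite lcompE sph_res lcompE !(@sphere_shift_atE m F n _ e (int_pred_eq e)) sph_res.
Qed.
Next Obligation. by move=> m F n A x; rewrite sphere_d linear0 /= oppr0. Qed.

Lemma sphere_shift_qi m F : quasi_iso (sphere_shift m F).
Proof.
apply/qi_hiso => A.
pose g n : {linear shift (sphere m F) n A -> sphere (m + 1) F n A} :=
  sph_rec (fun e => sph (m + 1) F n A (int_succ_eq e)).
have gE n e x : g n (sph m F (n - 1) A e x) = sph (m + 1) F n A (int_succ_eq e) x by exact: sph_recE.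
apply: (@hiso_bij k U A A (sphere (m + 1) F) (shift (sphere m F)) (fun n => sphere_shift m F n A) g) => [n x|n|n].
- by rewrite -[cd (shift _) n A x]/(- (0 : sphere m F (n - 1 - 1) A)) oppr0 linear0.
- apply: (@sph_ext (m + 1) F n A _ (lcomp (g n) (sphere_shift_at m F n A)) idfun) => e x.
  rewrite lcompE (@sphere_shift_atE m F n A e (int_pred_eq e)) gE; congr (sph _ _ _ _ _ _); exact: Prop_irrelevance.
- apply: (@sph_ext m F (n - 1) A _ (lcomp (sphere_shift_at m F n A) (g n)) idfun) => e x.
  by rewrite lcompE gE (@sphere_shift_atE m F n A _ e).
Qed.

End Sphere.
#[global] Arguments sph {k U} m F n A e.

(** * Coinduced presheaves, and why compact objects have finite homology *)

Section Coinduced.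
Context (k : fieldType) (U : finGroupType -> Prop) (T : truncation U) (G : grp U).
Implicit Types (X Y Z W : cpx k U) (A B C : grp U) (n m : int).

Lemma coind_res_linear A B (e : epi A B) :
  linear ((fun f => [ffun g : epi G A => f (epi_comp e g)]) : {ffun epi G B -> k^o} -> {ffun epi G A -> k^o}).
Proof. by move=> c f g; apply/ffunP => a; rewrite !ffunE. Qed.

(** By the Yoneda argument a morphism from F to this object is a linear form on F(G). It is defined
    on conjugacy classes since [T] makes conjugate epimorphisms equal. *)
Program Definition coind : rep k U :=
  @Rep k U (fun A => {ffun epi G A -> k^o}) (fun A B e => mklin (coind_res_linear e)) _ _ _.
Next Obligation. by move=> A f; apply/ffunP => g; rewrite ffunE; congr (f _); exact: epi_ext. Qed.
Next Obligation. by move=> A B C g f h; apply/ffunP => a; rewrite !ffunE; congr (h _); exact: epi_ext. Qed.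
Next Obligation.
move=> A B f g x fg; apply/ffunP => a; rewrite !ffunE; congr (x _); apply: epi_ext => y.
exact: (epi_conj_eq T fg).
Qed.

Definition coind_delta A (g : epi G A) : coind A := [ffun a => (a == g)%:R : k^o].

Lemma coind_delta_res A B (e : epi A B) (g : epi G B) :
  res coind e (coind_delta g) = \sum_(a | epi_comp e a == g) coind_delta a.
Proof.
apply/ffunP => b; rewrite !ffunE sum_ffunE.
have [eb|eb] := eqVneq (epi_comp e b) g.
  rewrite (bigD1 b) ?eb //= ffunE eqxx big1 ?addr0 // => a /andP[_ ab].
  by rewrite ffunE eq_sym (negPf ab).
rewrite big1 // => a /eqP ea; rewrite ffunE; case: eqVneq => // ba.
by rewrite ba ea eqxx in eb.
Qed.

(** X is mapped to a sum of coinduced objects indexed by the vectors of X at G, in such a way that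
    evaluation at the identity of G writes [harm x] as a combination of the indices. Smallness
    leaves finitely many indices, and these span the homology. *)
Lemma small_fin X : small X -> fin G X.
Proof.
move=> sX.
pose I := {n : int & X (n - 1) G}.
pose Y (i : I) := sphere (projT1 i - 1) coind.
(* The free space on the vectors at G. A linear section of [p n] expresses each vector by finitely
   many indices, which keeps the map inside the direct sum. *)
pose V n := dsum (fun _ : X (n - 1) G => k^o : lmodType k).
have scl n (v : X (n - 1) G) : linear ((fun c : k^o => c *: v) : k^o -> X (n - 1) G).
  by move=> c a b; rewrite scalerDl scalerA.
pose p n : {linear V n -> X (n - 1) G} := dsum_rec (fun v => mklin (scl n v)).
have pE n v c : p n (dsum_in _ v c) = c *: v by rewrite /p dsum_recE.
pose sg n := sval (cid (ginv_ex (p n))).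
have psg n x : p n (sg n x) = x.
  have := svalP (cid (ginv_ex (p n))) (dsum_in (fun _ => k^o : lmodType k) x 1).
  by rewrite pE scale1r.
have kl n A (g : epi G A) (v : X (n - 1) G) :
    linear ((fun c : k^o => csum_in Y (existT _ n v) (n - 1) A
      (sph (n - 1) coind (n - 1) A erefl (c *: coind_delta g))) : k^o -> csum Y (n - 1) A).
  by move=> c a b; rewrite scalerDl -scalerA !linearP.
pose ka n A (g : epi G A) : {linear V n -> csum Y (n - 1) A} := dsum_rec (fun v => mklin (kl n A g v)).
have kaE n A (g : epi G A) v c : ka n A g (dsum_in _ v c) = csum_in Y (existT _ n v) (n - 1) A
      (sph (n - 1) coind (n - 1) A erefl (c *: coind_delta g)) by rewrite /ka dsum_recE.
have ka_res n A B (e : epi A B) (g : epi G B) z :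
    res (csum Y (n - 1)) e (ka n B g z) = \sum_(a | epi_comp e a == g) ka n A a z.
  have l : linear (fun z => \sum_(a | epi_comp e a == g) ka n A a z).
    by move=> c x y; rewrite scaler_sumr -big_split; apply: eq_bigr => a _; rewrite linearP.
  move: z; apply: (dsum_ext (f := lcomp (res (csum Y (n - 1)) e) (ka n B g)) (g := mklin l)) => v c.
  rewrite lcompE kaE /= -(rhom_nat (csum_in Y _ _)) sph_res linearZ_LR coind_delta_res scaler_sumr !linear_sum.
  by apply: eq_bigr => a _; rewrite -kaE.
(* [harm] makes the map vanish on boundaries, as a chain map to a complex with zero differential
   must. *)
have fl n A : linear ((fun x => \sum_(g : epi G A) ka n A g (sg n (harm X G n (res _ g x)))) : X (n - 1) A -> csum Y (n - 1) A).
  by move=> c x y; rewrite scaler_sumr -big_split; apply: eq_bigr => a _; rewrite !linearP.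
have fn n A B (e : epi A B) x : mklin (fl n A) (res _ e x) = res (csum Y (n - 1)) e (mklin (fl n B) x).
  change (\sum_(g : epi G A) ka n A g (sg n (harm X G n (res (X (n - 1)) g (res (X (n - 1)) e x)))) =
    res (csum Y (n - 1)) e (\sum_(g : epi G B) ka n B g (sg n (harm X G n (res (X (n - 1)) g x))))).
  rewrite linear_sum (partition_big (fun a => epi_comp e a) xpredT) //=.
  apply: eq_bigr => g _; rewrite ka_res; apply: eq_bigr => a /eqP <-.
  by rewrite res_comp.
have [f fE] := @int_pred_ex (fun n => rhom (X n) (csum Y n)) (fun n => RHom (fn n)).
have d0 n A z : cd (csum Y) n A z = 0.
  by move: z; apply: (csum_ext (f := cd (csum Y) n A) (g := \0)) => i y; rewrite -cmap_d sphere_d linear0.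
have fP n A x : f (n - 1) A (cd X n A x) = cd (csum Y) n A (f n A x).
  rewrite d0 fE -[LHS]/(\sum_(g : epi G A) ka n A g (sg n (harm X G n (res (X (n - 1)) g (cd X n A x))))).
  by rewrite big1 // => g _; rewrite -(rhom_nat (cd X n)) harm_cd !linear0.
have [s /=] := sX _ _ (DMap (CMap fP)); rewrite -deq_mapM => es.
have [t ut st] := nodup_seq s.
exists t => n x dx; exists (harm X G n x); last exact: harm_bdry.
have cut0 : csum_cut Y s (n - 1) G (f (n - 1) G x) = 0.
  have [w] := deq_bdry es dx; rewrite d0 subr0; exact.
have evl : linear ((fun h => h (epi_id G)) : {ffun epi G G -> k^o} -> k^o).
  by move=> c a b; rewrite !ffunE.
pose W (i : I) (e : n - 1 = projT1 i - 1) : X (n - 1) G :=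
  eq_rect (projT1 i - 1) (fun m => X m G) (projT2 i) (n - 1) (esym e).
have thl (i : I) (e : n - 1 = projT1 i - 1) : linear ((fun h => h (epi_id G) *: W i e) : {ffun epi G G -> k^o} -> X (n - 1) G).
  by move=> c a b; rewrite !ffunE scalerDl scalerA.
(* Evaluates functions at the identity of G and replaces each index by the vector it names. *)
pose th : {linear csum Y (n - 1) G -> X (n - 1) G} :=
  dsum_rec (fun i : I => sph_rec (m := projT1 i - 1) (F := coind) (A := G) (fun e => mklin (thl i e) : {linear coind G -> X (n - 1) G})).
have thE (i : I) e h : th (csum_in Y i (n - 1) G (sph (projT1 i - 1) coind (n - 1) G e h)) = h (epi_id G) *: W i e.
  by rewrite /th [LHS]dsum_recE sph_recE.
have thf : th (f (n - 1) G x) = harm X G n x.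
  rewrite fE -[LHS]/(th (\sum_(g : epi G G) ka n G g (sg n (harm X G n (res (X (n - 1)) g x))))) linear_sum.
  have thk g z : th (ka n G g z) = (epi_id G == g)%:R *: p n z.
    move: z; apply: (dsum_ext (f := lcomp th (ka n G g)) (g := (epi_id G == g)%:R \*: p n)) => v c.
    rewrite lcompE kaE thE -[RHS]/(_ *: p n _) pE /W /=.
    by rewrite ffunE scalerA mulrC -scalerA ffunE scalerA.
  rewrite (bigD1 (epi_id G)) //= big1 ?addr0 => [|g /negPf ng].
    by rewrite thk eqxx scale1r psg res_id.
  by rewrite thk eq_sym ng scale0r.
rewrite -thf.
have partE : csum_part Y t (n - 1) G (f (n - 1) G x) = f (n - 1) G x.
  have e : csum_part Y t (n - 1) G (f (n - 1) G x) + csum_cut Y t (n - 1) G (f (n - 1) G x) =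
    f (n - 1) G x by exact: csum_part_cut.
  by rewrite -[RHS]e -(csum_cut_sub _ st) cut0 linear0 addr0.
rewrite -partE; elim: t {ut st partE} (f (n - 1) G x) => [|i t IH] z.
  by rewrite [csum_part _ _ _ _ _](_ : _ = 0) // linear0; exact: lspan0.
rewrite csum_part_cons linearD -[th (csum_in _ _ _ _ _)]scale1r; apply: lspan_closed; last first.
  by apply: (lspan_map (f := idfun) _ (IH z)) => y yt; apply: lspan_in; right.
move: (csum_proj Y i (n - 1) G z); apply: pres_ind => [[e h]||w Tw|v w Tv Tw|c v Tv].
- rewrite -[pgen _ _]/(sph (projT1 i - 1) coind (n - 1) G e h) thE; apply: lspanZ; apply: lspan_in; left.
  rewrite /W; case: i e => m v /= e; have nm : m = n by apply: (addIr (-1)); rewrite -[RHS]/(n - 1) e.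
  case: n / nm e {thf IH z dx cut0 W thl th thE x} => e.
  by rewrite (Prop_irrelevance (esym e) erefl).
- by rewrite !linear0; exact: lspan0.
- by rewrite !linearN -scaleN1r; exact: lspanZ.
- by rewrite !linearD; exact: lspanD.
- by rewrite !linearZ_LR; exact: lspanZ.
Qed.
End Coinduced.
(** * Prime ideals *)
Section Primes.
Context (k : fieldType) (U : finGroupType -> Prop) (T : truncation U).
Hypothesis (k0 : [pchar k]%R =i pred0).
Implicit Types (X Y Z W : cpx k U) (A B C G : grp U) (n m : int) (N M : nat).

Lemma compactP X : compact_obj X <-> (exists N, tr T N X) /\ forall A, fin A X.
Proof.
split=> [/compact_small sX|[[N tX] fX]].
  by split; [exact: small_tr|move=> A; exact: (small_fin T)].
by apply/compact_small; exact: (tr_small k0 tX fX).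
Qed.

Lemma compact_cone X Y (f : cmap X Y) :
  compact_obj X -> compact_obj Y -> compact_obj (cone f).
Proof.
move=> /compactP[[N tX] fX] /compactP[[M tY] fY]; apply/compactP; split.
  exists (maxn N M); apply: tr_cone; first exact: tr_mono (leq_maxl _ _) tX.
  exact: tr_mono (leq_maxr _ _) tY.
by move=> A; exact: fin_cone.
Qed.

Lemma compact_ctens X Y : compact_obj X -> compact_obj Y -> compact_obj (ctens X Y).
Proof.
move=> /compactP[[N tX] fX] /compactP[[M tY] fY]; apply/compactP; split.
  exists (maxn N M); apply: tr_ctens; first exact: tr_mono (leq_maxl _ _) tX.
  exact: tr_mono (leq_maxr _ _) tY.
by move=> A; exact: fin_ctens.
Qed.

Lemma compact_acyclic X : (forall A, acyc A X) -> compact_obj X.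
Proof. by move=> aX; apply/compact_small/acyclic_small => n A; exact: aX. Qed.

Lemma compact_retract X Y (i : dhom X Y) (q : dhom Y X) :
  deq (DComp q i) (did X) -> compact_obj Y -> compact_obj X.
Proof.
move=> qi /compact_small sY; apply/compact_small => I Z f.
have [s es] := sY I Z (DComp f q); exists s.
by rewrite -(deq_idr f) -qi !deq_compA -(deq_compA _ f) es dzero_compl.
Qed.

(** A cycle x is related to itself through some cycle of Y. As Y is acyclic that cycle may be
    replaced by 0, and then x is related to 0. *)
Lemma acyc_retract X Y (i : dhom X Y) (q : dhom Y X) A :
  deq (DComp q i) (did X) -> acyc A Y -> acyc A X.
Proof.
move=> qi aY n x dx.
have : hrel (did X) x x by rewrite /= subrr; exact: bdry0.
move/(hrel_deq qi dx dx) => [y [dy hi hq]].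
have b0 : bdry X n A (0 - 0) by rewrite subrr; exact: bdry0.
have h0 : hrel q 0 x.
  apply: hrel_bdry hq; first by rewrite subr0; exact: aY.
  by rewrite subrr; exact: bdry0.
have : hrel (DComp q (dzero X Y)) 0 x.
  exists 0; split=> //; first exact: linear0.
  by rewrite /= subr0; exact: bdry0.
move/(hrel_deq (dzero_compr X q) (linear0 _) dx).
by rewrite /= subr0.
Qed.

Lemma shift_bdry X n A x : bdry (shift X) n A x <-> bdry X (n - 1) A x.
Proof.
by split=> -[w wE]; exists (- w); rewrite ?linearN; [exact: wE|rewrite [cd _ _ _ _]/= opprK].
Qed.

Lemma shift_cycle X n A x : cd (shift X) n A x = 0 <-> cd X (n - 1) A x = 0.
Proof.
rewrite -[cd (shift X) n A x]/(- (cd X (n - 1) A x)).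
by split=> [/eqP|->]; rewrite ?oppr0 // oppr_eq0 => /eqP.
Qed.

Lemma acyc_shift X A : acyc A (shift X) <-> acyc A X.
Proof.
split=> aX.
  apply: int_pred_ind => n x dx; apply/shift_bdry/aX; exact/shift_cycle.
by move=> n x /shift_cycle dx; apply/shift_bdry/aX.
Qed.

Lemma tr_shift N X : tr T N (shift X) <-> tr T N X.
Proof.
split=> tX A; have [i q] := tX A.
  split; apply: int_pred_ind => n x dx.
    by move=> /shift_bdry b; apply/shift_bdry/i => //; exact/shift_cycle.
  have [|z /shift_cycle dz /shift_bdry b] := q n x; first exact/shift_cycle.
  by exists z.
split=> n x /shift_cycle dx.
  by move=> /shift_bdry b; apply/shift_bdry/i.
by have [z dz b] := q _ x dx; exists z; [exact/shift_cycle|exact/shift_bdry].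
Qed.

Lemma fin_shift X A : fin A (shift X) <-> fin A X.
Proof.
split=> /fin_degreewise[D DP]; apply/fin_degreewise.
  exists (map (fun n => n - 1) D); apply: int_pred_ind => n; have [s [s0 sP]] := DP n.
  exists s; split=> [nD|x dx].
    by apply: s0; apply: contra nD => nD; apply/mapP; exists n.
  by have [|y ys b] := sP x; [exact/shift_cycle|exists y => //; exact/shift_bdry].
exists (map (fun n => n + 1) D) => n; have [s [s0 sP]] := DP (n - 1).
exists s; split=> [nD|x /shift_cycle dx].
  by apply: s0; apply: contra nD => nD; apply/mapP; exists (n - 1) => //; rewrite subrK.
by have [y ys b] := sP x dx; exists y => //; exact/shift_bdry.
Qed.

Lemma compact_shift X : compact_obj (shift X) <-> compact_obj X.
Proof.
rewrite !compactP; split=> -[[N tX] fX]; split; try by move=> A; exact/fin_shift.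
  by exists N; exact/tr_shift.
by exists N; exact/tr_shift.
Qed.

Definition coherent (v : nat -> grp U) : Prop :=
  (forall N, tors T N (v N)) /\
  forall N M, (N <= M)%N -> exists e : epi (trunc T N (v M)) (v N), injective e.

Definition prime_at (v : nat -> grp U) X : Prop :=
  compact_obj X /\ exists N, forall M, (N <= M)%N -> acyc (v M) X.

(** Q_N (v M) is v N, so truncation carries acyclicity from one group to the other. *)
Lemma acyc_coherent v N M X : coherent v -> (N <= M)%N -> tr T N X ->
  (acyc (v M) X <-> acyc (v N) X).
Proof.
case=> _ cv NM tX; have [e ei] := cv N M NM.
by rewrite -(tr_acyc _ tX) -(acyc_inj X ei).
Qed.

Lemma prime_atP v N X : coherent v -> tr T N X -> compact_obj X ->
  (prime_at v X <-> acyc (v N) X).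
Proof.
move=> cv tX cX; split=> [[_ [M aM]]|aX].
  by apply/(acyc_coherent cv (leq_maxl N M) tX)/aM; exact: leq_maxr.
by split=> //; exists N => M NM; apply/(acyc_coherent cv NM tX).
Qed.

Definition zero_cpx : cpx k U := csum (fun x : void => match x with end).

Lemma zero_cpx_acyc A : acyc A zero_cpx.
Proof.
move=> n x _; suff -> : x = 0 by exact: bdry0.
by move: x; apply: (csum_ext (f := idfun) (g := \0)) => -[].
Qed.

Definition unit_cpx : cpx k U := sphere 0 (const_rep U (k^o : lmodType k)).

Lemma unit_cpx_acyc A : ~ acyc A unit_cpx.
Proof. by move/sphere_acyc/(_ 1)/eqP; rewrite oner_eq0. Qed.

Lemma fin_sphere m (F : rep k U) A (s : seq (F A)) :
  (forall x, lspan (fun y => List.In y s) x) -> fin A (sphere m F).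
Proof.
move=> sP; apply/fin_degreewise; exists [:: m + 1] => n.
case: (pselect (n - 1 = m)) => [e|ne]; last first.
  exists [::]; split=> // x _; exists 0; first exact: lspan0.
  rewrite subr0; suff -> : x = 0 by exact: bdry0.
  by move: x; apply: (@sph_ext k U m F _ A _ idfun \0) => e; case: ne.
exists (map (sph m F (n - 1) A e) s); split.
  by move=> nD; case/negP: nD; rewrite inE; apply/eqP; rewrite -e subrK.
move=> z _; exists z; last by rewrite subrr; exact: bdry0.
move: z; apply: pres_ind => [[e' x]||w Tw|v w Tv Tw|c v Tv].
- rewrite -[pgen _ _]/(sph m F (n - 1) A e' x) (Prop_irrelevance e' e).
  apply: lspan_map (sP x) => y ys; apply: lspan_in; exact: List.in_map.
- exact: lspan0.
- by rewrite -scaleN1r; exact: lspanZ.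
- exact: lspanD.
- exact: lspanZ.
Qed.

Lemma tr_sphere N m (F : rep k U) :
  (forall A, exists g : {linear F A -> F (trunc T N A)},
    cancel (res F (tproj T N A)) g /\ cancel g (res F (tproj T N A))) ->
  tr T N (sphere m F).
Proof.
move=> FP A; have [g [fg gf]] := FP A.
pose h n : {linear sphere m F n A -> sphere m F n (trunc T N A)} :=
  sph_rec (fun e => lcomp (sph m F n _ e) g).
have hE n e x : h n (sph m F n A e x) = sph m F n _ e (g x) by rewrite /h sph_recE lcompE.
apply: (@hiso_bij k U _ _ (sphere m F) (sphere m F) _ h) => n.
- by move=> x; rewrite !sphere_d linear0.
- apply: (@sph_ext k U m F n _ _ (lcomp (h n) (res (sphere m F n) (tproj T N A))) idfun) => e x.
  by rewrite lcompE sph_res hE fg.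
- apply: (@sph_ext k U m F n _ _ (lcomp (res (sphere m F n) (tproj T N A)) (h n)) idfun) => e x.
  by rewrite lcompE hE sph_res gf.
Qed.

Lemma unit_cpx_compact : compact_obj unit_cpx.
Proof.
apply/compactP; split=> [|A].
  by exists 0%N; apply: tr_sphere => A; exists idfun.
apply: (@fin_sphere 0 (const_rep U (k^o : lmodType k)) A [:: (1 : k^o)]) => x.
by rewrite -[x]mulr1; apply: lspanZ; apply: lspan_in; left.
Qed.

Lemma prime_at_prime v : coherent v -> prime_ideal (prime_at v).
Proof.
move=> cv.
have alt X : compact_obj X -> exists N, (prime_at v X <-> acyc (v N) X) /\ tr T N X.
  by move=> cX; have /compactP[[N tX] _] := cX; exists N; split=> //; exact: prime_atP.
have ret X Y (i : dhom X Y) (q : dhom Y X) : deq (DComp q i) (did X) -> prime_at v Y -> prime_at v X.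
  move=> e [cY [N aY]]; split; first exact: compact_retract e cY.
  by exists N => M NM; apply: acyc_retract e (aY M NM).
have shiftP X : prime_at v (shift X) <-> prime_at v X.
  split=> -[cX [N aX]]; (split; first exact/compact_shift); exists N => M NM;
  exact/acyc_shift/aX.
split.
- by move=> X [].
- exists zero_cpx; split; first exact/compact_acyclic/zero_cpx_acyc.
  by exists 0%N => M _; exact: zero_cpx_acyc.
- exact: shiftP.
- move=> X Y Z u w t [X' [Y' [f [a [b [c [[[a' a1 a2] [b' b1 b2] [c' c1 c2]] _]]]]]]] PX PY.
  have PX' : prime_at v X' := ret _ _ _ _ a2 PX.
  have PY' : prime_at v Y' := ret _ _ _ _ b2 PY.
  apply: ret c1 _; case: PX' PY' => cX [N aX] [cY [M aY]].
  split; first exact: compact_cone.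
  exists (maxn N M) => L; rewrite geq_max => /andP[NL ML].
  by apply: acyc_cone; [exact: aX|exact: aY].
- exact: ret.
- move=> X Y [cX [N aX]] cY; split; first exact: compact_ctens.
  by exists N => M NM; apply/acyc_ctensP; left; exact: aX.
- exists unit_cpx; first exact: unit_cpx_compact.
  by case=> _ [N aN]; exact: unit_cpx_acyc (aN N (leqnn N)).
(* Primality holds at a single group, by [acyc_ctensP]; an index beyond all three bounds is used,
   and coherence leads back to the truncation level of each factor. *)
- move=> X Y cX cY [cXY [N aXY]].
  have [M [XM tX]] := alt X cX; have [L [YL tY]] := alt Y cY.
  pose K := maxn N (maxn M L).
  have := aXY K (leq_maxl _ _) => /acyc_ctensP[aX|aY]; [left|right].
    by apply/XM/(acyc_coherent cv (_ : M <= K)%N tX) => //; rewrite /K; lia.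
  by apply/YL/(acyc_coherent cv (_ : L <= K)%N tY) => //; rewrite /K; lia.
Qed.

Lemma shift_cone_linear X Y (f : cmap X Y) n A :
  linear ((fun y => ((0, y), 0)) : shift Y n A -> cone (cone_out f) n A).
Proof.
move=> c x y; congr pair; last by rewrite /= scaler0 addr0.
by congr pair; rewrite /= scaler0 addr0.
Qed.

Program Definition shift_cone X Y (f : cmap X Y) : cmap (shift Y) (cone (cone_out f)) :=
  @CMap k U (shift Y) (cone (cone_out f)) (fun n =>
    @RHom k U (shift Y n) (cone (cone_out f) n) (fun A => mklin (@shift_cone_linear X Y f n A)) _) _.
Next Obligation.
by move=> X Y f n A B e x; congr pair; [congr pair|]; rewrite /= linear0.
Qed.
Next Obligation.
move=> X Y f n A x; congr pair; last by rewrite /= !linear0 addr0.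
by congr pair; rewrite /= ?linear0 ?oppr0 ?add0r.
Qed.

(** Rotation of the triangle: [prime_triangle] only provides third vertices, and this identification
    is what lets the second one be recovered in [prime_cone_inv]. *)
Lemma shift_cone_qi X Y (f : cmap X Y) : quasi_iso (shift_cone f).
Proof.
apply: quasi_isoP => n A.
  move=> y dy [[[a b] c] [/= _ e2 e3]].
  have {}e3 : a = cd X (n - 1) A c by apply/eqP; rewrite -subr_eq0 -e3.
  exists (f _ A c + b); rewrite -[RHS]/(- cd Y (n - 1) A (f _ A c + b)).
  by rewrite e2 (linearD (cd Y (n - 1) A)) -cmap_d -e3.
move=> [[a b] c] [/= _ e2 e3].
have {}e3 : a = cd X (n - 1 - 1) A c by apply/eqP; rewrite -subr_eq0 -e3.
have {}e2 : f _ A a + cd Y (n - 1 - 1) A b = 0 by rewrite -[LHS]opprK e2 oppr0.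
exists (b + f _ A c).
  rewrite -[LHS]/(- cd Y (n - 1 - 1) A (b + f _ A c)) (linearD (cd Y (n - 1 - 1) A)) -cmap_d -e3.
  by rewrite (addrC (cd Y _ A b)) e2 oppr0.
have h1 : cd X (n - 1 - 1) A c = a by rewrite e3.
have h2 : - (f _ A c + cd Y (n - 1) A 0) = b - (b + f _ A c).
  by rewrite linear0 addr0 opprD addrA subrr add0r.
exists ((c, 0), 0); congr pair; last first.   by rewrite -[RHS]/(c - cd X (n - 1) A 0) linear0.
congr pair; first by rewrite /= opprK h1 subr0.
exact: esym h2.
Qed.

Section Closure.
Context (P : cpx k U -> Prop) (pP : prime_ideal P).

Lemma prime_qi X Y (s : cmap X Y) : quasi_iso s -> (P X <-> P Y).
Proof.
move=> q; split.
  exact: (prime_retract pP (i := DInv q) (q := DMap s) (deq_invr q)).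
exact: (prime_retract pP (i := DMap s) (q := DInv q) (deq_invl q)).
Qed.

Lemma prime_cmap_retract X Y (i : cmap X Y) (q : cmap Y X) :
  cmap_eq (cmap_comp q i) (cmap_id X) -> P Y -> P X.
Proof.
by move=> e; apply: (prime_retract pP (i := DMap i) (q := DMap q)); exact: deq_mapE.
Qed.

Lemma prime_acyclic X : (forall A, acyc A X) -> P X.
Proof.
move=> aX; have [Y PY] := prime_nonempty pP.
apply: (prime_retract pP (i := dzero X Y) (q := dzero Y X)) PY.
have -> : deq (did X) (dzero X X) by apply: acyclic_did => n A; exact: aX.
exact: dzero_compl.
Qed.

Lemma prime_cone X Y (f : cmap X Y) : P X -> P Y -> P (cone f).
Proof.
have idiso Z : diso (did Z) by exists (did Z); rewrite deq_idl.
apply: (prime_triangle pP (u := DMap f) (v := DMap (cone_in f)) (w := DMap (cone_out f))).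
exists X, Y, f, (did X), (did Y), (did (cone f)); split; first by split.
split; rewrite ?deq_idl ?deq_idr //.
by rewrite -{2}(deq_idl (DMap (cone_out f))); apply: deq_comp => //; apply: deq_map.
Qed.

Lemma prime_cone_inv X Y (f : cmap X Y) : P X -> P (cone f) -> P Y.
Proof.
move=> PX PC; apply/(prime_shift pP Y).
have /prime_cone/(_ ((prime_shift pP X).2 PX)) := PC.
move=> PC2; apply/(prime_qi (shift_cone_qi f)).
exact: PC2.
Qed.
End Closure.
End Primes.
(** * Complexes attached to partial presheaves *)
Section PartialPresheaves.
Context (k : fieldType) (U : finGroupType -> Prop) (T : truncation U).
Hypothesis (k0 : [pchar k]%R =i pred0).
Implicit Types (X Y Z W : cpx k U) (A B C D G : grp U) (n m : int) (N M : nat).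

(** Presheaves of pointed sets with the base point left out; linearization sends an undefined
    restriction to 0. By [pps_map_comp] a composite restriction is defined exactly when both steps
    are. *)
Record pps := Pps {
  pob :> grp U -> Type;
  pps_map : forall A B, epi A B -> pob B -> option (pob A);
  pps_map_id : forall A s, pps_map (epi_id A) s = Some s;
  pps_map_comp : forall A B C (g : epi B C) (f : epi A B) s,
    pps_map (epi_comp g f) s = obind (pps_map f) (pps_map g s)
}.

Section Lin.
Context (S : pps).

Definition lin_ob A : lmodType k := dsum (fun _ : S A => k^o : lmodType k).

Definition lg A (s : S A) : lin_ob A := dsum_in (fun _ : S A => k^o : lmodType k) s 1.

Lemma lgE A (s : S A) (c : k^o) : dsum_in (fun _ : S A => k^o : lmodType k) s c = c *: lg s.
Proof. by rewrite /lg -linearZ_LR; congr (dsum_in _ _ _); rewrite [RHS]mulr1. Qed.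

Lemma lin_ext A (W : lmodType k) (f g : {linear lin_ob A -> W}) :
  (forall s, f (lg s) = g (lg s)) -> forall z, f z = g z.
Proof. by move=> fg; apply: dsum_ext => s c; rewrite lgE !linearZ_LR fg. Qed.

Lemma lin_rec_linear (W : lmodType k) (w : W) : linear ((fun c : k^o => c *: w) : k^o -> W).
Proof. by move=> c a b; rewrite scalerDl scalerA. Qed.

Definition lin_rec A (W : lmodType k) (phi : S A -> W) : {linear lin_ob A -> W} :=
  dsum_rec (fun s => mklin (lin_rec_linear (phi s))).

Lemma lin_recE A (W : lmodType k) (phi : S A -> W) s : lin_rec phi (lg s) = phi s.
Proof. by rewrite /lin_rec [LHS]dsum_recE /= scale1r. Qed.

Definition lgo A (s : option (S A)) : lin_ob A := if s is Some s then lg s else 0.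

Definition lin_res A B (e : epi A B) : {linear lin_ob B -> lin_ob A} :=
  lin_rec (fun s => lgo (pps_map e s)).

Lemma lin_resE A B (e : epi A B) s : lin_res e (lg s) = lgo (pps_map e s).
Proof. exact: lin_recE. Qed.

Program Definition lin : rep k U := @Rep k U lin_ob lin_res _ _ _.
Next Obligation.
by move=> A; apply: (lin_ext (f := lin_res (epi_id A)) (g := idfun)) => s; rewrite lin_resE pps_map_id /=.
Qed.
Next Obligation.
move=> A B C g f; apply: (lin_ext (f := lin_res (epi_comp g f)) (g := lcomp (lin_res f) (lin_res g))) => s.
rewrite lcompE !lin_resE pps_map_comp; case: (pps_map g s) => [t|]; last exact/esym/(linear0 (lin_res f)).
exact/esym/lin_resE.
Qed.
Next Obligation.
move=> A B f g x fg; congr (lin_res _ x); apply: epi_ext; exact: (epi_conj_eq T fg).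
Qed.

Lemma lin_resE' A B (e : epi A B) s : res lin e (lg s) = lgo (pps_map e s).
Proof. exact: lin_recE. Qed.

Lemma lg_neq0 A (s : S A) : lg s <> 0.
Proof.
move/(congr1 (lin_rec (fun _ => 1 : k^o))); rewrite lin_recE linear0 => /eqP.
by rewrite oner_eq0.
Qed.

Lemma lin_acyc m A : acyc A (sphere m lin) <-> (S A -> False).
Proof.
rewrite sphere_acyc; split=> [h s|h]; first exact: (lg_neq0 (h (lg s))).
by apply: (lin_ext (f := idfun) (g := \0)) => s; case: (h s).
Qed.

Lemma lin_fin m A (l : list (S A)) : (forall s, List.In s l) -> fin A (sphere m lin).
Proof.
move=> lP; apply: (@fin_sphere k U m lin A (List.map (@lg A) l)) => x.
apply: pres_ind x => [[s c]||x sx|x y sx sy|c x sx].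
- rewrite -[pgen _ _]/(dsum_in (fun _ : S A => k^o : lmodType k) s c) lgE.
  by apply/lspanZ/lspan_in; exact: List.in_map.
- exact: lspan0.
- by rewrite -scaleN1r; exact: lspanZ.
- exact: lspanD.
- exact: lspanZ.
Qed.

Lemma lin_tr N m :
  (forall A, exists g : S A -> S (trunc T N A),
     (forall s, pps_map (tproj T N A) (g s) = Some s) /\
     forall s, exists2 s', pps_map (tproj T N A) s = Some s' & g s' = s) ->
  tr T N (sphere m lin).
Proof.
move=> SP; apply: tr_sphere => A; have [g [g1 g2]] := SP A.
pose h : {linear lin A -> lin (trunc T N A)} := lin_rec (fun s => lg (g s)).
have hE s : h (lg s) = lg (g s) by exact: lin_recE.
exists h; split.
  apply: (lin_ext (f := lcomp h (res lin (tproj T N A))) (g := idfun)) => s.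
  by rewrite lcompE lin_resE'; have [s' -> /= e] := g2 s; rewrite hE e.
apply: (lin_ext (f := lcomp (res lin (tproj T N A)) h) (g := idfun)) => s.
by rewrite lcompE hE lin_resE' g1.
Qed.
End Lin.

Section Convex.
Context (C : grp U -> Prop).
Hypothesis Cconv : forall A B D, epi A B -> epi B D -> C A -> C D -> C B.

Definition cmap_conv A B (_ : epi A B) (_ : C B) : option (C A) :=
  if pselect (C A) is left c then Some c else None.

Lemma cmap_convE A B (e : epi A B) b a : cmap_conv e b = Some a.
Proof.
by rewrite /cmap_conv; case: pselect => // a'; congr Some; exact: Prop_irrelevance.
Qed.

(** The one-point presheaf on C, extended by nothing. Convexity ensures that a restriction between
    members of C is not interrupted at an intermediate group. *)
Program Definition conv : pps := @Pps C cmap_conv _ _.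
Next Obligation. by move=> A s; exact: cmap_convE. Qed.
Next Obligation.
move=> A B D g f s; rewrite {1}/cmap_conv; case: pselect => [a|na].
  by rewrite (cmap_convE g s (Cconv f g a s)) /= (cmap_convE f _ a).
by case: (cmap_conv g s) => //= b; rewrite /cmap_conv; case: pselect.
Qed.

Lemma conv_tr N m : (forall A, C A <-> C (trunc T N A)) -> tr T N (sphere m (lin conv)).
Proof.
move=> CT; apply: lin_tr => A; exists (fun s => (CT A).1 s); split=> [s|s].
  exact: cmap_convE.
by exists ((CT A).2 s); [exact: cmap_convE|exact: (@Prop_irrelevance (C _))].
Qed.

Lemma conv_compact N m : (forall A, C A <-> C (trunc T N A)) -> compact_obj (sphere m (lin conv)).
Proof.
move=> CT; apply/(compactP T k0); split; first by exists N; exact: conv_tr.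
move=> A; case: (pselect (C A)) => [a|na].
  by apply: (@lin_fin conv m A (cons a nil)) => s; left; exact: (@Prop_irrelevance (C A)).
by apply: (@lin_fin conv m A nil) => s; case: na.
Qed.
End Convex.

Section Iso.
Context (N : nat) (G : grp U).

Definition iso_ob A := {f : epi (trunc T N A) G | injectiveb f}.

Definition mkiso A (f : epi (trunc T N A) G) (h : injectiveb f) : iso_ob A := exist _ f h.

Definition iso_map A B (e : epi A B) (f : iso_ob B) : option (iso_ob A) :=
  insub (epi_comp (val f) (tmap T N e)).

Lemma iso_mapE A B (e : epi A B) f (h : injectiveb (epi_comp (val f) (tmap T N e))) :
  iso_map e f = Some (mkiso h).
Proof. exact: (insubT (fun f : epi (trunc T N A) G => injectiveb f) h). Qed.

Lemma iso_pob_comp A B D (g : epi B D) (f : epi A B) s :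
  iso_map (epi_comp g f) s = obind (iso_map f) (iso_map g s).
Proof.
rewrite /iso_map; have e : epi_comp (val s) (tmap T N (epi_comp g f)) =
    epi_comp (epi_comp (val s) (tmap T N g)) (tmap T N f).
  by apply: epi_ext => x /=; rewrite tmap_comp.
case: (insubP _ (epi_comp (val s) (tmap T N g))) => [u iu uE|nu] /=; first by rewrite e uE.
(* If the whole composite is injective then so is its outer part, because [tmap T N f] is
   surjective. *)
rewrite insubF //; apply: contraNF nu => /injectiveP i; apply/injectiveP => x y xy.
have [x' x'E] := epi_surj (tmap T N f) x; have [y' y'E] := epi_surj (tmap T N f) y.
by rewrite -x'E -y'E; congr (tmap T N f _); apply: i; rewrite e /= x'E y'E.
Qed.

Program Definition iso_pps : pps := @Pps iso_ob iso_map _ iso_pob_comp.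
Next Obligation.
move=> A s; rewrite /iso_map (_ : epi_comp _ _ = val s) ?valK //.
by apply: epi_ext => x /=; rewrite tmap_id.
Qed.

Definition isoT A := exists f : epi (trunc T N A) G, injective f.

Lemma isoT_card A : isoT A -> #|trunc T N A| = #|G|.
Proof.
by case=> f fi; apply/eqP; rewrite eqn_leq (epi_card f) andbT; exact: leq_card fi.
Qed.

(** Orders of truncations decrease along epimorphisms and agree at both ends, so every map in
    between is an isomorphism. *)
Lemma isoT_conv A B D : epi A B -> epi B D -> isoT A -> isoT D -> isoT B.
Proof.
move=> e f iA iD; have cA := isoT_card iA; have cD := isoT_card iD.
have h1 := epi_card (tmap T N e); have h2 := epi_card (tmap T N f).
have [i [i1 i2]] : exists i : epi (trunc T N B) (trunc T N A), cancel (tmap T N e) i /\ cancel i (tmap T N e).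
  by apply: epi_inv_ex; apply: epi_card_inj; lia.
case: iA => g gi; exists (epi_comp g i) => x y /= /gi; exact: (can_inj i2).
Qed.

Lemma isoT_trunc A : isoT A <-> isoT (trunc T N A).
Proof.
have [i [i1 i2]] := epi_inv_ex (@tproj_trunc U T N A).
split=> -[f fi].
  by exists (epi_comp f i) => x y /= /fi; exact: (can_inj i2).
by exists (epi_comp f (tproj T N (trunc T N A))) => x y /= /fi; exact: tproj_trunc.
Qed.

Definition chi := conv isoT_conv.

Lemma chi_compact m : compact_obj (sphere m (lin chi)).
Proof. exact/conv_compact/isoT_trunc. Qed.

Lemma iso_tr m : tr T N (sphere m (lin iso_pps)).
Proof.
apply: lin_tr => A.
have tE x : tmap T N (tproj T N A) x = tproj T N (trunc T N A) x.
  by have [y <-] := epi_surj (tproj T N A) x; rewrite tmapE.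
have [i [i1 i2]] := epi_inv_ex (@tproj_trunc U T N A).
have gi (s : iso_ob A) : injectiveb (epi_comp (val s) i).
  apply/injectiveP => x y /= h; apply: (can_inj i2); by move/injectiveP: (valP s); apply.
exists (fun s => mkiso (gi s)); split=> s.
  rewrite /= /iso_map /=; have e : epi_comp (epi_comp (val s) i) (tmap T N (tproj T N A)) = val s.
    by apply: epi_ext => x /=; rewrite tE i1.
  by rewrite e valK.
have si : injectiveb (epi_comp (val s) (tmap T N (tproj T N A))).
  apply/injectiveP => x y /=; rewrite !tE => h; apply: (@tproj_trunc U T N A).
  by move/injectiveP: (valP s); apply.
exists (mkiso si).
  exact: iso_mapE.
by apply: val_inj; apply: epi_ext => x /=; rewrite tE i2.
Qed.

Lemma iso_compact m : compact_obj (sphere m (lin iso_pps)).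
Proof.
apply/(compactP T k0); split; first by exists N; exact: iso_tr.
move=> A; apply: (@lin_fin iso_pps m A (enum {: iso_ob A})) => s.
have : s \in enum {: iso_ob A} by rewrite mem_enum.
by elim: (enum _) => //= y t IH; rewrite inE => /orP[/eqP ->|/IH]; [left|right].
Qed.

(* [chi] is a retract of the linearized [iso_pps]: average over the isomorphisms. *)
Definition isoT_of A (f : iso_ob A) : chi A := ex_intro _ (val f) (elimT (injectiveP _) (valP f)).

Definition chi_out_at A : {linear lin iso_pps A -> lin chi A} :=
  lin_rec (S := iso_pps) (fun f : iso_ob A => lg (isoT_of f)).

Lemma chi_out_atE A f : chi_out_at A (lg (S := iso_pps) f) = lg (isoT_of f).
Proof. exact: lin_recE. Qed.

Program Definition chi_out : rhom (lin iso_pps) (lin chi) := @RHom k U _ _ chi_out_at _.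
Next Obligation.
move=> A B e; apply: (lin_ext (f := lcomp (chi_out_at A) (res (lin iso_pps) e)) (g := lcomp (res (lin chi) e) (chi_out_at B))) => s.
rewrite !lcompE chi_out_atE !lin_resE' -[pps_map e s]/(iso_map e s) -[pps_map e (isoT_of s)]/(cmap_conv e (isoT_of s)).
have [h|h] := boolP (injectiveb (epi_comp (val s) (tmap T N e))).
  by rewrite (iso_mapE h) (cmap_convE e _ (isoT_of (mkiso h))); exact: chi_out_atE.
(* If A were of type G, a surjection from its truncation onto G would be injective; so both sides
   vanish. *)
rewrite /iso_map insubF; last exact: negbTE.
rewrite linear0 /cmap_conv; case: pselect => // -[f fi]; case/negP: h.
apply/injectiveP; apply: epi_card_inj; have := leq_card f fi.
by have h := epi_card (epi_comp (val s) (tmap T N e)); move=> h2; apply: anti_leq; rewrite h h2.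
Qed.

Definition chi_in_at A : {linear lin chi A -> lin iso_pps A} :=
  lin_rec (S := chi) (fun _ => #|{: epi G G}|%:R^-1 *: \sum_(f : iso_ob A) lg (S := iso_pps) f).

Lemma chi_in_atE A s : chi_in_at A (lg (S := chi) s) =
  #|{: epi G G}|%:R^-1 *: \sum_(f : iso_ob A) lg (S := iso_pps) f.
Proof. exact: lin_recE. Qed.

Program Definition chi_in : rhom (lin chi) (lin iso_pps) := @RHom k U _ _ chi_in_at _.
Next Obligation.
move=> A B e; apply: (lin_ext (f := lcomp (chi_in_at A) (res (lin chi) e)) (g := lcomp (res (lin iso_pps) e) (chi_in_at B))) => s.
rewrite !lcompE chi_in_atE lin_resE' linearZ_LR linear_sum -[pps_map e s]/(cmap_conv e s).
under [in RHS]eq_bigr do rewrite lin_resE' -[pps_map e _]/(iso_map e _).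
case: (pselect (isoT A)) => [a|na]; last first.
  rewrite {1}/cmap_conv; case: pselect => // _; rewrite linear0 big1 ?scaler0 // => f _.
  rewrite /iso_map insubF //; apply/negP => /injectiveP fi; apply: na.
  by exists (epi_comp (val f) (tmap T N e)).
rewrite (cmap_convE e s a) [LHS]chi_in_atE; congr (_ *: _).
have ei : injective (tmap T N e).
  by apply: epi_card_inj; rewrite (isoT_card a) (isoT_card s).
have [i [i1 i2]] := epi_inv_ex ei.
have ci (f : iso_ob B) : injectiveb (epi_comp (val f) (tmap T N e)).
  by apply/injectiveP => x y /= h; apply: ei; move/injectiveP: (valP f); apply.
(* Composition with the isomorphism [tmap T N e] is a bijection between the isomorphisms for B and
   those for A. *)
rewrite (reindex (fun f : iso_ob B => mkiso (ci f))) /=.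
  by apply: eq_bigr => f _; rewrite (iso_mapE (ci f)).
have di (f : iso_ob A) : injectiveb (epi_comp (val f) i).
  by apply/injectiveP => x y /= h; apply: (can_inj i2); move/injectiveP: (valP f); apply.
by exists (fun f => mkiso (di f)) => f _; apply: val_inj; apply: epi_ext => x /=; rewrite ?i1 ?i2.
Qed.

Lemma chi_outK A z : chi_out A (chi_in A z) = z.
Proof.
move: z; apply: (lin_ext (f := lcomp (chi_out_at A) (chi_in_at A)) (g := idfun)) => s.
rewrite lcompE chi_in_atE linearZ_LR linear_sum.
rewrite (eq_bigr (fun _ => lg (S := chi) s)); last first.
  by move=> f _; rewrite [LHS]chi_out_atE; congr (lg _); exact: (@Prop_irrelevance (isoT A)).
rewrite sumr_const -scaler_nat scalerA.
(* One chosen isomorphism identifies all of them with the automorphisms of G, whence the normalizing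
   factor. *)
have -> : #|{: iso_ob A}| = #|{: epi G G}|.
  have [g gi] := s; have [i [i1 i2]] := epi_inv_ex gi.
  have ji (a : epi G G) : injectiveb (epi_comp a g).
    by apply/injectiveP => x y /= /(epi_card_inj erefl) /gi.
  apply: (bij_eq_card (f := fun f : iso_ob A => epi_comp (val f) i)).
  by exists (fun a => mkiso (ji a)) => f; [apply: val_inj|]; apply: epi_ext => x /=; rewrite ?i1 ?i2.
rewrite mulVf ?scale1r //; have /charf0P -> := k0; rewrite -lt0n.
by apply/card_gt0P; exists (epi_id G).
Qed.
End Iso.
End PartialPresheaves.

(** * Symmetry of the tensor product *)

Section TensorSwap.
Context (k : fieldType) (U : finGroupType -> Prop).
Implicit Types (X Y : cpx k U) (A B : grp U) (n : int).

Section Spaces.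
Context (V W : lmodType k).

Lemma tswapP a b : tens_rel a b ->
  leval (fun s : V * W => tpure s.2 s.1) a = leval (fun s : V * W => tpure s.2 s.1) b.
Proof. by case=> *; rewrite /= ?(tpureDl, tpureDr, tpureZl, tpureZr). Qed.

Definition tswap : {linear tens V W -> tens W V} := pres_rec tswapP.

Lemma tswapE x y : tswap (tpure x y) = tpure y x.
Proof. exact: (pres_recE tswapP). Qed.
End Spaces.

Lemma sgn_sqr (i : int) : (-1) ^ i * (-1) ^ i = 1 :> k.
Proof.
by rewrite -expfzMl mulrNN mulr1 exp1rz.
Qed.

Lemma sgnB (i j : int) : (-1) ^ (i - j) = (-1) ^ i * (-1) ^ j :> k.
Proof.
have e : i = (i - j) + j by rewrite subrK.
by rewrite {2}e [in RHS]expfzDr ?oppr_eq0 ?oner_eq0 // -[RHS]mulrA sgn_sqr mulr1.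
Qed.

Section Swap.
Context (X Y : cpx k U).

Lemma bidegCP n (t : bideg n) : ((sval t).2 + (sval t).1 == n)%R.
Proof. by case: t => -[i j] /= /eqP <-; rewrite addrC. Qed.

Definition bidegC n (t : bideg n) : bideg n := exist _ ((sval t).2, (sval t).1) (bidegCP t).

(** The Koszul sign makes the exchange of factors commute with the differentials. The exchange is
    needed because [prime_tens] keeps the member of the ideal on the left. *)
Definition ctens_swap_at n A : {linear ctens X Y n A -> ctens Y X n A} :=
  dsum_rec (fun t : bideg n => (-1) ^ ((sval t).1 * (sval t).2) \*:
    lcomp (dsum_in (fun t : bideg n => rep_tens (Y (sval t).1) (X (sval t).2) A) (bidegC t))
      (tswap (X (sval t).1 A) (Y (sval t).2 A))).

Lemma ctens_swap_atE n A (t : bideg n) x y : ctens_swap_at n A (tgen (t := t) x y) =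
  (-1) ^ ((sval t).1 * (sval t).2) *: tgen (t := bidegC t) y x.
Proof.
rewrite /ctens_swap_at /tgen dsum_recE -[LHS]/(_ *: lcomp _ _ _) lcompE.
by rewrite tswapE.
Qed.

Program Definition ctens_swap : cmap (ctens X Y) (ctens Y X) :=
  @CMap k U (ctens X Y) (ctens Y X) (fun n => @RHom k U (ctens X Y n) (ctens Y X n) (ctens_swap_at n) _) _.
Next Obligation.
move=> n A B e; apply: (@tens_d_ext k U X Y n B _ (lcomp (ctens_swap_at n A) (res (ctens X Y n) e))
  (lcomp (res (ctens Y X n) e) (ctens_swap_at n B))) => t x y.
by rewrite !lcompE res_tgen !ctens_swap_atE linearZ_LR; congr (_ *: _); exact/esym/res_tgen.
Qed.
Next Obligation.
move=> n A; apply: (@tens_d_ext k U X Y n A _ (lcomp (ctens_swap_at (n - 1) A) (cd (ctens X Y) n A))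
  (lcomp (cd (ctens Y X) n A) (ctens_swap_at n A))) => t x y.
rewrite !lcompE ctens_swap_atE [in RHS]linearZ_LR.
rewrite -[cd (ctens X Y) n A _]/(tens_d X Y n A _) -[cd (ctens Y X) n A _]/(tens_d Y X n A _) !tens_dE.
case: t x y => -[i j] ij x y; rewrite linearD linearZ_LR !ctens_swap_atE /=.
rewrite scalerDr !scalerA; etransitivity; first exact: addrC.
congr (_ + _).
  rewrite mulrBr mulr1 sgnB mulrCA sgn_sqr mulr1; congr (_ *: _); exact: (@tgen_irr k U Y X _ A (_, _)).
rewrite mulrBl mul1r sgnB; congr (_ *: _); exact: (@tgen_irr k U Y X _ A (_, _)).
Qed.
End Swap.

Lemma ctens_swapK X Y n A z : ctens_swap Y X n A (ctens_swap X Y n A z) = z.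
Proof.
move: z; apply: (@tens_d_ext k U X Y n A _ (lcomp (ctens_swap_at Y X n A) (ctens_swap_at X Y n A)) idfun) => t x y.
rewrite lcompE ctens_swap_atE linearZ_LR ctens_swap_atE scalerA /= [_ * (sval t).1]mulrC sgn_sqr scale1r.
case: t x y => -[i j] ij x y; exact: (@tgen_irr k U X Y _ A (_, _)).
Qed.
End TensorSwap.

(** * Tensor products with a presheaf in degree zero *)

Section SphereTensor.
Context (k : fieldType) (U : finGroupType -> Prop).
Implicit Types (X Y Z W : cpx k U) (A B C G : grp U) (n m : int) (F : rep k U).

Definition icast X A i j (e : i = j) : {linear X i A -> X j A} :=
  eq_rect i (fun l => {linear X i A -> X l A}) idfun j e.

Lemma icast_id X A i (e : i = i) y : icast X A e y = y.
Proof. by rewrite (Prop_irrelevance e erefl). Qed.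

Lemma bideg0P n : (0 + n == n)%R.
Proof. by rewrite add0r. Qed.

Definition bideg0 n : bideg n := exist _ (0, n) (bideg0P n).

Section Tens0.
Context (F : rep k U) (X : cpx k U).

Definition tg n A (u : F A) (y : X n A) : ctens (sphere 0 F) X n A :=
  tgen (t := bideg0 n) (sph 0 F 0 A erefl u) y.

Lemma tgDZl n A y : linear (fun u : F A => tg u y : ctens (sphere 0 F) X n A).
Proof. by move=> c u u'; rewrite /tg linearP /tgen tpureDl tpureZl linearP. Qed.

Lemma tgDZr n A u : linear (fun y : X n A => @tg n A u y).
Proof. by move=> c y y'; rewrite /tg /tgen tpureDr tpureZr linearP. Qed.

Lemma tgenDZl n A (t : bideg n) y :
  linear (fun x : sphere 0 F (sval t).1 A => tgen (Y := X) (t := t) x y).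
Proof. by move=> c u u'; rewrite /tgen tpureDl tpureZl linearP. Qed.

(** The sphere vanishes outside degree 0, so only generators of bidegree (0, n) remain. *)
Lemma tg_ext n A (W : lmodType k) (f g : {linear ctens (sphere 0 F) X n A -> W}) :
  (forall u y, f (tg u y) = g (tg u y)) -> forall z, f z = g z.
Proof.
move=> fg; apply: tens_d_ext => t x y.
move: x; have H := (@sph_ext k U 0 F _ A _ (lcomp f (mklin (tgenDZl y))) (lcomp g (mklin (tgenDZl y)))). apply: H => e u.
case: t e y => -[i j] ij /= e y; subst i.
have ej : j = n by rewrite -(eqP ij) add0r.
subst j; move: (fg u y); rewrite /tg /bideg0.
by rewrite (bool_irrelevance ij (bideg0P n)).
Qed.

Lemma tg_d n A u y : cd (ctens (sphere 0 F) X) n A (tg u y) = tg u (cd X n A y).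
Proof.
have el : 0 - 1 + n == n - 1 by rewrite add0r addrC.
have er : 0 + (n - 1) == n - 1 by rewrite add0r.
rewrite /tg (tens_dE' el er) sphere_d tgen0l add0r expr0z scale1r; exact: (@tgen_irr k U (sphere 0 F) X _ A (_, _)).
Qed.

Lemma tg_res n A B (g : epi A B) u y :
  res (ctens (sphere 0 F) X n) g (tg u y) = tg (res F g u) (res (X n) g y).
Proof. by rewrite /tg res_tgen sph_res. Qed.

Context (Z : cpx k U) (b : forall n A, X n A -> {linear F A -> Z n A}).
Hypothesis b_linear : forall n A u, linear (fun y : X n A => b y u).
Hypothesis b_res : forall n A B (g : epi A B) u y, b (res (X n) g y) (res F g u) = res (Z n) g (b y u).
Hypothesis b_d : forall n A u y, b (cd X n A y) u = cd Z n A (b y u).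

Lemma bideg_tail n (t : bideg n) : (sval t).1 = 0 -> (sval t).2 = n.
Proof. by case: t => -[i j] /= /eqP <- ->; rewrite add0r. Qed.

(** The pairing [b] extended by zero to all bidegrees: [sph_rec] supplies a proof that the first
    degree is 0, along which the second is moved to n. *)
Definition ten_pure n A (t : bideg n) (s : sphere 0 F (sval t).1 A * X (sval t).2 A) : Z n A :=
  sph_rec (fun e => b (icast X A (bideg_tail e) s.2)) s.1.

Lemma ten_pureDr n A (t : bideg n) c (x : sphere 0 F (sval t).1 A) y y' :
  ten_pure (t := t) (x, c *: y + y') = c *: ten_pure (t := t) (x, y) + ten_pure (t := t) (x, y').
Proof.
pose h y := sph_rec (m := 0) (F := F) (fun e => b (icast X A (bideg_tail (t := t) e) y)).
rewrite -[LHS]/(h _ x) -[RHS]/((c \*: h y \+ h y') x).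
have H := @sph_ext k U 0 F _ A _ (h (c *: y + y')) (c \*: h y \+ h y').
move: x; apply: H => e u.
by rewrite -[RHS]/(c *: h y _ + h y' _) !sph_recE linearP b_linear.
Qed.

Lemma ten_pureP n A (t : bideg n) a a' : tens_rel a a' ->
  leval (@ten_pure n A t) a = leval (@ten_pure n A t) a'.
Proof.
case=> [x x' y|x y y'|c x y|c x y] /=.
- exact: (linearD (sph_rec _)).
- by have := ten_pureDr 1 x y y'; rewrite !scale1r.
- exact: (linearZ_LR (sph_rec _)).
- have := ten_pureDr c x y 0; rewrite addr0 => ->.
  have := ten_pureDr 1 x 0 0; rewrite !scale1r addr0 => h.
  suff -> : ten_pure (t := t) (x, 0) = 0 by rewrite addr0.
  by apply: (addrI (ten_pure (t := t) (x, 0))); rewrite addr0 -h.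
Qed.

Definition ten_at n A : {linear ctens (sphere 0 F) X n A -> Z n A} :=
  dsum_rec (fun t : bideg n => pres_rec (@ten_pureP n A t)).

Lemma ten_atE n A u y : ten_at n A (tg u y) = b y u.
Proof.
rewrite /ten_at /tg /tgen dsum_recE [LHS]pres_recE [LHS]sph_recE.
by rewrite icast_id.
Qed.

Program Definition ten : cmap (ctens (sphere 0 F) X) Z :=
  @CMap k U (ctens (sphere 0 F) X) Z
    (fun n => @RHom k U (ctens (sphere 0 F) X n) (Z n) (ten_at n) _) _.
Next Obligation.
move=> n A B g; apply: (@tg_ext n B _ (lcomp (ten_at n A) (res (ctens (sphere 0 F) X n) g))
  (lcomp (res (Z n) g) (ten_at n B))) => u y.
by rewrite !lcompE tg_res !ten_atE b_res.
Qed.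
Next Obligation.
move=> n A; apply: (@tg_ext n A _ (lcomp (ten_at (n - 1) A) (cd (ctens (sphere 0 F) X) n A))
  (lcomp (cd Z n A) (ten_at n A))) => u y.
by rewrite !lcompE tg_d !ten_atE b_d.
Qed.

Lemma tenE n A u y : ten n A (tg u y) = b y u.
Proof. exact: ten_atE. Qed.
End Tens0.

Section UnitRetract.
Context (X : cpx k U).

Definition unit_in_at n A : {linear X n A -> ctens (unit_cpx k U) X n A} :=
  mklin (tgDZr (F := const_rep U (k^o : lmodType k)) (X := X) (n := n) (A := A) 1).

Program Definition unit_in : cmap X (ctens (unit_cpx k U) X) :=
  @CMap k U X (ctens (unit_cpx k U) X) (fun n => @RHom k U (X n) (ctens (unit_cpx k U) X n) (unit_in_at n) _) _.
Next Obligation. by move=> n A B g y; rewrite [RHS]tg_res. Qed.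
Next Obligation. by move=> n A y; rewrite [RHS]tg_d. Qed.

Lemma unit_act_linear n A (y : X n A) : linear (fun u : k^o => u *: y).
Proof. by move=> c u u'; rewrite scalerDl scalerA. Qed.

Program Definition unit_out : cmap (ctens (unit_cpx k U) X) X :=
  @ten (const_rep U (k^o : lmodType k)) X X (fun n A y => mklin (unit_act_linear y)) _ _ _.
Next Obligation. by move=> n A u c y y'; rewrite /= scalerDr !scalerA mulrC. Qed.
Next Obligation. by move=> n A B g u y; rewrite /= linearZ_LR. Qed.
Next Obligation. by move=> n A u y; rewrite /= linearZ_LR. Qed.

Lemma unit_outK n A y : unit_out n A (unit_in n A y) = y.
Proof. by rewrite [LHS]tenE /= scale1r. Qed.
End UnitRetract.
End SphereTensor.
(** * The point of a prime ideal *)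
Section IsoRetract.
Context (k : fieldType) (U : finGroupType -> Prop) (T : truncation U).
Implicit Types (A B C : grp U) (n : int).
Context (N : nat) (G : grp U) (X : cpx k U) (m : int) (x : X m G).
Hypothesis dx : cd X m G x = 0.
Context (xi : forall i, {linear X i G -> k^o}).
Hypotheses (xi1 : xi m x = 1) (xi0 : forall i z, xi (i - 1) (cd X i G z) = 0).

Let M := lin k T (iso_pps T N G).

Definition iso_inv A (f : iso_pps T N G A) : epi G (trunc T N A) :=
  sval (cid (epi_inv_ex (elimT (injectiveP (val f)) (valP f)))).

Lemma iso_invK A (f : iso_pps T N G A) : cancel (iso_inv f) (val f).
Proof. by case: (svalP (cid (epi_inv_ex (elimT (injectiveP (val f)) (valP f))))). Qed.

(** An isomorphism f from Q_N A to G carries y back to G, where [xi] measures it: f (x) y |-> xi(y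
    pulled back along the inverse of f) f. Truncating X is what places y at Q_N A. *)
Definition iso_act n A (y : trunc_cpx T N X n A) : {linear M A -> sphere m M n A} :=
  lin_rec (k := k) (fun f => if pselect (n = m) is left e then
    xi n (res (X n) (iso_inv f) y) *: sph m M n A e (lg k f) else 0).

Lemma iso_actE n A (y : trunc_cpx T N X n A) f : iso_act y (lg k f) =
  if pselect (n = m) is left e then
    xi n (res (X n) (iso_inv f) y) *: sph m M n A e (lg k f) else 0.
Proof. exact: lin_recE. Qed.

Lemma iso_act_linear n A (u : M A) : linear (fun y => @iso_act n A y u).
Proof.
move=> c y y'; move: u.
apply: (lin_ext (f := iso_act (c *: y + y')) (g := c \*: iso_act y \+ iso_act y')) => f.
rewrite -[RHS]/(c *: iso_act y (lg k f) + iso_act y' (lg k f)) !iso_actE.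
case: pselect => [e|_]; last by rewrite scaler0 addr0.
by rewrite linearP linearP scalerDl scalerA.
Qed.

Program Definition iso_tens_out : cmap (ctens (sphere 0 M) (trunc_cpx T N X)) (sphere m M) :=
  @ten k U M (trunc_cpx T N X) (sphere m M) iso_act iso_act_linear _ _.
Next Obligation.
move=> n A B g u y; move: u.
apply: (lin_ext (f := lcomp (iso_act (res (trunc_cpx T N X n) g y)) (res M g)) (g := lcomp (res (sphere m M n) g) (iso_act y))) => f.
rewrite !lcompE lin_resE' iso_actE -[pps_map g f]/(iso_map g f).
have [h|h] := boolP (injectiveb (epi_comp (val f) (tmap T N g))); last first.
  rewrite /iso_map insubF; last exact: negbTE.
  rewrite linear0; case: pselect => [e|_]; last by rewrite linear0.
  rewrite linearZ_LR sph_res lin_resE' -[pps_map g f]/(iso_map g f) /iso_map insubF; last exact: negbTE.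
  by rewrite linear0 scaler0.
rewrite (iso_mapE h) [LHS]iso_actE; case: pselect => [e|_]; last by rewrite linear0.
rewrite linearZ_LR sph_res lin_resE' -[pps_map g f]/(iso_map g f) (iso_mapE h); congr (_ *: _).
rewrite -[res (trunc_cpx T N X n) g y]/(res (X n) (tmap T N g) y) -res_comp; congr (xi _ _).
apply: res_ext => z /=; move/injectiveP: (valP f); apply; rewrite iso_invK.
exact: (iso_invK (mkiso h) z).
Qed.
Next Obligation.
move=> n A u y; rewrite sphere_d; move: u.
apply: (lin_ext (f := iso_act (cd (trunc_cpx T N X) n A y)) (g := \0)) => f.
rewrite iso_actE; case: pselect => // e.
rewrite -[cd (trunc_cpx T N X) n A y]/(cd X n (trunc T N A) y).
by rewrite -(rhom_nat (cd X n)) xi0 scale0r.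
Qed.

(** The section f |-> f (x) f^* x. Followed by [iso_tens_out] it multiplies f by xi(x) = 1. *)
Definition iso_tens_in_at n A : {linear sphere m M n A -> ctens (sphere 0 M) (trunc_cpx T N X) n A} :=
  sph_rec (F := M) (A := A) (fun e => lin_rec (k := k) (fun f => tg (F := M) (X := trunc_cpx T N X) (n := n) (A := A) (lg k f)
    (res (X n) (val f) (icast X G (esym e) x)))).

Lemma iso_tens_in_atE n A e f : iso_tens_in_at n A (sph m M n A e (lg k f)) =
  tg (F := M) (X := trunc_cpx T N X) (n := n) (A := A) (lg k f) (res (X n) (val f) (icast X G (esym e) x)).
Proof. by rewrite /iso_tens_in_at sph_recE; exact: lin_recE. Qed.

Lemma sph_lin_ext n A (W : lmodType k) (f g : {linear sphere m M n A -> W}) :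
  (forall e s, f (sph m M n A e (lg k s)) = g (sph m M n A e (lg k s))) -> forall z, f z = g z.
Proof.
move=> fg; apply: sph_ext => e.
by apply: (lin_ext (f := lcomp f (sph m M n A e)) (g := lcomp g (sph m M n A e))) => s; exact: fg.
Qed.

Program Definition iso_tens_in : cmap (sphere m M) (ctens (sphere 0 M) (trunc_cpx T N X)) :=
  @CMap k U (sphere m M) (ctens (sphere 0 M) (trunc_cpx T N X)) (fun n =>
    @RHom k U (sphere m M n) (ctens (sphere 0 M) (trunc_cpx T N X) n) (iso_tens_in_at n) _) _.
Next Obligation.
move=> n A B g; apply: (@sph_lin_ext n B _ (lcomp (iso_tens_in_at n A) (res (sphere m M n) g))
  (lcomp (res (ctens (sphere 0 M) (trunc_cpx T N X) n) g) (iso_tens_in_at n B))) => e f.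
rewrite !lcompE sph_res iso_tens_in_atE tg_res lin_resE' -[pps_map g f]/(iso_map g f).
have [h|h] := boolP (injectiveb (epi_comp (val f) (tmap T N g))); last first.
  rewrite /iso_map insubF; last exact: negbTE.
  by rewrite !linear0; exact/esym/(linear0 (mklin (tgDZl _))).
rewrite (iso_mapE h) [LHS]iso_tens_in_atE; congr tg.
by rewrite -[RHS]/(res (X n) (tmap T N g) (res (X n) (val f) _)) -res_comp.
Qed.
Next Obligation.
move=> n A; apply: (@sph_lin_ext n A _ (lcomp (iso_tens_in_at (n - 1) A) (cd (sphere m M) n A))
  (lcomp (cd (ctens (sphere 0 M) (trunc_cpx T N X)) n A) (iso_tens_in_at n A))) => e f.
rewrite !lcompE sphere_d iso_tens_in_atE tg_d linear0.
rewrite -[cd (trunc_cpx T N X) n A]/(cd X n (trunc T N A)) rhom_nat.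
rewrite (_ : cd X n G _ = 0) ?linear0; last by subst n; rewrite icast_id.
exact/esym/(linear0 (mklin (tgDZr _))).
Qed.

Lemma iso_tensK n A z : iso_tens_out n A (iso_tens_in n A z) = z.
Proof.
move: z; apply: (@sph_lin_ext n A _ (lcomp (iso_tens_out n A) (iso_tens_in_at n A)) idfun) => e f.
rewrite lcompE iso_tens_in_atE [LHS]tenE iso_actE; case: pselect => // e'.
rewrite -res_comp (res_ext (e' := epi_id G)) ?res_id; last by move=> z /=; rewrite iso_invK.
rewrite (Prop_irrelevance e' e); subst n.
by rewrite icast_id xi1 scale1r.
Qed.
End IsoRetract.

Section ShortExact.
Context (k : fieldType) (U : finGroupType -> Prop).
Implicit Types (A B : grp U) (n m : int) (F H Q : rep k U).

Lemma sph_cases m F n A z : z = 0 \/ exists e x, z = sph m F n A e x.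
Proof.
case: (pselect (n = m)) => [e|ne]; [right|left].
  exists e, (sph_rec (fun _ => idfun) z); move: z.
  apply: (@sph_ext k U m F n A _ idfun (lcomp (sph m F n A e) (sph_rec (fun _ => idfun)))) => e' x.
  by rewrite lcompE sph_recE (Prop_irrelevance e e').
by move: z; apply: (@sph_ext k U m F n A _ idfun \0) => e; case: (ne e).
Qed.

Context (m : int) (F H Q : rep k U) (f : rhom F H) (g : rhom H Q).
Context (h : forall A, {linear H A -> F A}) (s : forall A, {linear Q A -> H A}).
Hypotheses (hf : forall A x, h A (f A x) = x) (gs : forall A x, g A (s A x) = x).
Hypotheses (gf : forall A x, g A (f A x) = 0) (fsE : forall A x, x = f A (h A x) + s A (g A x)).

Lemma snd_linear (V W : lmodType k) : linear (fun z : V * W => z.2).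
Proof. by []. Qed.

Definition ses_out_at n A : {linear cone (sphere_map m f) n A -> sphere m Q n A} :=
  lcomp (sphere_map_at m g n A) (mklin (@snd_linear _ _)).

Program Definition ses_out : cmap (cone (sphere_map m f)) (sphere m Q) :=
  @CMap k U (cone (sphere_map m f)) (sphere m Q) (fun n =>
    @RHom k U (cone (sphere_map m f) n) (sphere m Q n) (ses_out_at n) _) _.
Next Obligation. by move=> n A B e z; exact: (rhom_nat (sphere_map m g n)). Qed.
Next Obligation.
move=> n A [x y]; rewrite sphere_d.
rewrite -[LHS]/(sphere_map_at m g (n - 1) A (sphere_map_at m f (n - 1) A x + cd (sphere m H) n A y)).
rewrite sphere_d addr0.
move: x; apply: (@sph_ext k U m F _ A _ (lcomp (sphere_map_at m g (n - 1) A) (sphere_map_at m f (n - 1) A)) \0) => e x.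
by rewrite lcompE !sphere_map_atE gf linear0.
Qed.

(** The splittings [h] and [s] are linear at each group without being natural; they express
    exactness pointwise, which is where homology is computed. *)
Lemma ses_qi : quasi_iso ses_out.
Proof.
have gE n A e x : sphere_map m g n A (sph m H n A e x) = sph m Q n A e (g A x) by exact: sphere_mapE.
have fE n A e x : sphere_map m f n A (sph m F n A e x) = sph m H n A e (f A x) by exact: sphere_mapE.
apply: quasi_isoP => n A.
  move=> [x y] dz /bdry_sphere gy; have {}dz := congr1 snd dz.
  have x0 : sphere_map m f (n - 1 - 1) A x = 0 by rewrite -[RHS]dz; exact/esym/addr0.
  have {x0 dz} -> : x = 0.
    case: (sph_cases x) => // -[e [u xE]]; subst x; move: x0; rewrite fE => /sph_inj fu.
    by rewrite -[u]hf fu !linear0.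
  case: (sph_cases y) => [->|[e [u yE]]]; first exact: bdry0.
  subst y; move: gy; rewrite -[ses_out _ _ _]/(sphere_map m g (n - 1) A _) gE => /sph_inj gu.
  exists (sph m F (n - 1) A e (h A u), 0).
  congr pair; first by rewrite /= oppr0.
  rewrite {1}(fsE u) gu linear0 addr0 -fE; exact/esym/addr0.
move=> z _; case: (sph_cases z) => [->|[e [u ->]]].
  exists 0; first exact: linear0.
  by rewrite linear0 subr0; exact: bdry0.
exists (0, sph m H (n - 1) A e (s A u)).
  congr pair; first exact: oppr0.
  by rewrite -[LHS]/(sphere_map m f (n - 1 - 1) A 0 + 0) linear0 addr0.
rewrite -[ses_out _ _ _]/(sphere_map m g (n - 1) A _) gE gs subrr; exact: bdry0.
Qed.

Lemma prime_ses (P : cpx k U -> Prop) (pP : prime_ideal P) :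
  P (sphere m F) -> P (sphere m Q) -> P (sphere m H).
Proof. by move=> PF PQ; apply: (prime_cone_inv pP PF); apply/(prime_qi pP ses_qi). Qed.
End ShortExact.
Section ConvexExact.
Context (k : fieldType) (U : finGroupType -> Prop) (T : truncation U).
Context (P : cpx k U -> Prop) (pP : prime_ideal P).
Implicit Types (A B D G H : grp U).

Definition convex (C : grp U -> Prop) := forall A B D, epi A B -> epi B D -> C A -> C D -> C B.

Section Maps.
Context (C D : grp U -> Prop) (hC : convex C) (hD : convex D).

Definition conv_cut A (_ : conv hC A) : lin k T (conv hD) A :=
  if pselect (D A) is left d then lg k (S := conv hD) d else 0.

Definition conv_map_at A : {linear lin k T (conv hC) A -> lin k T (conv hD) A} :=
  lin_rec (k := k) (S := conv hC) (@conv_cut A).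

Lemma conv_map_in A c (d : D A) : conv_map_at A (lg k (S := conv hC) c) = lg k (S := conv hD) d.
Proof.
rewrite [LHS]lin_recE /conv_cut; case: pselect => // d'.
by rewrite (Prop_irrelevance d' d).
Qed.

Lemma conv_map_out A c : ~ D A -> conv_map_at A (lg k (S := conv hC) c) = 0.
Proof. by move=> nd; rewrite [LHS]lin_recE /conv_cut; case: pselect. Qed.
End Maps.
Arguments conv_map_in {C D} hC hD {A} c d.
Arguments conv_map_out {C D} hC hD {A} c _.

Lemma conv_res_in C (hC : convex C) A B (e : epi A B) (c : C B) (a : C A) :
  res (lin k T (conv hC)) e (lg k (S := conv hC) c) = lg k (S := conv hC) a.
Proof. by rewrite lin_resE' -[pps_map (p := conv hC) e c]/(cmap_conv e c) (cmap_convE e c a). Qed.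

Lemma conv_res_out C (hC : convex C) A B (e : epi A B) (c : C B) : ~ C A ->
  res (lin k T (conv hC)) e (lg k (S := conv hC) c) = 0.
Proof. by move=> na; rewrite lin_resE' -[pps_map (p := conv hC) e c]/(cmap_conv e c) /cmap_conv; case: pselect. Qed.

Arguments conv_res_in {C} hC {A B} e c a.
Arguments conv_res_out {C} hC {A B} e c _.

Section Layer.
Context (C C' C'' : grp U -> Prop) (hC : convex C) (hC' : convex C') (hC'' : convex C'').
Hypotheses (C1 : forall A, C A <-> C' A \/ C'' A) (C2 : forall A, C' A -> ~ C'' A).
Hypothesis up : forall A B, epi A B -> C' B -> ~ C'' A.

(** By [up], restriction from a group in C' never reaches C'', so k on C' is a subobject of k on C,
    with quotient k on C''. *)
Program Definition layer_in : rhom (lin k T (conv hC')) (lin k T (conv hC)) :=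
  @RHom k U _ _ (conv_map_at hC' hC) _.
Next Obligation.
move=> A B e; apply: (lin_ext (S := conv hC') (f := lcomp (conv_map_at hC' hC A) (res (lin k T (conv hC')) e))
  (g := lcomp (res (lin k T (conv hC)) e) (conv_map_at hC' hC B))) => s.
rewrite !lcompE (conv_map_in hC' hC s ((C1 B).2 (or_introl (s : C' B)))).
case: (pselect (C' A)) => [a|na].
  by rewrite (conv_res_in hC' e s a) (conv_map_in hC' hC a ((C1 A).2 (or_introl a))) (conv_res_in hC e _ ((C1 A).2 (or_introl a))).
rewrite (conv_res_out hC' e s na) linear0 conv_res_out // => /C1[//|]; exact: up e s.
Qed.

Program Definition layer_out : rhom (lin k T (conv hC)) (lin k T (conv hC'')) :=
  @RHom k U _ _ (conv_map_at hC hC'') _.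
Next Obligation.
move=> A B e; apply: (lin_ext (S := conv hC) (f := lcomp (conv_map_at hC hC'' A) (res (lin k T (conv hC)) e))
  (g := lcomp (res (lin k T (conv hC'')) e) (conv_map_at hC hC'' B))) => s.
rewrite !lcompE; case: ((C1 B).1 s) => [b|b].
  have na := up e b; rewrite (conv_map_out hC hC'' s (C2 b)) linear0.
  case: (pselect (C A)) => [a|nC]; last by rewrite (conv_res_out hC e s nC) linear0.
  by rewrite (conv_res_in hC e s a) conv_map_out.
rewrite (conv_map_in hC hC'' s b); case: (pselect (C'' A)) => [a|na].
  by rewrite (conv_res_in hC e s ((C1 A).2 (or_intror a))) (conv_map_in hC hC'' _ a) (conv_res_in hC'' e b a).
rewrite (conv_res_out hC'' e b na).
case: (pselect (C A)) => [a|nC]; last by rewrite (conv_res_out hC e s nC) linear0.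
by rewrite (conv_res_in hC e s a) conv_map_out.
Qed.

Lemma prime_layer m : P (sphere m (lin k T (conv hC'))) -> P (sphere m (lin k T (conv hC''))) ->
  P (sphere m (lin k T (conv hC))).
Proof.
apply: (@prime_ses k U m _ _ _ layer_in layer_out (conv_map_at hC hC') (conv_map_at hC'' hC)) => // A.
- apply: (lin_ext (S := conv hC') (f := lcomp (conv_map_at hC hC' A) (conv_map_at hC' hC A)) (g := idfun)) => s.
  by rewrite lcompE (conv_map_in hC' hC s ((C1 A).2 (or_introl (s : C' A)))) (conv_map_in hC hC' _ s).
- apply: (lin_ext (S := conv hC'') (f := lcomp (conv_map_at hC hC'' A) (conv_map_at hC'' hC A)) (g := idfun)) => s.
  by rewrite lcompE (conv_map_in hC'' hC s ((C1 A).2 (or_intror (s : C'' A)))) (conv_map_in hC hC'' _ s).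
- apply: (lin_ext (S := conv hC') (f := lcomp (conv_map_at hC hC'' A) (conv_map_at hC' hC A)) (g := \0)) => s.
  by rewrite lcompE (conv_map_in hC' hC s ((C1 A).2 (or_introl (s : C' A)))) (conv_map_out hC hC'' _ (C2 s)).
apply: (lin_ext (S := conv hC) (f := idfun) (g := lcomp (conv_map_at hC' hC A) (conv_map_at hC hC' A) \+ lcomp (conv_map_at hC'' hC A) (conv_map_at hC hC'' A))) => s.
rewrite -[RHS]/(lcomp (conv_map_at hC' hC A) (conv_map_at hC hC' A) _ + lcomp (conv_map_at hC'' hC A) (conv_map_at hC hC'' A) _) !lcompE.
case: ((C1 A).1 s) => [a|a].
  by rewrite (conv_map_in hC hC' s a) (conv_map_out hC hC'' s (C2 a)) linear0 addr0 (conv_map_in hC' hC a s).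
rewrite (conv_map_in hC hC'' s a) (conv_map_out hC hC' s) ?linear0 ?add0r ?(conv_map_in hC'' hC a s) // => b.
exact: C2 b a.
Qed.
End Layer.

Lemma prime_conv_eq (C D : grp U -> Prop) (hC : convex C) (hD : convex D) m : (forall A, C A <-> D A) ->
  P (sphere m (lin k T (conv hC))) -> P (sphere m (lin k T (conv hD))).
Proof.
move=> CD; have e : C = D by apply/funext => A; exact/propext.
by subst D; rewrite (Prop_irrelevance hC hD).
Qed.
End ConvexExact.

Lemma qi_id (k : fieldType) (U : finGroupType -> Prop) (X : cpx k U) : quasi_iso (cmap_id X).
Proof.
by apply: quasi_isoP => // n A y dy; exists y; rewrite //= subrr; exact: bdry0.
Qed.

Section PrimePoint.
Context (k : fieldType) (U : finGroupType -> Prop) (T : truncation U).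
Hypothesis (k0 : [pchar k]%R =i pred0).
Context (P : cpx k U -> Prop) (pP : prime_ideal P).
Implicit Types (X Y Z W : cpx k U) (A B C D G H : grp U) (n m : int) (N M : nat).

(** X is a retract of its tensor product with the unit. *)
Lemma prime_all X : P (unit_cpx k U) -> compact_obj X -> P X.
Proof.
move=> P1 cX; apply: (prime_cmap_retract pP (i := unit_in X) (q := unit_out X)).
  by move=> n A y; exact: unit_outK.
exact: (prime_tens pP).
Qed.

Lemma prime_unit : ~ P (unit_cpx k U).
Proof. by move=> P1; have [X cX] := prime_proper pP; apply; exact: prime_all. Qed.

Lemma prime_sphere m (F : rep k U) : P (sphere (m + 1) F) <-> P (sphere m F).
Proof. rewrite (prime_qi pP (@sphere_shift_qi k U m F)); exact: (prime_shift pP). Qed.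

Lemma prime_sphere0 m (F : rep k U) : P (sphere m F) <-> P (sphere 0 F).
Proof.
elim/int_rect: m => [|n IH|n IH] //.
- by rewrite -IH -(prime_sphere n%:Z) -PoszD addn1.
- by rewrite -IH -(prime_sphere (- n.+1%:Z)) -[n.+1]addn1 PoszD opprD addrNK.
Qed.

Definition chi_cpx N G : cpx k U := sphere 0 (lin k T (chi T N G)).

Lemma sphere_chi_outK N G i A z :
  sphere_map 0 (chi_out k T N G) i A (sphere_map 0 (chi_in k T N G) i A z) = z.
Proof.
move: z; apply: (@sph_ext k U 0 _ i A _ (lcomp (sphere_map_at 0 (chi_out k T N G) i A)
  (sphere_map_at 0 (chi_in k T N G) i A)) idfun) => e x.
by rewrite lcompE !sphere_map_atE (chi_outK k0).
Qed.

(** Let M be the linearized presheaf of isomorphisms. Membership in P passes from X to X (x) M, by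
    symmetry and truncation to M (x) [trunc_cpx T N X], then to its retract M in degree n - 1, and
    finally to the retract chi of M. *)
Lemma prime_chi_in X N G : tr T N X -> compact_obj X -> ~ acyc G X -> P X -> P (chi_cpx N G).
Proof.
move=> tX cX nX PX; have [n [x [dx bx]]] : exists n (x : X (n - 1) G), cd X (n - 1) G x = 0 /\ ~ bdry X n G x.
  apply: contrapT => h; apply: nX => n x dx; apply: contrapT => nb; apply: h.
  by exists n, x.
have [xi [xi1 xi0]] := functional_ex dx bx.
have cM := iso_compact T k0 N G 0.
have PM : P (sphere 0 (lin k T (iso_pps T N G))).
  apply/(prime_sphere0 (n - 1)).
  apply: (prime_cmap_retract pP (i := iso_tens_in T N dx) (q := iso_tens_out T N (n - 1) xi0)).
    by move=> i A z; exact: iso_tensK.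
  apply/(prime_qi pP (ctens_map_qi (f := cmap_id _) (@qi_id _ _ _) ((trP T N X).1 tX))).
  apply: (prime_cmap_retract pP (i := ctens_swap _ _) (q := ctens_swap _ _)); last exact: (prime_tens pP PX cM).
  by move=> i A z; exact: ctens_swapK.
apply: (prime_cmap_retract pP (i := sphere_map 0 (chi_in k T N G)) (q := sphere_map 0 (chi_out k T N G))) PM.
by move=> i A z; exact: sphere_chi_outK.
Qed.

Lemma isoT_eq N A B G H : isoT T N H A -> isoT T N H B -> isoT T N G B -> isoT T N G A.
Proof.
move=> [a ai] [b bi] [c ci]; have [b' [b1 b2]] := epi_inv_ex bi.
by exists (epi_comp c (epi_comp b' a)) => x y /= /ci /(can_inj b2) /ai.
Qed.

Lemma isoT_epi N A B G H : epi A B -> isoT T N G A -> isoT T N H B -> (#|G| <= #|H|)%N -> isoT T N G B.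
Proof.
move=> e iA iB GH; have cA := isoT_card iA; have cB := isoT_card iB.
have ei : injective (tmap T N e).
  by apply: epi_card_inj; have := epi_card (tmap T N e); rewrite cA cB; lia.
case: iA => a ai; have [i [i1 i2]] := epi_inv_ex ei.
by exists (epi_comp a i) => x y /= /ai /(can_inj i2).
Qed.

(** The smallest type G is split off. An epimorphism from a group of type G to one of a later type
    would be an isomorphism on truncations, so the later types carry a subobject and G the
    quotient. *)
Lemma prime_devissage N (l : list (grp U)) (C : grp U -> Prop) (hC : convex C) :
  ordered l -> (forall A, C A -> exists2 G, List.In G l & isoT T N G A) ->
  (forall A B H, C A -> isoT T N H A -> isoT T N H B -> C B) ->
  (forall G, List.In G l -> P (chi_cpx N G)) -> P (sphere 0 (lin k T (conv hC))).
Proof.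
elim: l C hC => [|G l IH] C hC ol Cl Ciso Pl.
  apply: (prime_acyclic pP) => A; apply/lin_acyc => /Cl[G []].
case: ol => Gl ol.
pose C' A := C A /\ ~ isoT T N G A; pose C'' A := C A /\ isoT T N G A.
have C'l A : C' A -> exists2 H, List.In H l & isoT T N H A.
  by case=> /Cl[H [->//|Hl iH] nA]; exists H.
have hC' : convex C'.
  move=> A B D e f [cA nA] [cD nD]; split; first exact: hC e f cA cD.
  move=> iB; have [H Hl iD] := C'l D (conj cD nD).
  by apply: nD; exact: isoT_epi f iB iD (Gl _ Hl).
have hC'' : convex C''.
  move=> A B D e f [cA iA] [cD iD]; split; first exact: hC e f cA cD.
  exact: isoT_conv e f iA iD.
apply: (@prime_layer k U T P pP C C' C'' hC hC' hC'').
- by move=> A; rewrite /C' /C''; case: (pselect (isoT T N G A)); tauto.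
- by move=> A [_ nA] [].
- move=> A B e cB [cA iA]; have [H Hl iB] := C'l B cB.
  by case: cB => _; apply; exact: isoT_epi e iA iB (Gl _ Hl).
- apply: IH => //; last by move=> H Hl; apply: Pl; right.
  move=> A B H [cA nA] iA iB; split; first exact: Ciso cA iA iB.
  by move=> gB; apply: nA; exact: isoT_eq iA iB gB.
(* C is a union of types, so its part of type G is the whole type or empty. *)
have [[A [cA iA]]|nC] := pselect (exists A, C'' A).
  apply: (@prime_conv_eq k U T P (isoT T N G) C'' (@isoT_conv U T N G)); last by apply: Pl; left.
  by move=> B; split=> [iB|[]//]; split=> //; exact: Ciso cA iA iB.
by apply: (prime_acyclic pP) => A; apply/lin_acyc => cA; apply: nC; exists A.
Qed.

(** Otherwise the filtration by the finitely many types puts the constant presheaf k in P, and with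
    it the unit. *)
Lemma prime_chi_notin N : exists2 G, List.In G (ttypes T N) & ~ P (chi_cpx N G).
Proof.
apply: contrapT => h; have Pchi G : List.In G (ttypes T N) -> P (chi_cpx N G).
  by move=> Gl; apply: contrapT => nP; apply: h; exists G.
have hT : convex (fun _ : grp U => True) by [].
apply: prime_unit; have [l [ol lP]] := ordered_ex (ttypes T N).
have : P (sphere 0 (lin k T (conv hT))).
  apply: (@prime_devissage N l _ hT) => // [A _|G /lP /Pchi//].
  have [G [Gl [e ei]]] := ttypesP (@tproj_trunc U T N A).
  by exists G; [exact/lP|exists e].
(* The linearization of the one-point presheaf on all groups is the constant presheaf, through [u]
   and [v]. *)
pose u A : {linear lin k T (conv hT) A -> k^o} := lin_rec (S := conv hT) (fun _ => 1 : k^o).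
have uE A s : u A (lg k (S := conv hT) s) = 1 by exact: lin_recE.
pose v A : {linear k^o -> lin k T (conv hT) A} := mklin (lin_rec_linear (lg k (S := conv hT) (A := A) I)).
have hu A B (e : epi A B) x : u A (res (lin k T (conv hT)) e x) = u B x.
  move: x; apply: (lin_ext (S := conv hT) (f := lcomp (u A) (res (lin k T (conv hT)) e)) (g := u B)) => s.
  by rewrite lcompE (conv_res_in k T hT e s I) !uE.
have hv A B (e : epi A B) x : v A x = res (lin k T (conv hT)) e (v B x).
  by rewrite -[v B x]/(x *: lg k (S := conv hT) (A := B) I) linearZ_LR (conv_res_in k T hT e I I).
pose U1 := @RHom k U (lin k T (conv hT)) (const_rep U (k^o : lmodType k)) u hu.
pose V1 := @RHom k U (const_rep U (k^o : lmodType k)) (lin k T (conv hT)) v hv.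
apply: (prime_cmap_retract pP (i := sphere_map 0 V1) (q := sphere_map 0 U1)) => i A.
apply: (@sph_ext k U 0 _ i A _ (lcomp (sphere_map_at 0 U1 i A) (sphere_map_at 0 V1 i A)) idfun) => e z.
rewrite lcompE !sphere_map_atE; congr (sph _ _ _ _ _ _).
by rewrite -[LHS]/(u A (z *: lg k (S := conv hT) (A := A) I)) linearZ_LR uE; exact: mulr1.
Qed.

(** If X is acyclic at G, then its product with chi is acyclic at groups of type G by truncation,
    and elsewhere because chi vanishes; primality removes the factor chi. *)
Lemma prime_chiP X N G : tr T N X -> compact_obj X -> ~ P (chi_cpx N G) -> (P X <-> acyc G X).
Proof.
move=> tX cX nP; split=> [PX|aX].
  by apply: contrapT => nX; apply: nP; exact: prime_chi_in PX.
suff : P (ctens (chi_cpx N G) X) by case/(prime_prime pP (chi_compact T k0 N G 0) cX).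
apply: (prime_acyclic pP) => A; apply/acyc_ctensP.
have [[f fi]|nA] := pselect (isoT T N G A); last by left; exact/lin_acyc.
by right; apply/(tr_acyc A tX)/(acyc_inj X fi).
Qed.

Lemma prime_pointP : exists v, [/\ coherent T v, forall N, List.In (v N) (ttypes T N) &
  forall X, P X <-> prime_at v X].
Proof.
have h N : exists G, List.In G (ttypes T N) /\ ~ P (chi_cpx N G).
  by have [G] := prime_chi_notin N; exists G.
pose v N := sval (cid (h N)); have vP N : List.In (v N) (ttypes T N) /\ ~ P (chi_cpx N (v N)).
  exact: (svalP (cid (h N))).
have vc : coherent T v.
  split=> [N|N M NM]; first by apply: ttypes_tors; exact: (vP N).1.
  (* Coherence: chi for [v N] is also M-truncated and lies outside P, so the criterion at level M
     says that it is not acyclic at [v M]; thus Q_N (v M) has type [v N]. *)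
  have := (vP N).2; rewrite (@prime_chiP (chi_cpx N (v N)) M (v M)).
  - by move=> nn; apply: contrapT => q; apply: nn; exact/lin_acyc.
  - apply: (tr_mono NM); exact/conv_tr/isoT_trunc.
  - exact: chi_compact.
  - exact: (vP M).2.
exists v; split=> // [N|X]; first exact: (vP N).1.
suff hX : compact_obj X -> (P X <-> prime_at v X).
  by split=> [PX|[cX PX]]; apply/hX => //; exact: (prime_compact pP).
move=> cX; have [[N tX] _] := (compactP T k0 X).1 cX.
by rewrite (prime_atP vc tX cX); apply: prime_chiP => //; exact: (vP N).2.
Qed.
End PrimePoint.
(** * Spaces of bounded antitone sequences *)
Section Coded.
Context (r : nat).

Definition antitone_le (h : nat -> nat) : Prop :=
  (forall i j, (i <= j)%N -> (h j <= h i)%N) /\ forall i, (h i <= r)%N.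

(** The coding identifies T with the bounded antitone functions under the topology of finite
    prefixes. Each conclusion of the theorem is drawn from codings alone. *)
Record coded (T : Defs.space) (g : T -> nat -> nat) : Prop := Coded {
  coded_le : forall x, antitone_le (g x);
  coded_inj : forall x y, g x =1 g y -> x = y;
  coded_surj : forall h, antitone_le h -> exists x, g x =1 h;
  coded_opn : forall A, opn A <-> forall x, A x ->
    exists N, forall y, (forall i, (i < N)%N -> g y i = g x i) -> A y
}.

Lemma coded_cylinder (T : Defs.space) (g : T -> nat -> nat) (gP : coded g) x N :
  opn (fun y => forall i, (i < N)%N -> g y i = g x i).
Proof.
apply/(coded_opn gP) => y yx; exists N => z zy i iN.
by rewrite zy // yx.
Qed.

Lemma coded_hausdorff (T : Defs.space) (g : T -> nat -> nat) : coded g -> hausdorff T.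
Proof.
move=> gP x y xy; have [n nE] : exists n, g x n <> g y n.
  by apply: contrapT => h; apply/xy/(coded_inj gP) => n; apply: contrapT => nE; apply: h; exists n.
exists (fun z => forall i, (i < n.+1)%N -> g z i = g x i), (fun z => forall i, (i < n.+1)%N -> g z i = g y i).
split=> //; [exact: coded_cylinder|exact: coded_cylinder|].
by move=> z zx zy; apply: nE; rewrite -(zx n) // (zy n).
Qed.

Lemma coded_homeomorphic (T T' : Defs.space) (g : T -> nat -> nat) (g' : T' -> nat -> nat) :
  coded g -> coded g' -> homeomorphic T T'.
Proof.
move=> gP gP'.
pose f x := sval (cid (coded_surj gP' (coded_le gP x))).
pose f' x := sval (cid (coded_surj gP (coded_le gP' x))).
have fE x : g' (f x) =1 g x by exact: (svalP (cid (coded_surj gP' (coded_le gP x)))).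
have fE' x : g (f' x) =1 g' x by exact: (svalP (cid (coded_surj gP (coded_le gP' x)))).
exists f, f'; split=> [x|x|A /(coded_opn gP') oA|A /(coded_opn gP) oA].
- by apply: (coded_inj gP) => i; rewrite fE' fE.
- by apply: (coded_inj gP') => i; rewrite fE fE'.
- apply/(coded_opn gP) => x /oA[N AN]; exists N => y yx; apply: AN => i iN.
  by rewrite !fE yx.
- apply/(coded_opn gP') => x /oA[N AN]; exists N => y yx; apply: AN => i iN.
  by rewrite !fE' yx.
Qed.

Lemma cb_derivative_mono (T : Defs.space) (A B : T -> Prop) :
  (forall x, A x -> B x) -> forall x, cb_derivative A x -> cb_derivative B x.
Proof.
move=> AB x [Ax nA]; split; first exact: AB.
by case=> C [oC Cx CB]; apply: nA; exists C; split=> // y Cy /AB; exact: CB.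
Qed.

(** A substitute for trichotomy of ordinal notations. At a supremum, either some member already
    satisfies the second alternative, or all members are bounded by n. *)
Lemma cb_derived_nat (T : Defs.space) (b : ord) n : ole b (ord_of_nat n) \/
  forall x : T, cb_derived b x -> cb_derived (ord_of_nat n.+1) x.
Proof.
elim: b n => [|b IH|I f IH] n; first by left; exact: ole_zero.
  case: n => [|n]; first by right=> x; exact: cb_derivative_mono.
  case: (IH n) => h; first by left; apply/ole_succ/olt_succ.
  by right=> x; exact: cb_derivative_mono.
case: (pselect (exists i, forall x : T, cb_derived (f i) x -> cb_derived (ord_of_nat n.+1) x)) => [[i h]|h].
  by right=> x /(_ i); exact: h.
by left; apply: ole_lim => i; case: (IH i n) => // hi; case: h; exists i.
Qed.

Lemma coded_derived (T : Defs.space) (g : T -> nat -> nat) (gP : coded g) j : (j <= r.+1)%N ->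
  forall x, cb_derived (ord_of_nat j) x <-> forall i, (j <= g x i)%N.
Proof.
elim: j => [|j IH] jr x; first by [].
have {}IH y := IH (ltnW jr) y; rewrite /=; split=> [[/IH jx ni] i|jx].
  (* A function that reaches the value j at i is isolated among those bounded below by j: agreement
     up to i forces the value j from there on. *)
  rewrite ltnNge; apply/negP => ij; apply: ni.
  exists (fun y => forall l, (l < i.+1)%N -> g y l = g x l); split=> //; first exact: coded_cylinder.
  move=> y yx /IH jy; apply: (coded_inj gP) => l; case: (ltnP l i.+1) => li; first exact: yx.
  have [ax _] := coded_le gP x; have [ay _] := coded_le gP y.
  have := ay i l (ltnW li); have := ax i l (ltnW li); have := yx i (ltnSn i).
  by have := jx l; have := jy l; lia.
split; first by apply/IH => i; exact: ltnW (jx i).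
case=> B [/(coded_opn gP) oB Bx BX]; have [N BN] := oB x Bx.
have [ax bx] := coded_le gP x.
(* Conversely a function bounded below by j + 1 is approached by its prefixes continued with the
   constant j, which is at most r. *)
have [|y yE] := @coded_surj _ _ gP (fun i => if (i < N)%N then g x i else j).
  split=> [i l il|i]; last by case: ifP => // _; exact: jr.
  case: ifP => lN; first by rewrite (leq_ltn_trans il lN); exact: ax.
  by case: ifP => // _; exact: ltnW (jx i).
have yx : y = x.
  apply: BX; first by apply: BN => i iN; rewrite yE iN.
  by apply/IH => i; rewrite yE; case: ifP => // _; exact: ltnW (jx i).
by have := jx N; rewrite -yx yE ltnn /= ltnn.
Qed.

Lemma coded_cb_rank (T : Defs.space) (g : T -> nat -> nat) : coded g -> has_cb_rank T (ord_of_nat r).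
Proof.
move=> gP; have [//|x xE] := @coded_surj _ _ gP (fun _ => r).
have dx : cb_derived (ord_of_nat r) x by apply/(coded_derived gP) => // i; rewrite xE.
split; first by exists x.
  move=> b [y by_]; case: (cb_derived_nat T b r) => // /(_ y by_)/(coded_derived gP) h.
  by have := h (leqnn _) 0%N; have := (coded_le gP y).2 0%N; lia.
by move=> c h; apply: h; exists x.
Qed.
End Coded.
(** * Finite abelian p-groups *)
Section AbelianGroups.
Context (p : nat) (p_pr : prime p).
Local Open Scope group_scope.
Implicit Types (A B C Q : finGroupType) (n m i : nat).

Lemma epi_factor A Q C (q : epi A Q) (f : epi A C) : (forall x, q x = 1 -> f x = 1) ->
  exists g : epi Q C, forall x, g (q x) = f x.
Proof.
move=> h; have [s sP] := choice (epi_surj q).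
have fq x y : q x = q y -> f x = f y.
  move=> xy; have : q (x * y^-1) = 1 by rewrite !epiM xy -epiM mulgV epi1.
  move/h; rewrite epiM => e.
  by rewrite -[x](mulgKV y) epiM epiM e mul1g.
have gM : {morph f \o s : x y / x * y}.
  by move=> x y /=; rewrite -epiM; apply: fq; rewrite epiM !sP.
have gs y : exists x, (f \o s) x = y.
  by have [x <-] := epi_surj f y; exists (q x) => /=; apply: fq; rewrite sP.
by exists (mkepi gM gs) => x; apply: fq; rewrite /= sP.
Qed.

Lemma epiX A B (e : epi A B) x n : e (x ^+ n) = e x ^+ n.
Proof. by elim: n => [|n IH]; rewrite ?expg0 ?epi1 // !expgS epiM IH. Qed.

Lemma epi_inj1 A B (e : epi A B) : (forall x, e x = 1 -> x = 1) -> injective e.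
Proof.
move=> h x y xy; have : e (x * y^-1) = 1 by rewrite epiM xy -epiM mulgV epi1.
by move/h/(congr1 (fun z => z * y)); rewrite mulgKV mul1g.
Qed.

Definition abp A := abelian [set: A] /\ p.-group [set: A].

(** For an abelian p-group ['Mho^n] consists of the p^n-th powers, so this is A / p^n. *)
Definition quo n A : finGroupType := coset_of 'Mho^n([set: A]).

Lemma quo_normal n A (x : A) : x \in 'N('Mho^n([set: A])).
Proof. exact: (fintype.subsetP (normal_norm (Mho_normal n [set: A]%G)) x (finset.in_setT x)). Qed.

Lemma quo_projM n A : {morph (coset 'Mho^n([set: A]) : A -> quo n A) : x y / x * y}.
Proof. by move=> x y; rewrite morphM ?quo_normal. Qed.

Lemma quo_proj_surj n A (y : quo n A) : exists x, coset 'Mho^n([set: A]) x = y.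
Proof. by have [x _ ->] := cosetP y; exists x. Qed.

Definition quo_proj n A : epi A (quo n A) := mkepi (@quo_projM n A) (@quo_proj_surj n A).

Lemma quo_proj1 n A x : abp A -> quo_proj n A x = 1 <-> exists y, x = y ^+ (p ^ n).
Proof.
case=> cA pA; rewrite -[quo_proj n A x]/(coset _ x).
have MhoP : x \in 'Mho^n([set: A]) <-> exists y, x = y ^+ (p ^ n).
  rewrite (MhoEabelian n pA cA); split=> [/imsetP[y _ ->]|[y ->]]; first by exists y.
  by apply/imsetP; exists y; rewrite ?inE.
by rewrite -MhoP; split=> [/(coset_idr (quo_normal n x))|]; last exact: coset_id.
Qed.

(** The order of the p^n-torsion, equal to that of A / p^n by [card_quo]; these orders determine the
    group. *)
Definition kap n A := #|[set x : A | x ^+ (p ^ n) == 1]|.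

Lemma kapE n A : abp A -> kap n A = #|'Ohm_n([set: A])|.
Proof.
case=> cA pA; rewrite (OhmEabelian pA (abelianS (Ohm_sub _ _) cA)).
by apply: eq_card => x; rewrite !inE.
Qed.

Lemma kap_gt0 n A : (0 < kap n A)%N.
Proof. by apply/card_gt0P; exists 1; rewrite inE expg1n. Qed.

Lemma card_quo n A : abp A -> #|{: quo n A}| = kap n A.
Proof.
move=> aA; rewrite (kapE n aA); have [cA pA] := aA.
rewrite -[LHS]cardsT -quotientT card_quotient; last exact: normal_norm (Mho_normal _ _).
by rewrite -divgS ?Mho_sub // -(mul_card_Ohm_Mho_abelian n cA) mulnK ?cardG_gt0.
Qed.

Definition epi_morphism A B (e : epi A B) : {morphism [set: A] >-> B} :=
  @Morphism _ _ [set: A] e (in2W (epiM e)).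

Lemma epi_morphim A B (e : epi A B) : epi_morphism e @* [set: A] = [set: B].
Proof.
apply/setP => y; rewrite !inE; have [x <-] := epi_surj e y.
by apply/morphimP; exists x; rewrite ?inE.
Qed.

Lemma abp_epi A B (e : epi A B) : abp A -> abp B.
Proof.
by case=> cA pA; split; rewrite -(epi_morphim e); [exact: morphim_abelian|exact: morphim_pgroup].
Qed.

Lemma p_rank_epi A B (e : epi A B) : abp A -> ('r_p([set: B]) <= 'r_p([set: A]))%N.
Proof. by case=> cA pA; rewrite -(epi_morphim e) morphim_p_rank_abelian. Qed.

Definition torsn n A := forall x : A, x ^+ (p ^ n) = 1.

Lemma quo_proj_inj n A : abp A -> injective (quo_proj n A) <-> torsn n A.
Proof.
move=> aA; split=> [h x|h].
  by apply: h; rewrite epi1; apply/(quo_proj1 _ _ aA); exists x.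
by apply: epi_inj1 => x /(quo_proj1 _ _ aA)[y ->]; exact: h.
Qed.

Lemma torsn_kap n A : torsn n A <-> kap n A = #|A|.
Proof.
split=> h; first by rewrite -cardsT; apply: eq_card => x; rewrite !inE h eqxx.
move=> x; have : [set x : A | x ^+ (p ^ n) == 1] = [set: A].
  by apply/eqP; rewrite eqEcard finset.subsetT cardsT -/(kap n A) h leqnn.
by move/setP/(_ x); rewrite !inE => /eqP.
Qed.

Lemma torsn_leq m n A : (m <= n)%N -> torsn m A -> torsn n A.
Proof. by move=> mn h x; rewrite -(subnKC mn) expnD expgM h expg1n. Qed.

Lemma torsn_large A : abp A -> exists n, torsn n A.
Proof.
case=> _ /p_natP[n]; rewrite cardsT => cA; exists n => x; rewrite -cA.
by apply/eqP; rewrite -order_dvdn -cardsT; apply: order_dvdG; rewrite inE.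
Qed.

Lemma quo_tors n A : abp A -> torsn n (quo n A).
Proof.
move=> aA y; have [x <-] := epi_surj (quo_proj n A) y.
by rewrite -epiX; apply/(quo_proj1 _ _ aA); exists x.
Qed.

Lemma quo_map_ex n A B (e : epi A B) : abp A -> exists f : epi (quo n A) (quo n B),
  forall x, f (quo_proj n A x) = quo_proj n B (e x).
Proof.
move=> aA; apply: (epi_factor (f := epi_comp (quo_proj n B) e)) => x /(quo_proj1 _ _ aA)[y ->] /=.
by rewrite epiX; apply/(quo_proj1 _ _ (abp_epi e aA)); exists (e y).
Qed.

(** For m <= n the quotients Q_m Q_n A and Q_m A map onto each other, so their orders agree; for
    larger m all of Q_n A is p^m-torsion. *)
Lemma kap_quo m n A : abp A -> kap m (quo n A) = kap (minn m n) A.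
Proof.
move=> aA; have aQ i := abp_epi (quo_proj i A) aA.
have [mn|nm] := leqP m n; last first.
  by rewrite -(card_quo _ aA); apply/torsn_kap/(torsn_leq (ltnW nm)); exact: quo_tors.
rewrite -(card_quo _ aA) -(card_quo _ (aQ n)).
have [f _] := quo_map_ex m (quo_proj n A) aA.
have [|g gE] := @epi_factor _ _ _ (quo_proj n A) (quo_proj m A).
  move=> x /(quo_proj1 _ _ aA)[y ->]; apply/(quo_proj1 _ _ aA).
  by exists (y ^+ (p ^ (n - m))); rewrite -expgM -expnD subnK.
have [|h _] := @epi_factor _ _ _ (quo_proj m (quo n A)) g.
  by move=> x /(quo_proj1 _ _ (aQ n))[y ->]; rewrite epiX; exact: quo_tors.
by apply/eqP; rewrite eqn_leq (epi_card f) (epi_card h).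
Qed.

(* The number of invariant factors of [A] of order greater than [p ^ i]. *)
Definition cty A i := (logn p (kap i.+1 A) - logn p (kap i A))%N.

Lemma kap0 A : kap 0 A = 1%N.
Proof. by rewrite -(cards1 (1 : A)); apply: eq_card => x; rewrite !inE expn0 expg1. Qed.

Lemma kap_pow n A : abp A -> kap n A = (p ^ logn p (kap n A))%N.
Proof.
move=> aA; have [cA pA] := aA; rewrite (kapE n aA).
by have /p_natP[m ->] : p.-group 'Ohm_n([set: A]) := pgroupS (Ohm_sub _ _) pA; rewrite pfactorK.
Qed.

(** In a product of cyclic groups the jumps of the [Ohm] orders count factors; a basis from
    [abelian_structure] connects them with [abelian_type]. *)
Lemma cty_count A : abp A -> exists b : seq A,
  [/\ map (@fingroup.order _) b = abelian_type [set: A], all (fun x => #[x] == p ^ logn p #[x])%N b &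
    forall i, cty A i = count [pred x | (i < logn p #[x])%N] b].
Proof.
move=> aA; have [cA pA] := aA; have [b [defA bA]] := abelian_structure cA.
exists b; split=> // [|i].
  apply/allP => x _; apply/eqP; have /p_natP[m ->] : p.-nat #[x].
    by apply: (mem_p_elt pA); rewrite inE.
  by rewrite pfactorK.
rewrite (count_logn_dprod_cycle _ _ defA) /cty !(kapE _ aA) -divgS ?Ohm_leq //.
rewrite logn_div //; exact: cardSg (Ohm_leq _ (leqnSn i)).
Qed.

Lemma kap_cty A : abp A -> forall n, logn p (kap n.+1 A) = (logn p (kap n A) + cty A n)%N.
Proof.
move=> aA n; rewrite /cty subnKC // dvdn_leq_log ?kap_gt0 // !(kapE _ aA).
exact: cardSg (Ohm_leq _ (leqnSn n)).
Qed.

Lemma cty_antitone A i j : abp A -> (i <= j)%N -> (cty A j <= cty A i)%N.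
Proof.
move=> aA ij; have [b [_ _ bE]] := cty_count aA; rewrite !bE; apply: sub_count => x /=.
exact: leq_ltn_trans.
Qed.

Lemma cty0 A : abp A -> cty A 0 = 'r_p([set: A]).
Proof.
move=> aA; have [cA pA] := aA.
by rewrite /cty kap0 logn1 subn0 (kapE _ aA) (p_rank_abelian p cA).
Qed.

Lemma cty_quo n A i : abp A -> cty (quo n A) i = if (i < n)%N then cty A i else 0%N.
Proof.
move=> aA; rewrite /cty !kap_quo //; case: ltnP => h; first by rewrite (minn_idPl h).
by rewrite (minn_idPr (leqW h)) subnn.
Qed.

Lemma cty_large n A i : abp A -> torsn n A -> (n <= i)%N -> cty A i = 0%N.
Proof.
move=> aA tA ni; have e j : (n <= j)%N -> kap j A = #|A|.
  by move=> nj; apply/torsn_kap/(torsn_leq nj).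
by rewrite /cty !e ?subnn // leqW.
Qed.

(** The orders of the p^m-torsion are constant from m = n on and eventually equal to that of A. *)
Lemma cty_tors n A : abp A -> (forall i, (n <= i)%N -> cty A i = 0%N) -> torsn n A.
Proof.
move=> aA h; have [N tN] := torsn_large aA; apply/torsn_kap.
have [Nn|/ltnW nN] := leqP N n; first exact/torsn_kap/(torsn_leq Nn).
rewrite -(torsn_kap N A).1 // -(subnKC nN); elim: (N - n)%N => [|m IH]; first by rewrite addn0.
rewrite addnS (kap_pow _ aA) (kap_pow (n + m).+1 aA) kap_cty // h ?leq_addr // addn0.
by rewrite -(kap_pow _ aA) -(kap_pow _ aA).
Qed.

(** The multiplicity of i + 1 is the number of entries above i minus the number above i + 1. *)
Lemma count_gt_perm (s t : seq nat) : all (fun x => 0 < x)%N s -> all (fun x => 0 < x)%N t ->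
  (forall i, count (fun x => i < x)%N s = count (fun x => i < x)%N t) -> perm_eq s t.
Proof.
move=> s0 t0 h; have cE (u : seq nat) i : (count (fun x => i < x)%N u = count_mem i.+1 u + count (fun x => i.+1 < x)%N u)%N.
  elim: u => //= x u ->; case: (ltngtP x i.+1) => /= _; lia.
have c0 u : all (fun x => 0 < x)%N u -> count_mem 0%N u = 0%N.
  by move=> u0; apply/count_memPn/negP => /(allP u0).
apply/allP => -[|i] _ /=; apply/eqP; first by rewrite !c0.
by have := h i; rewrite (cE s i) (cE t i) h => /addIn.
Qed.

(** The counts determine the multiset of exponents of a basis, hence the abelian type and the
    isomorphism class. *)
Lemma cty_epi A B : abp A -> abp B -> cty A =1 cty B -> exists e : epi A B, injective e.
Proof.
move=> aA aB AB; have [cA pA] := aA; have [cB pB] := aB.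
have [a [ta pa ca]] := cty_count aA; have [b [tb pb cb]] := cty_count aB.
have pos C (c : seq C) : map (@fingroup.order _) c = abelian_type [set: C] ->
    all (fun x => #[x] == p ^ logn p #[x])%N c -> all (fun x => 0 < x)%N (map (fun x => logn p #[x]) c).
  move=> tc pc; apply/allP => _ /mapP[x xc ->]; rewrite lt0n; apply/eqP => x0.
  have := allP pc _ xc; rewrite x0 expn0 => /eqP x1.
  have : #[x] \in abelian_type [set: C] by rewrite -tc map_f.
  by move/(allP (abelian_type_gt1 _)); rewrite x1.
have mapo C (c : seq C) : all (fun x => #[x] == p ^ logn p #[x])%N c ->
    map (@fingroup.order _) c = map (fun m => p ^ m)%N (map (fun x => logn p #[x]) c).
  by move=> pc; rewrite -map_comp; apply/eq_in_map => x /(allP pc)/eqP.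
have ab : perm_eq (map (fun x => logn p #[x]) a) (map (fun x => logn p #[x]) b).
  apply: count_gt_perm; [exact: pos|exact: pos|] => i.
  by rewrite !count_map -[LHS](ca i) -[RHS](cb i).
have : abelian_type [set: A] = abelian_type [set: B].
  apply: (sorted_eq (leT := geq)); [exact: rev_trans leq_trans|by move=> x y; rewrite andbC; exact: anti_leq| | |].
  - exact: abelian_type_sorted.
  - exact: abelian_type_sorted.
  - by rewrite -ta -tb !mapo //; exact: perm_map.
move/eqP; rewrite -(eq_abelian_type_isog cA cB) => /isogP[f fi fT].
have fM : {morph f : x y / x * y} by move=> x y; rewrite morphM ?inE.
have fs y : exists x, f x = y.
  have : y \in f @* [set: A] by rewrite fT inE.
  by case/morphimP => x _ _ ->; exists x.
by exists (mkepi fM fs) => x y /(injmP fi); apply; rewrite inE.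
Qed.

Lemma epi_cty A B (e : epi A B) : injective e -> cty A =1 cty B.
Proof.
move=> ei; have k n : kap n A = kap n B.
  rewrite /kap -(card_imset _ ei); apply: eq_card => y; rewrite !inE.
  apply/imsetP/eqP => [[x]|h]; first by rewrite inE => /eqP x1 ->; rewrite -epiX x1 epi1.
  have [x xy] := epi_surj e y; exists x => //; rewrite inE.
  by apply/eqP/ei; rewrite epiX xy h epi1.
by move=> i; rewrite /cty !k.
Qed.
End AbelianGroups.

(** * Groups with prescribed invariant factors, and the truncation of abelian p-groups *)

Lemma count_iota_lt m r : count (fun j => j < m)%N (iota 0 r) = minn m r.
Proof.
elim: r => [|r IH]; first by rewrite minn0.
by rewrite -addn1 iotaD count_cat IH /= add0n; lia.
Qed.

(** A downward closed predicate holds on an initial segment whose length is its count; this is the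
    duality between a partition and its conjugate. *)
Lemma count_down (P : pred nat) N i : (forall i j, (i <= j)%N -> P j -> P i) ->
  (i < count P (iota 0 N))%N = (i < N)%N && P i.
Proof.
move=> Pd; have [iN|Ni] := ltnP i N; last first.
  by apply/negbTE; rewrite -leqNgt (leq_trans (count_size _ _)) // size_iota.
have [Pi|nPi] /= := boolP (P i).
  rewrite -(subnKC iN) iotaD count_cat; have /eqP -> : count P (iota 0 i.+1) == i.+1.
    rewrite -{2}(size_iota 0 i.+1) -all_count; apply/allP => j; rewrite mem_iota => ji.
    by apply: Pd Pi; lia.
  exact: leq_addr.
apply/negbTE; rewrite -leqNgt -(subnKC (ltnW iN)) iotaD count_cat.
have -> : count P (iota (0 + i) (N - i)) = 0%N.
  apply/eqP; rewrite -leqn0 leqNgt -has_count; apply/hasPn => j; rewrite mem_iota => ji.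
  by apply: contra nPi; apply: Pd; lia.
by rewrite addn0 (leq_trans (count_size _ _)) // size_iota.
Qed.

Section Realization.
Context (p : nat) (p_pr : prime p).
Local Open Scope group_scope.
Implicit Types (A B C : finGroupType) (n m i : nat).

Lemma cyclic_realize v : exists2 C : finGroupType, abp p C & forall n, logn p (kap p n C) = minn n v.
Proof.
have q0 : (0 < p ^ v)%N by rewrite expn_gt0 prime_gt0.
(* The cyclic group of order p^v, written with a successor so that the ordinal type carries its
   additive group structure. *)
pose C : finGroupType := 'I_(p ^ v).-1.+1.
have cC : #|[set: C]| = (p ^ v)%N by rewrite cardsT card_ord prednK.
pose z : C := Zp1; have zC : [set: C] = <[z]> by exact: Zp_cycle.
have oz : #[z] = (p ^ v)%N by rewrite -cC zC.
have aC : abp p C.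
  split; first by rewrite zC cycle_abelian.
  by rewrite /pgroup cC pnatX pnat_id.
exists C => // n; rewrite (kapE n aC) zC (Ohm_p_cycle n (p := p)); last by rewrite /p_elt oz pnatX pnat_id.
rewrite -[#|_|]/(#[_]) oz pfactorK // orderXdiv; last by rewrite oz dvdn_exp2l // leq_subr.
rewrite oz -expnB ?prime_gt0 ?leq_subr // pfactorK //; lia.
Qed.

Lemma prodX A B (x : A * B) n : x ^+ n = (x.1 ^+ n, x.2 ^+ n).
Proof. by elim: n => [|n IH] //; rewrite !expgS IH. Qed.

Lemma kap_prod A B n : kap p n (A * B)%type = (kap p n A * kap p n B)%N.
Proof.
rewrite /kap -cardsX; apply: eq_card => -[x y]; rewrite !inE prodX /=.
by [].
Qed.

Lemma abp_prod A B : abp p A -> abp p B -> abp p (A * B)%type.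
Proof.
move=> [cA pA] [cB pB]; split.
  by apply/centsP => -[x y] _ [x' y'] _; congr pair; [exact: (centsP cA)|exact: (centsP cB)].
by move: pA pB; rewrite /pgroup !cardsT card_prod pnatM => -> ->.
Qed.

Lemma list_realize (s : seq nat) : exists2 A : finGroupType, abp p A &
  forall n, logn p (kap p n A) = (\sum_(v <- s) minn n v)%N.
Proof.
elim: s => [|v s [A aA AE]].
  have [A aA AE] := cyclic_realize 0; exists A => // n.
  by rewrite AE big_nil minn0.
have [C aC CE] := cyclic_realize v; exists (C * A)%type => [|n]; first exact: abp_prod.
by rewrite kap_prod lognM ?kap_gt0 // CE AE big_cons.
Qed.

Lemma cty_realize (s : seq nat) : exists2 A : finGroupType, abp p A &
  forall i, cty p A i = count (fun v => i < v)%N s.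
Proof.
have [A aA AE] := list_realize s; exists A => // i; rewrite /cty !AE {AE}.
elim: s => [|v s IH]; first by rewrite !big_nil.
rewrite !big_cons /= -IH; have : (\sum_(v <- s) minn i v <= \sum_(v <- s) minn i.+1 v)%N.
  by apply: leq_sum => w _; lia.
by move: (\sum_(v <- s) _)%N (\sum_(v <- s) _)%N => a b; lia.
Qed.

(** The exponents of the group are the conjugate partition of h cut off at N: for each j < r, the
    number of i < N with h i > j. *)
Lemma antitone_realize r h N : antitone_le r h -> exists A : finGroupType,
  [/\ abp p A, ('r_p([set: A]) <= r)%N, torsn p N A & forall i, (i < N)%N -> cty p A i = h i].
Proof.
move=> [ha hr]; have [A aA AE] := cty_realize [seq count (fun i => j < h i)%N (iota 0 N) | j <- iota 0 r].
have {}AE i : cty p A i = if (i < N)%N then h i else 0%N.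
  rewrite AE count_map (eq_count (a2 := fun j => (i < N) && (j < h i))%N).
    by case: (i < N)%N; rewrite ?count_pred0 // count_iota_lt; have := hr i; lia.
  by move=> j /=; apply: count_down => a b ab jb; apply: leq_trans jb (ha _ _ ab).
exists A; split=> // [||i iN]; last by rewrite AE iN.
  by rewrite -cty0 // AE; case: ifP.
by apply: (cty_tors p_pr) => // i Ni; rewrite AE ltnNge Ni.
Qed.
End Realization.

Section AbelianTruncation.
Context (p r : nat) (p_pr : prime p).
Local Notation U := (abelian_p_rank_le p r).
Local Open Scope group_scope.
Implicit Types (A B C : grp U) (n m i : nat).

Lemma grp_abp A : abp p A.
Proof. by case: (grpP A). Qed.

Lemma quo_le n A : U (quo n A).
Proof.
have [cA pA rA] := grpP A; have aA := grp_abp A.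
have [cQ pQ] := abp_epi (quo_proj n A) aA; split=> //.
exact: leq_trans (p_rank_epi (quo_proj n A) aA) rA.
Qed.

Definition quo_grp n A : grp U := Grp (quo_le n A).

Definition quo_map n A B (e : epi A B) : epi (quo_grp n A) (quo_grp n B) :=
  sval (cid (quo_map_ex n e (grp_abp A))).

Lemma quo_mapE n A B (e : epi A B) x : quo_map n e (quo_proj n A x) = quo_proj n B (e x).
Proof. exact: (svalP (cid (quo_map_ex n e (grp_abp A)))). Qed.

(** One group is chosen for each function c that is realized, so there are at most (r + 1)^n
    types. *)
Definition type_rep n (c : {ffun 'I_n -> 'I_r.+1}) : seq (grp U) :=
  if pselect (exists A : grp U, torsn p n A /\ forall i : 'I_n, cty p A i = c i) is left h
  then [:: sval (cid h)] else [::].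

Definition type_list n : seq (grp U) := List.flat_map (@type_rep n) (enum {: {ffun 'I_n -> 'I_r.+1}}).

Lemma mem_In (X : eqType) (x : X) s : x \in s -> List.In x s.
Proof. by elim: s => //= y s IH; rewrite inE => /orP[/eqP ->|/IH]; [left|right]. Qed.

Lemma type_list_tors n G : List.In G (type_list n) -> torsn p n G.
Proof.
case/List.in_flat_map => c [_]; rewrite /type_rep; case: pselect => //= h [<-|//].
by case: (svalP (cid h)).
Qed.

Lemma cty_le A i : (cty p A i <= r)%N.
Proof.
have [_ _ rA] := grpP A; apply: leq_trans rA; rewrite -cty0 //; last exact: grp_abp.
exact: (@cty_antitone p p_pr A 0 i (grp_abp A) (leq0n i)).
Qed.

Lemma cty_tors_epi n A B : torsn p n A -> torsn p n B ->
  (forall i, (i < n)%N -> cty p A i = cty p B i) -> exists e : epi A B, injective e.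
Proof.
move=> tA tB h; apply: (cty_epi p_pr (grp_abp A) (grp_abp B)) => i.
have [/h//|ni] := ltnP i n.
by rewrite (cty_large (grp_abp A) tA ni) (cty_large (grp_abp B) tB ni).
Qed.

Lemma type_listP n A : torsn p n A -> exists G, List.In G (type_list n) /\ exists e : epi A G, injective e.
Proof.
move=> tA; pose c : {ffun 'I_n -> 'I_r.+1} := [ffun i : 'I_n => inord (cty p A i)].
have cE (i : 'I_n) : cty p A i = c i by rewrite ffunE inordK // ltnS cty_le.
have h : exists A : grp U, torsn p n A /\ forall i : 'I_n, cty p A i = c i by exists A.
have [tG GE] := svalP (cid h); exists (sval (cid h)); split; last first.
  by apply: cty_tors_epi tA tG _ => i iN; rewrite (cE (Ordinal iN)) (GE (Ordinal iN)).
apply/List.in_flat_map; exists c; split; first by apply: mem_In; rewrite mem_enum.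
by rewrite /type_rep; case: pselect => //= h'; left; rewrite (Prop_irrelevance h' h).
Qed.

Lemma abelian_epi_conj A B (f g : epi A B) : epi_conj f g -> f =1 g.
Proof.
case=> h hP x; rewrite hP conjgE; have [cB _ _] := grpP B.
by have -> : (f x * h = h * f x)%g by [apply: (centsP cB)]; rewrite mulKg.
Qed.

Definition abelian_truncation : truncation U.
Proof.
refine (@Truncation U abelian_epi_conj quo_grp (fun n A => quo_proj n A) quo_map quo_mapE _ _ _ type_list _ _).
- by move=> n A; apply/(quo_proj_inj _ (abp_epi (quo_proj n A) (grp_abp A))); exact: quo_tors (grp_abp A).
- move=> m n A mn /(quo_proj_inj _ (grp_abp _)) h.
  by apply/(quo_proj_inj _ (grp_abp _)); exact: torsn_leq mn h.
- move=> A; have [n tA] := torsn_large (grp_abp A).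
  by exists n; apply/(quo_proj_inj _ (grp_abp _)).
- by move=> n G /type_list_tors h; apply/(quo_proj_inj _ (grp_abp _)).
by move=> n A /(quo_proj_inj _ (grp_abp _)); exact: type_listP.
Defined.
End AbelianTruncation.
(** * The spectrum *)
Section SpectrumCode.
Context (p r : nat) (k : fieldType) (p_pr : prime p).
Hypothesis (k0 : [pchar k]%R =i pred0).
Local Notation U := (abelian_p_rank_le p r).
Local Notation T := (abelian_truncation r p_pr).
Local Notation spectrum := (balmer_spectrum k U).
Implicit Types (A B G : grp U) (X : cpx k U) (P Q : spc k U) (i N M : nat).

Lemma torsP N A : tors T N A <-> torsn p N A.
Proof. exact: (quo_proj_inj _ (grp_abp A)). Qed.

Definition point P : nat -> grp U := sval (cid (prime_pointP T k0 (spcP P))).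

Lemma point_coherent P : coherent T (point P).
Proof. by case: (svalP (cid (prime_pointP T k0 (spcP P)))). Qed.

Lemma point_types P N : List.In (point P N) (ttypes T N).
Proof. by have [_ h _] := svalP (cid (prime_pointP T k0 (spcP P))); exact: h. Qed.

Lemma pointP P X : P X <-> prime_at (point P) X.
Proof. by have [_ _ h] := svalP (cid (prime_pointP T k0 (spcP P))); exact: h. Qed.

Lemma point_tors P N : torsn p N (point P N).
Proof. by apply/torsP; case: (point_coherent P) => h _; exact: h. Qed.

Lemma point_mem P X N : tr T N X -> compact_obj X -> (P X <-> acyc (point P N) X).
Proof. by move=> tX cX; rewrite pointP; apply: prime_atP tX cX; exact: point_coherent. Qed.

Lemma coherent_cty v i N : coherent T v -> (i < N)%N -> cty p (v N) i = cty p (v i.+1) i.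
Proof.
case=> _ h iN; have [e /(epi_cty p) <-] := h _ _ iN.
by rewrite [RHS](cty_quo i.+1 i (grp_abp (v N))) ltnSn.
Qed.

(** Level i + 1 is the first at which invariant factors of order greater than p^i are visible. *)
Definition code P i : nat := cty p (point P i.+1) i.

Lemma codeE P i N : (i < N)%N -> cty p (point P N) i = code P i.
Proof. exact: coherent_cty (point_coherent P). Qed.

Lemma code_le P : antitone_le r (code P).
Proof.
split=> [i j ij|i]; last exact: cty_le.
rewrite -(@codeE P i j.+1) // -(@codeE P j j.+1) //.
exact: (@cty_antitone p p_pr _ i j (grp_abp _) ij).
Qed.

Lemma point_epi P Q N : (forall i, (i < N)%N -> code P i = code Q i) ->
  exists e : epi (point P N) (point Q N), injective e.
Proof.
move=> h; apply: (cty_tors_epi p_pr (@point_tors P N) (@point_tors Q N)) => i iN.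
by rewrite !codeE // h.
Qed.

(** An N-truncated object sees only the N-th group of the point, whose type is given by N values of
    the code. *)
Lemma code_mem P Q X N : tr T N X -> compact_obj X ->
  (forall i, (i < N)%N -> code P i = code Q i) -> (P X <-> Q X).
Proof.
move=> tX cX /point_epi[e ei]; rewrite (point_mem P tX cX) (point_mem Q tX cX).
exact: (iff_sym (acyc_inj X ei)).
Qed.

Lemma code_inj P Q : code P =1 code Q -> P = Q.
Proof.
move=> h; have PQ X : P X <-> Q X.
  split=> [PX|QX].
    have cX := prime_compact (spcP P) PX; have [[N tX] _] := (compactP T k0 X).1 cX.
    by apply/(code_mem tX cX (Q := Q) (P := P)) => // i _.
  have cX := prime_compact (spcP Q) QX; have [[N tX] _] := (compactP T k0 X).1 cX.
  by apply/(code_mem tX cX (Q := Q) (P := P)) => // i _.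
case: P Q {h} PQ => [P hP] [Q hQ] /= PQ.
have e : P = Q by apply/funext => X; exact/propext.
by subst Q; rewrite (Prop_irrelevance hP hQ).
Qed.

Lemma chi_tr N G : tr T N (chi_cpx k T N G).
Proof. exact/conv_tr/isoT_trunc. Qed.

Lemma chi_mem P N G : P (chi_cpx k T N G) <-> ~ isoT T N G (point P N).
Proof.
rewrite (point_mem P (@chi_tr N G) (chi_compact T k0 N G 0)); exact: lin_acyc.
Qed.

Lemma isoT_cty N G A : tors T N A -> isoT T N G A <-> cty p A =1 cty p G.
Proof.
move=> tA; have qE : cty p (trunc T N A) =1 cty p A by apply/fsym/(epi_cty p tA).
split=> [[f /(epi_cty p) fE] i|h]; first by rewrite -fE qE.
by apply: (cty_epi p_pr (grp_abp _) (grp_abp _)) => i; rewrite qE h.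
Qed.

Lemma code_surj h : antitone_le r h -> exists P : spc k U, code P =1 h.
Proof.
move=> hh; have ex N : exists A : grp U, torsn p N A /\ forall i, (i < N)%N -> cty p A i = h i.
  have [A [[cA pA] rA tA AE]] := antitone_realize p_pr N hh.
  by exists (Grp (And3 cA pA rA)).
pose v N := sval (cid (ex N)); have vP N : torsn p N (v N) /\ forall i, (i < N)%N -> cty p (v N) i = h i.
  exact: (svalP (cid (ex N))).
have vc : coherent T v.
  split=> [N|N M NM]; first by apply/torsP; exact: (vP N).1.
  apply: (cty_tors_epi p_pr (n := N)).
  - exact: quo_tors (grp_abp _).
  - exact: (vP N).1.
  move=> i iN; rewrite [LHS](cty_quo N i (grp_abp (v M))) iN (vP N).2 // (vP M).2 //.
  exact: leq_trans iN NM.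
exists (SpcPoint (prime_at_prime k0 vc)) => i; set P := SpcPoint _.
(* The chi of the chosen group lies outside the prime, which forces [point P] to have that type at
   level i + 1. *)
have : ~ P (chi_cpx k T i.+1 (v i.+1)).
  rewrite -[P _]/(prime_at v _) (prime_atP vc (@chi_tr i.+1 (v i.+1)) (chi_compact T k0 i.+1 (v i.+1) 0)) => /lin_acyc; apply.
  by apply/isoT_cty => //; apply/torsP; exact: (vP i.+1).1.
rewrite chi_mem => /contrapT/isoT_cty e; rewrite /code e; last by apply/torsP; exact: point_tors.
by rewrite (vP i.+1).2.
Qed.

Lemma opn_true_eq (S : Defs.space) (A B : S -> Prop) : (forall x, A x <-> B x) -> opn A -> opn B.
Proof. by move=> AB; have -> : A = B by apply/funext => x; exact/propext. Qed.

Lemma spectrum_opn (A : spectrum -> Prop) : opn A <-> forall P, A P ->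
  exists N, forall Q, (forall i, (i < N)%N -> code Q i = code P i) -> A Q.
Proof.
split=> [oA|h].
  elim: oA => {A} [A [X cX ->]|P _|A B _ IA _ IB P [AP BP]|C _ IC P [A CA AP]].
  - move=> P PX; have [[N tX] _] := (compactP T k0 X).1 cX; exists N => Q QP.
    by move=> nQ; apply: PX => PX; apply: nQ; apply/(code_mem tX cX (Q := P) (P := Q)).
  - by exists 0%N.
  - have [N NA] := IA P AP; have [M MB] := IB P BP; exists (maxn N M) => Q QP.
    by split; [apply: NA|apply: MB] => i iN; apply: QP; rewrite leq_max iN ?orbT.
  - have [N NA] := IC A CA P AP; exists N => Q QP; exists A => //; exact: NA.
(* A cylinder is a finite intersection of basic open sets: a prime contains chi of every type except
   that of its own N-th group, so requiring all chi other than that of [point P N] fixes the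
   type. *)
have cyl P N : opn (fun Q : spectrum => forall i, (i < N)%N -> code Q i = code P i).
  have ol (l : list (grp U)) : opn (fun Q : spectrum => forall G, List.In G l ->
      ~ isoT T N G (point P N) -> Q (chi_cpx k T N G)).
    elim: l => [|G l IH]; first by apply: (opn_true_eq (A := fun _ => True)) (opn_full _) => Q; split.
    have oG : opn (fun Q : spectrum => ~ isoT T N G (point P N) -> Q (chi_cpx k T N G)).
      have [iG|nG] := pselect (isoT T N G (point P N)).
        by apply: (opn_true_eq (A := fun _ => True)) (opn_full _) => Q; split.
      apply: (opn_true_eq (S := spectrum) (A := fun Q => ~ supp (chi_cpx k T N G) Q)).
        by move=> Q; split=> [/contrapT//|/(_ nG) q]; apply.
      by apply: generated_in; exists (chi_cpx k T N G) => //; exact: chi_compact.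
    apply: opn_true_eq (opn_cap oG IH) => Q; split=> [[a b] H [<-//|]|a]; first exact: b.
    by split=> [|H Hl]; apply: a; [left|right].
  apply: opn_true_eq (ol (ttypes T N)) => Q; split=> [a i iN|a G _ nG].
    have : ~ Q (chi_cpx k T N (point Q N)).
      by rewrite chi_mem; apply; apply/isoT_cty => //; apply/torsP; exact: point_tors.
    have := a _ (point_types Q N); have [/isoT_cty e _ _|nG /(_ nG)//] := pselect (isoT T N (point Q N) (point P N)).
    by rewrite -(codeE Q iN) -(codeE P iN) e //; apply/torsP; exact: point_tors.
  apply/chi_mem => /isoT_cty e; apply: nG; apply/isoT_cty; first by apply/torsP; exact: point_tors.
  move=> i; rewrite -e; last by apply/torsP; exact: point_tors.
  have [/[dup] iN /a|Ni] := ltnP i N; first by rewrite !codeE.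
  by rewrite !(cty_large (grp_abp _) (@point_tors _ N) Ni).
apply: (opn_true_eq (A := fun Q : spectrum => exists2 C, (exists2 P, A P & exists2 N,
  (forall Q, (forall i, (i < N)%N -> code Q i = code P i) -> A Q) & C = (fun Q : spectrum => forall i, (i < N)%N -> code Q i = code P i)) & C Q)).
  move=> Q; split=> [[C [P AP [N NA ->]] QP]|AQ]; first exact: NA.
  have [N NA] := h Q AQ; exists (fun R : spectrum => forall i, (i < N)%N -> code R i = code Q i) => //.
  by exists Q => //; exists N.
by apply: opn_cup => C [P AP [N NA ->]]; exact: cyl.
Qed.

Lemma spectrum_coded : coded r (T := spectrum) code.
Proof.
split; [exact: code_le|exact: code_inj|exact: code_surj|exact: spectrum_opn].
Qed.
End SpectrumCode.

(** * Coding of decreasing sequences by conjugate partitions *)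

Section DecreasingSequences.
Local Open Scope classical_set_scope.
Implicit Types (a b : natinf) (i j N : nat).

Definition ltinf i a : bool := if a is Some m then (i < m)%N else true.

(** The fibres of truncation at N give the neighbourhoods in the compactification: single numbers
    below N, and all numbers from N on together with infinity. *)
Definition cap N a : nat := if a is Some m then minn m N else N.

Lemma ltinf_cap i N a : (i < N)%N -> ltinf i a = (i < cap N a)%N.
Proof. by case: a => [m|] /= iN; lia. Qed.

Lemma cap_le N a : (cap N a <= N)%N.
Proof. by case: a => [m|] /=; lia. Qed.

Lemma cap_eqP N a b : cap N a = cap N b <-> forall i, (i < N)%N -> ltinf i a = ltinf i b.
Proof.
split=> [ab i iN|h]; first by rewrite !(ltinf_cap _ iN) ab.
have := cap_le N a; have := cap_le N b.
case: (ltngtP (cap N a) (cap N b)) => // [ab bN _|ba _ aN].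
  by have := h (cap N a); rewrite !(@ltinf_cap _ N) ?ab ?ltnn //; [move=> /(_ (leq_trans ab bN))|exact: leq_trans ab bN|exact: leq_trans ab bN].
by have := h (cap N b); rewrite !(@ltinf_cap _ N) ?ba ?ltnn //; [move=> /(_ (leq_trans ba aN))|exact: leq_trans ba aN|exact: leq_trans ba aN].
Qed.

Lemma ltinf_anti i j a : (i <= j)%N -> ltinf j a -> ltinf i a.
Proof. by case: a => [m|] //= ij; exact: leq_ltn_trans. Qed.

Lemma natinf_leP a b : natinf_le a b <-> forall i, ltinf i a -> ltinf i b.
Proof.
case: a b => [m|] [n|] /=; split=> //.
- by move=> mn i im; exact: leq_trans mn.
- by move=> h; rewrite leqNgt; apply/negP => /h; rewrite ltnn.
- by move=> /(_ n erefl); rewrite ltnn.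
Qed.

Lemma ltinf_ext a b : (forall i, ltinf i a = ltinf i b) -> a = b.
Proof.
move=> h; have ab : natinf_le a b by apply/natinf_leP => i; rewrite h.
have ba : natinf_le b a by apply/natinf_leP => i; rewrite h.
case: a b {h} ab ba => [m|] [n|] //= mn nm; congr Some; apply/eqP; lia.
Qed.

Lemma nbhs_natinf a (B : set natinf) :
  nbhs a B <-> exists N, forall b, cap N b = cap N a -> B b.
Proof.
split=> [|[N NB]].
  case: a => [m /nbhs_singleton Bm|[K [cK _] KB]].
    by exists m.+1 => -[n|] /= h; last lia; have -> : n = m by lia.
  (* A compact set of the discrete space is bounded, shown by covering it with neighbourhoods near
     infinity. *)
  have : \forall n \near \oo, K `<=` [set x | (x <= n)%N].
    move/compact_near_coveringP: cK; apply=> x _.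
    exists ([set x], [set n | (x <= n)%N]); last by move=> [y n] /= [->].
    split; last exact: nbhs_infty_ge.
    exact/principal_filterP.
  case=> N _ /(_ N (leqnn N)) KN; exists N.+1 => -[n|] /= h; last by apply: KB; right.
  by apply: KB; left; exists n => // /KN /=; lia.
case: a NB => [m|] NB; first by apply/principal_filterP/NB.
exists [set x | (x < N)%N]; last by move=> [n|] /= => [[[x xN [<-]]|//]|_]; apply: NB => /=; lia.
split; first exact/finite_compact/finite_II.
exact: discrete_closed.
Qed.

Context (r : nat).
Implicit Types v w : decreasing_space r.

Definition entry v (j : 'I_r) : natinf := set_val v j.

Lemma entry_anti v (j j' : 'I_r) : (j <= j')%N -> natinf_le (entry v j') (entry v j).
Proof. by move=> jj; exact: (set_mem (valP v)). Qed.

Definition entry_gt v i j : bool := if insub j is Some j' then ltinf i (entry v j') else false.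

Lemma entry_gtE v i (j : 'I_r) : entry_gt v i j = ltinf i (entry v j).
Proof. by rewrite /entry_gt valK. Qed.

Lemma entry_gt_down v i j j' : (j <= j')%N -> entry_gt v i j' -> entry_gt v i j.
Proof.
rewrite {1}/entry_gt; case: insubP => // l _ <- jl h.
have jr := leq_ltn_trans jl (ltn_ord l).
rewrite -[j]/(val (Ordinal jr)) entry_gtE; exact: (natinf_leP _ _).1 (entry_anti (j := Ordinal jr) v jl) _ h.
Qed.

(* The conjugate partition: the number of entries exceeding [i]. *)
Definition conj_code v i : nat := count (entry_gt v i) (iota 0 r).

Lemma conj_codeP v i (j : 'I_r) : (j < conj_code v i)%N = ltinf i (entry v j).
Proof. by rewrite /conj_code count_down ?ltn_ord ?entry_gtE // => a b; exact: entry_gt_down. Qed.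

Lemma conj_code_le v : antitone_le r (conj_code v).
Proof.
split=> [i j ij|i]; last by rewrite (leq_trans (count_size _ _)) // size_iota.
apply: sub_count => l; rewrite /entry_gt; case: insubP => // l' _ _; exact: ltinf_anti.
Qed.

Lemma conj_code_eqP v w i : conj_code v i = conj_code w i <->
  forall j : 'I_r, ltinf i (entry v j) = ltinf i (entry w j).
Proof.
split=> [h j|h]; first by rewrite -!conj_codeP h.
by apply: eq_count => l; rewrite /entry_gt; case: insubP.
Qed.

Lemma conj_code_inj v w : conj_code v =1 conj_code w -> v = w.
Proof.
move=> h; apply: val_inj; apply/funext => j; apply: ltinf_ext => i.
exact: (conj_code_eqP v w i).1 (h i) j.
Qed.

Lemma conj_code_surj h : antitone_le r h -> exists v, conj_code v =1 h.
Proof.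
move=> [ha hr].
(* Inverse conjugation: entry j is the least i with h i <= j, and infinity when h stays above j. *)
pose f (j : 'I_r) : natinf := if pselect (exists i, (h i <= j)%N) is left e then Some (ex_minn e) else None.
have fE i (j : 'I_r) : ltinf i (f j) = (j < h i)%N.
  rewrite /f; case: pselect => [e|ne] /=.
    case: ex_minnP => m hm mm; apply/idP/idP => [im|ji]; rewrite ltnNge.
      by apply/negP => /mm; lia.
    by apply: contraTN ji => mi; rewrite -leqNgt; exact: leq_trans (ha _ _ mi) hm.
  by apply/esym; rewrite ltnNge; apply/negP => hi; apply: ne; exists i.
have fD : decreasing_seqs f.
  by move=> i j ij; apply/natinf_leP => l; rewrite !fE; exact: leq_ltn_trans.
exists (exist _ f (mem_set fD)) => i; rewrite /conj_code.
rewrite (eq_in_count (a2 := fun j => (j < h i)%N)) ?count_iota_lt; first by have := hr i; lia.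
move=> j; rewrite mem_iota /= => jr.
by rewrite -[j]/(val (Ordinal jr)) entry_gtE -fE.
Qed.

Lemma conj_code_opn (A : decreasing_space r -> Prop) : opn A <-> forall v, A v ->
  exists N, forall w, (forall i, (i < N)%N -> conj_code w i = conj_code v i) -> A w.
Proof.
(* Exchanging the quantifiers over values i and positions j turns prefixes of the code into boxes of
   the product topology. *)
have capE v w N : (forall i, (i < N)%N -> conj_code w i = conj_code v i) <->
    forall j : 'I_r, cap N (entry w j) = cap N (entry v j).
  split=> [h j|h i iN]; first by apply/cap_eqP => i /h /conj_code_eqP.
  by apply/conj_code_eqP => j; move: i iN; apply/cap_eqP.
split=> [[W oW <-] v Wv|h].
  (* The filter generated by the boxes around v converges to v in each coordinate, hence in the
     product. *)
  pose F : set_system (prod_topology (fun _ : 'I_r => natinf)) :=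
    filter_from setT (fun N => [set x | forall j : 'I_r, cap N (x j) = cap N (entry v j)]).
  have capM N M a b : (N <= M)%N -> cap M a = cap M b -> cap N a = cap N b.
    by move=> NM /cap_eqP ab; apply/cap_eqP => i iN; apply: ab; exact: leq_trans NM.
  have FF : Filter F.
    apply: filter_from_filter; first by exists 0%N.
    move=> N M _ _; exists (maxn N M) => // x xP; split=> j.
      exact: capM (leq_maxl _ _) (xP j).
    exact: capM (leq_maxr _ _) (xP j).
  have Fv : F --> (set_val v : prod_topology (fun _ : 'I_r => natinf)).
    apply/cvg_sup => j B; rewrite nbhsE => -[_ [[V oV <-] Vv] VB].
    have /nbhs_natinf[N NV] : nbhs (entry v j) V by apply: open_nbhs_nbhs.
    by exists N => // x xP; apply: VB; apply: NV; exact: xP.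
  have [N _ NW] : F W by apply: Fv; exact: open_nbhs_nbhs.
  by exists N => w /capE wv; apply: NW.
rewrite -[opn A]/(open A) openE => v /h[N NA].
pose f (j : 'I_r) := [set w : set_type (@decreasing_seqs r) | cap N (entry w j) = cap N (entry v j)].
have fv (j : 'I_r) : nbhs (v : set_type (@decreasing_seqs r)) (f j).
  have cj : continuous (fun w : set_type (@decreasing_seqs r) => entry w j).
    move=> w; apply: (@continuous_comp _ _ _ set_val (fun x : prod_topology (fun _ : 'I_r => natinf) => x j)).
      exact: initial_continuous.
    exact: (@proj_continuous _ (fun _ : 'I_r => natinf) j).
  apply: (cj v [set a | cap N a = cap N (entry v j)]).
  by apply/nbhs_natinf; exists N.
(* A box is a neighbourhood because it constrains only r coordinates. *)
have := @filter_forall _ 'I_r f _ (nbhs_filter (v : set_type (@decreasing_seqs r))) fv.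
by apply: filterS => w wv; apply: NA; apply/capE.
Qed.

Lemma decreasing_coded : coded r conj_code.
Proof.
split; [exact: conj_code_le|exact: conj_code_inj|exact: conj_code_surj|exact: conj_code_opn].
Qed.
End DecreasingSequences.

Theorem theorem2 (p r : nat) (k : fieldType)
  (hp : prime p) (hr : (0 < r)%N) (hk : [pchar k]%R =i pred0) :
  [/\ hausdorff (balmer_spectrum k (abelian_p_rank_le p r)),
      homeomorphic (balmer_spectrum k (abelian_p_rank_le p r))
                   (decreasing_space r) &
      has_cb_rank (balmer_spectrum k (abelian_p_rank_le p r)) (ord_of_nat r)].
Proof.
have sC := spectrum_coded r hp hk; split.
- exact: coded_hausdorff sC.
- exact: coded_homeomorphic sC (decreasing_coded r).
- exact: coded_cb_rank sC.
Qed.
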